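(* Let $d\ge1$ be a fixed integer. For each $n$, let $A_n=P^{(1)}+\dots+P^{(d)}$ be the sum of $d$ independent uniform random $n\times n$ permutation matrices, and let $$\widehat\chi_n(z)=\frac1{\sqrt d}\det\left(I_n-z\frac{A_n}{\sqrt d}\right).$$ Let $(\Lambda_\ell)_{\ell\ge1}$ be independent random variables with $\Lambda_\ell\sim\mathrm{Poisson}(d^\ell/\ell)$, let $\overline{\Lambda_\ell}=\Lambda_\ell-\mathbb{E}[\Lambda_\ell]$, and let $$Y_d(z)=\sum_{k\ge1}\frac{z^k}{k\,d^{k/2}}\sum_{\ell\mid k}\ell\,\overline{\Lambda_\ell},\qquad z\in D_1 .$$ Then, as $n\to\infty$, $$\widehat\chi_n(z)\xrightarrow{\ \mathrm{law}\ }\left(\frac1{\sqrt d}-z\right)\frac{e^{-Y_d(z)}}{\mathbb{E}[e^{-Y_d(z)}]}$$ for the topology of uniform convergence on compact subsets of $D_1$.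
   Context: $D_1=\{z\in\mathbb{C}:|z|<1\}$. Convergence in law is that of random elements of the space $H(D_1)$ of analytic functions on $D_1$, equipped with the topology of uniform convergence on compact subsets of $D_1$. The random power series $Y_d$ almost surely converges to an analytic function on $D_1$. A uniform random permutation matrix is $P=(\mathbf 1_{\pi(i)=j})_{1\le i,j\le n}$ with $\pi$ uniform in $S_n$. *)

(* Defs.v *)
From HB Require Import structures.
From mathcomp Require Export all_boot all_order all_algebra perm.
From mathcomp Require Export all_classical all_reals all_analysis.
From mathcomp.real_closed Require Export complex.

Set Implicit Arguments.
Unset Strict Implicit.
Unset Printing Implicit Defensive.

Import Order.TTheory GRing.Theory Num.Theory.
Import numFieldNormedType.Exports.

Local Open Scope classical_set_scope.
Local Open Scope ring_scope.
Local Open Scope complex_scope.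

(* The topological and normed structures are inherited from the regular module
   R[i]^o, as the library does for abstract numeric fields. *)
HB.instance Definition _ (R : rcfType) := GRing.ComAlgebra.copy R[i] R[i]^o.
HB.instance Definition _ (R : rcfType) := Vector.copy R[i] R[i]^o.
HB.instance Definition _ (R : rcfType) := NormedModule.copy R[i] R[i]^o.
HB.instance Definition _ (R : rcfType) := Num.ClosedField.on R[i].

Definition unit_disc (R : realType) : set R[i] := [set z | `|z| < 1].

(* All functions on the open unit disc, with the topology of uniform
   convergence on its compact subsets. *)
Definition disc_fun (R : realType) : Type :=
  {family compact, set_type (@unit_disc R) -> R[i]}.
HB.instance Definition _ (R : realType) := Uniform.on (disc_fun R).

(* H(D_1), as a subset of [disc_fun R].  Differentiability in the library is
   only available for maps defined on the whole normed module, so an analytic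
   function on the disc is presented as the restriction of a map g on R[i] that
   is complex differentiable at every point of the (open) disc; the values of g
   off the disc are irrelevant. *)
Definition analytic_disc (R : realType) : set (disc_fun R) :=
  [set f | exists2 g : R[i] -> R[i],
     forall z : R[i], unit_disc z -> derivable g z 1 &
     forall z : set_type (@unit_disc R), f z = g (val z)].

(* Measurability is with respect to the Borel sigma-algebra of H(D_1), which is
   the trace on [analytic_disc R] of the Borel sigma-algebra of [disc_fun R]. *)
Definition random_analytic (R : realType) (dT : measure_display)
    (T : measurableType dT) (X : T -> disc_fun R) : Prop :=
  (forall w, analytic_disc (X w)) /\
  (forall U : set (disc_fun R), open U -> measurable (X @^-1` U)).

Definition cvg_in_law (R : realType) (dT : nat -> measure_display)
    (T : forall n, measurableType (dT n)) (P : forall n, probability (T n) R)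
    (X : forall n, T n -> disc_fun R)
    (dT' : measure_display) (T' : measurableType dT') (P' : probability T' R)
    (X' : T' -> disc_fun R) : Prop :=
  [/\ forall n, random_analytic (X n),
      random_analytic X' &
      forall F : disc_fun R -> R,
        {within @analytic_disc R, continuous F} ->
        (exists M : R, forall f, analytic_disc f -> `|F f| <= M) ->
        'E_(P n)[fun w => F (X n w)]%E @[n --> \oo] -->
        'E_P'[fun w => F (X' w)]%E].

(* Mutual independence of the family (X_i) for i in J.  The arbitrary sets A_i
   make this the right notion for random variables with values in a discrete
   measurable space E; it is only used for E = nat and E = 'S_n. *)
Definition mutually_independent (R : realType) (dT : measure_display)
    (T : measurableType dT) (P : probability T R) (I : choiceType) (J : set I)
    (E : Type) (X : I -> T -> E) : Prop :=
  forall (s : seq I) (A : I -> set E), uniq s -> (forall i, i \in s -> J i) ->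
    P (\bigcap_(i in [set` s]) (X i @^-1` A i)) =
    (\prod_(i <- s) P (X i @^-1` A i))%E.

Definition uniform_perm (R : realType) (dT : measure_display)
    (T : measurableType dT) (P : probability T R) (n : nat)
    (p : T -> 'S_n) : Prop :=
  forall s : 'S_n, measurable (p @^-1` [set s]) /\
    P (p @^-1` [set s]) = ((n`!)%:R^-1)%:E.

Definition poisson_rv (R : realType) (dT : measure_display)
    (T : measurableType dT) (P : probability T R) (rate : R)
    (L : {RV P >-> nat}) : Prop :=
  forall k : nat, P (L @^-1` [set k]) = (poisson_pmf rate k)%:E.

Definition sqrtd (R : realType) (d : nat) : R[i] := (Num.sqrt (d%:R : R))%:C.

Definition sum_perm_mx (R : realType) (d n : nat) (p : 'I_d -> 'S_n) :
  'M[R[i]]_n := \sum_(i < d) perm_mx (p i).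

Definition chi_hat (R : realType) (d n : nat) (p : 'I_d -> 'S_n) :
    disc_fun R :=
  fun z => (sqrtd R d)^-1 *
    \det (1%:M - val z *: ((sqrtd R d)^-1 *: sum_perm_mx R p)).

Definition cexp (R : realType) (z : R[i]) : R[i] :=
  (expR (complex.Re z) * cos (complex.Im z)) +i*
  (expR (complex.Re z) * sin (complex.Im z)).

Definition cexpectation (R : realType) (dT : measure_display)
    (T : measurableType dT) (P : probability T R) (Z : T -> R[i]) : R[i] :=
  fine 'E_P[fun w => complex.Re (Z w)]%E +i* fine 'E_P[fun w => complex.Im (Z w)]%E.

Section limit.
Context (R : realType) (dT : measure_display) (T : measurableType dT).
Context (P : probability T R) (d : nat) (L : nat -> {RV P >-> nat}).

Definition centered (l : nat) (w : T) : R :=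
  (L l w)%:R - fine 'E_P[fun w' => (L l w')%:R : R]%E.

Definition Y_partial (w : T) (z : R[i]) (n : nat) : R[i] :=
  \sum_(1 <= k < n) z ^+ k / (k%:R * sqrtd R d ^+ k) *
    (\sum_(l <- divisors k) l%:R * centered l w)%:C.

(* The series converges on the whole disc only almost surely; on the exceptional
   null event Y is set to 0, so that every realisation is an analytic function. *)
Definition Y_series (w : T) (z : R[i]) : R[i] :=
  if `[< forall z', unit_disc z' -> cvgn (Y_partial w z') >]
  then limn (Y_partial w z) else 0.

Definition limit_fun (w : T) : disc_fun R :=
  fun z => ((sqrtd R d)^-1 - val z) * cexp (- Y_series w (val z)) /
    cexpectation P (fun w' => cexp (- Y_series w' (val z))).
End limit.

(* Main.v *)
(* Put G(w) = det(1 - w A_n), h = sqrt d, so that chi_hat z = G(z / h) / h.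
   Newton's identities make the coefficients of G polynomials in the traces
   T_j = tr A_n^j.  Multiplying one of the permutations by a random transposition
   gives an exchangeable pair, and A_n changes by a rank one matrix; comparing the
   two characteristic polynomials shows that the law of (T_1, ..., T_K) satisfies,
   up to O(1/n), the Stein recursion
     t_k p(t) = sum_(l | k) d^l p(t - (l 1_(l | j))_j)
   that characterises T_j = sum_(l | j) l Lambda_l.  Expanding G over partial
   functions and exchanging two values of a permutation bounds E |G_k|^2 by a
   polynomial in k times d^k, which yields tightness in H(D_1) and allows to
   truncate the power series.  On the Poisson side the same recursion gives the
   orthogonality of the coefficients of exp(sum_j (d^j - T_j) w^j / j), hence the
   normalising constant E[exp(-Y_d)] and the convergence of Y_d. *)

Require Import Defs.
From mathcomp Require Import zify ring lra measurable_realfun.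

Set Implicit Arguments.
Unset Strict Implicit.
Unset Printing Implicit Defensive.

Import Order.TTheory GRing.Theory Num.Theory.
Import numFieldNormedType.Exports.

Local Open Scope ring_scope.

(** * Exponential sequences *)

(** Counting the short cycles of a swapped tuple directly is delicate, since a closed path may use
    the two modified arrows several times. The rank one formula replaces this count by an identity
    of power series: if [N] collects the net numbers of closed paths gained, then
    [G' = (1 - X N) G], and as the swap is an involution [N' G' = - N G]. Only the typical case, one
    new closed path and no old one, is solved exactly; all other swaps are charged to an error which
    counts coincidences of walks. Per tuple of permutations the main terms have order [n] and the
    coincidences order one on average, whence the [1/n].

    The recursion determines a law only up to its value at zero. The missing normalisation comes
    from the second moments: they confine the coefficients, hence by Newton the traces, to a finite
    box outside of which both laws have small mass.

    The formal factor [1 - d X] of [exp(- sum T_j X^j / j)], due to the trivial eigenvalue [d],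
    becomes [1 / sqrt d - z]. The remaining factor has orthogonal coefficients on the Poisson side,
    so that its mean is its constant term. *)

Definition shiftseq (R : pzRingType) l (f : nat -> R) k :=
  if (l <= k)%N then f (k - l)%N else 0.

(** Generating functions: the geometric series of [alpha X^l], without its constant term, times
    [(1 - alpha X^l) A] equals [alpha X^l A]. The sum is the coefficient of degree [n.+1], so the
    index [j] stands for the exponent [j.+1]. *)
Lemma telescope_shiftseq (R : comPzRingType) (a : nat -> R) l (alpha : R) n :
  (0 < l)%N ->
  \sum_(j < n.+1) (if (l %| j.+1)%N then alpha ^+ (j.+1 %/ l) else 0) *
    (a (n - j)%N - alpha * shiftseq l a (n - j)%N) =
  alpha * shiftseq l a n.+1.
Proof.
move=> l_gt0; pose f k := a k - alpha * shiftseq l a k.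
rewrite -/(f _); under eq_bigr do rewrite -/(f _).
have f0 : f 0 = a 0.
  by rewrite /f /shiftseq leqn0 gtn_eqF // mulr0 subr0.
elim/ltn_ind: n => n IH.
have [lt_nl|le_ln] := ltnP n.+1 l.
  rewrite /shiftseq leqNgt lt_nl /= mulr0 big1 // => j _.
  by rewrite gtnNdvd ?mul0r // (leq_ltn_trans (ltn_ord j)).
have [m Em] : exists m, n.+1 = (l + m)%N by exists (n.+1 - l)%N; rewrite subnKC.
have Dm : (n.+1 - l = m)%N by rewrite Em addKn.
rewrite /shiftseq le_ln Dm.
rewrite (bigID (fun j : 'I_n.+1 => (j < l)%N)) /=.
have lt1 : (l.-1 < n.+1)%N by lia.
rewrite (bigD1 (Ordinal lt1)) /=; last by lia.
rewrite prednK // dvdnn divnn l_gt0 expr1.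
have -> : (n - l.-1 = m)%N by lia.
rewrite [X in _ * f m + X + _]big1 ?addr0; last first.
  move=> j /andP[ltjl nej]; rewrite gtnNdvd ?mul0r //.
  rewrite ltn_neqAle ltjl andbT; apply: contra nej => /eqP e.
  by apply/eqP/val_inj; rewrite /= -e.
have e2 : \sum_(i < n.+1 | ~~ (i < l)%N)
    (if (l %| i.+1)%N then alpha ^+ (i.+1 %/ l) else 0) * f (n - i)%N =
    alpha * \sum_(j < m) (if (l %| j.+1)%N then alpha ^+ (j.+1 %/ l) else 0)
  * f (m.-1 - j)%N.
  under eq_bigl do rewrite -leqNgt.
  rewrite -(big_mkord (fun i => (l <= i)%N) (fun i =>
    (if (l %| i.+1)%N then alpha ^+ (i.+1 %/ l) else 0) * f (n - i)%N)).
  rewrite (@big_cat_nat _ _ _ l) //=.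
  rewrite big_nat_cond big1 ?add0r; last first.
    by move=> i /andP[/andP[_ h1] h2]; lia.
  rewrite big_nat_cond (eq_bigl (fun i => (l <= i < n.+1)%N)); last first.
    by move=> i /=; case: (l <= i)%N; rewrite ?andbT ?andbF.
  rewrite -big_nat -{1}[l]add0n big_addn Dm big_mkord mulr_sumr.
  apply: eq_bigr => j _.
  rewrite -addSn dvdn_addl ?dvdnn // divnDr ?dvdnn // divnn l_gt0 addn1 exprS.
  have -> : (n - (j + l) = m.-1 - j)%N by lia.
  by case: ifP => _; ring.
rewrite e2; case: m Em {e2 Dm} => [|m] Em.
  by rewrite big_ord0 mulr0 addr0 f0.
by rewrite /= IH; [rewrite /f; ring | lia].
Qed.

Section Expseq.
Variable F : numFieldType.
Implicit Types a b : nat -> F.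

Fixpoint expseq_list a n : seq F :=
  if n is m.+1 then
    let s := expseq_list a m in
    rcons s (m.+1%:R^-1 * \sum_(j < m.+1) a j.+1 * nth 0 s (m - j))
  else [:: 1].

(** Coefficients of [exp(sum_(j >= 1) a_j X^j / j)], computed from the relation between this series
    and its derivative. The auxiliary list keeps all earlier coefficients, which makes the recursion
    structural. *)
Definition expseq a n := nth 0 (expseq_list a n) n.

Lemma size_expseq_list a n : size (expseq_list a n) = n.+1.
Proof. by elim: n => //= n IH; rewrite size_rcons IH. Qed.

Lemma nth_expseq_list a n k : (k <= n)%N ->
  nth 0 (expseq_list a n) k = expseq a k.
Proof.
elim: n => [|n IH]; first by rewrite leqn0 => /eqP ->.
rewrite leq_eqVlt => /orP[/eqP -> //|lt_kn].
by rewrite /= nth_rcons size_expseq_list lt_kn IH.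
Qed.

Lemma expseq0 a : expseq a 0 = 1. Proof. by []. Qed.

Lemma expseqS a n :
  n.+1%:R * expseq a n.+1 = \sum_(j < n.+1) a j.+1 * expseq a (n - j).
Proof.
rewrite /expseq /= nth_rcons size_expseq_list ltnn eqxx mulVKf ?pnatr_eq0 //.
by apply: eq_bigr => j _; rewrite nth_expseq_list ?leq_subr.
Qed.

Lemma expseq_uniq a K (f : nat -> F) : f 0 = 1 ->
  (forall n, (n < K)%N ->
     n.+1%:R * f n.+1 = \sum_(j < n.+1) a j.+1 * f (n - j)%N) ->
  forall k, (k <= K)%N -> f k = expseq a k.
Proof.
move=> f0 fS k; elim/ltn_ind: k => -[_ _|n IH ltnK]; first by rewrite f0.
apply: (mulfI (x := n.+1%:R)); first by rewrite pnatr_eq0.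
rewrite fS // expseqS; apply: eq_bigr => j _.
by rewrite IH ?ltnS ?leq_subr // (leq_trans (leq_subr _ _)) // ltnW.
Qed.

Lemma eq_expseq a b K : (forall j, (0 < j <= K)%N -> a j = b j) ->
  forall k, (k <= K)%N -> expseq a k = expseq b k.
Proof.
move=> eqab; apply: expseq_uniq => // n ltnK; rewrite expseqS.
by apply: eq_bigr => j _; rewrite eqab //= (leq_trans (ltn_ord j)).
Qed.

Lemma expseq_inj a b K : (forall k, (k <= K)%N -> expseq a k = expseq b k) ->
  forall j, (0 < j <= K)%N -> a j = b j.
Proof.
move=> eqab; elim/ltn_ind => -[//|n] IH /= ltnK.
have := expseqS a n; rewrite eqab // expseqS !big_ord_recr /= subnn !expseq0.
rewrite (eq_bigr (fun i : 'I_n => a i.+1 * expseq a (n - i))) => [|i _].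
  by move/addrI; rewrite !mulr1.
rewrite IH ?ltnS ?ltn_ord //=; last by rewrite (leq_trans _ (ltnW ltnK)).
by rewrite eqab // (leq_trans (leq_subr _ _)) // ltnW.
Qed.

Lemma expseq_scale a c k :
  expseq (fun j => a j * c ^+ j) k = expseq a k * c ^+ k.
Proof.
apply/esym; apply: (@expseq_uniq _ k (fun k => expseq a k * c ^+ k)) => //.
  by rewrite expseq0 mulr1.
move=> n _; rewrite mulrA expseqS mulr_suml; apply: eq_bigr => j _.
have jn : (j <= n)%N by rewrite -ltnS.
by rewrite -[in c ^+ n.+1](subnKC jn) -addSn exprD; ring.
Qed.

(* Multiplication of the exponential by [1 - alpha X^l]. *)
Lemma expseq_shift a l (alpha : F) k : (0 < l)%N ->
  expseq (fun j => a j - (if (l %| j)%N then l%:R * alpha ^+ (j %/ l) else 0)) k =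
  expseq a k - alpha * shiftseq l (expseq a) k.
Proof.
move=> l_gt0; apply/esym.
pose f k := expseq a k - alpha * shiftseq l (expseq a) k.
pose g n (b : nat -> F) := \sum_(j < n.+1) b j.+1 * f (n - j)%N.
have f0 : f 0 = 1.
  by rewrite /f /shiftseq leqn0 gtn_eqF // mulr0 subr0.
(* The series of [a] times the exponential is the derivative of the exponential. In the term shifted
   by [l], that derivative is taken at a degree lowered by [l], whence the factor [n.+1 - l]. *)
have ga n : g n a = n.+1%:R * expseq a n.+1 -
    alpha * (n.+1%:R - l%:R) * shiftseq l (expseq a) n.+1.
  rewrite /g /f.
  under eq_bigr do rewrite mulrBr.
  rewrite big_split /= -expseqS sumrN; congr (_ - _).
  rewrite /shiftseq; case: ifP => [le_ln|/negbT]; last first.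
    rewrite -ltnNge => lt_nl; rewrite mulr0 big1 // => j _.
    by rewrite leqNgt (leq_ltn_trans (leq_subr _ _)) ?mulr0 // ltnW.
  under eq_bigr do rewrite mulrCA.
  rewrite -mulr_sumr -mulrA; congr (_ * _).
  have [m Em] : exists m, n.+1 = (l + m)%N by exists (n.+1 - l)%N; rewrite subnKC.
  have Dm : (n.+1 - l = m)%N by rewrite Em addKn.
  rewrite -natrB // Dm.
  rewrite (bigID (fun j : 'I_n.+1 => (j < m)%N)) /= [X in _ + X]big1 ?addr0; last first.
    move=> j; rewrite -leqNgt => le_mj; rewrite leqNgt.
    have -> : (n - j < l)%N by lia.
    by rewrite mulr0.
  rewrite -(big_ord_widen n.+1 (fun j =>
    a j.+1 * (if (l <= n - j)%N then expseq a (n - j - l) else 0))); last by lia.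
  case: m Em {Dm} => [|m] Em; first by rewrite big_ord0 mul0r.
  rewrite expseqS; apply: eq_bigr => j _.
  have jm := ltn_ord j.
  have -> : (l <= n - j)%N by lia.
  by congr (_ * expseq _ _); lia.
have sE n : \sum_(j < n.+1)
    (if (l %| j.+1)%N then l%:R * alpha ^+ (j.+1 %/ l) else 0) * f (n - j)%N =
    l%:R * alpha * shiftseq l (expseq a) n.+1.
  rewrite -mulrA -(telescope_shiftseq _ _ _ l_gt0) mulr_sumr; apply: eq_bigr => j _.
  by case: ifP => _; rewrite ?mul0r ?mulr0 // mulrA.
apply: (@expseq_uniq _ k f) => // n _.
under eq_bigr do rewrite mulrBl.
rewrite big_split /= sumrN -/(g n a) ga sE /f.
by ring.
Qed.

End Expseq.

(** * Reciprocal characteristic polynomials *)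

Section CharPoly.
Variable R : comNzRingType.
Variable n : nat.
Implicit Types A : 'M[R]_n.

Definition polymx A : 'M[{poly R}]_n := map_mx polyC A.
Definition revchar_mx A : 'M[{poly R}]_n := 1%:M - 'X *: polymx A.
Definition revchar A : {poly R} := \det (revchar_mx A).

Lemma revchar_horner A (x : R) : (revchar A).[x] = \det (1%:M - x *: A).
Proof.
rewrite /revchar -horner_evalE -det_map_mx; congr (\det _).
apply/matrixP => i j; rewrite !mxE /= /horner_eval.
by case: eqP => _; rewrite ?mulr1n ?mulr0n !hornerE.
Qed.

Lemma revchar0 A : (revchar A)`_0 = 1.
Proof. by rewrite -horner_coef0 revchar_horner scale0r subr0 det1. Qed.

Definition geom_mx A K : 'M[{poly R}]_n := \sum_(j < K) 'X^j *: polymx (A ^+ j).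

Lemma mul_revchar_geom A K :
  revchar_mx A *m geom_mx A K = 1%:M - 'X^K *: polymx (A ^+ K).
Proof.
elim: K => [|K IH].
  rewrite /geom_mx big_ord0 mulmx0 expr0 scale1r expr0.
  by rewrite /polymx map_mx1 subrr.
rewrite /geom_mx big_ord_recr /= mulmxDr -/(geom_mx A K) IH.
rewrite /revchar_mx mulmxBl mul1mx -scalemxAr -scalemxAl scalerA -exprSr.
have -> : polymx A *m polymx (A ^+ K) = polymx (A ^+ K.+1).
  by rewrite /polymx exprS map_mxM.
by rewrite addrA subrK.
Qed.

(** The adjugate is the determinant times the inverse of [1 - X A], and modulo [X^(k+1)] this
    inverse is the truncated Neumann series [geom_mx]. *)
Lemma adj_revchar_coef A i j k :
  (\adj (revchar_mx A) i j)`_k =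
  \sum_(l < k.+1) (revchar A)`_(k - l) * (A ^+ l) i j.
Proof.
have E : \adj (revchar_mx A) = revchar A *: geom_mx A k.+1
     + 'X^(k.+1) *: (\adj (revchar_mx A) *m polymx (A ^+ k.+1)).
  have := congr1 (mulmx (\adj (revchar_mx A))) (mul_revchar_geom A k.+1).
  rewrite mulmxA mul_adj_mx mul_scalar_mx -/(revchar A) => ->.
  by rewrite mulmxBr mulmx1 -scalemxAr subrK.
rewrite E !mxE coefD coefXnM ltnSn addr0 /geom_mx summxE mulr_sumr coef_sum.
apply: eq_bigr => l _; rewrite !mxE mulrCA coefXnM.
by rewrite ltnNge -ltnS ltn_ord /= coefMC.
Qed.

(** Matrix determinant lemma without inverting [M]: two block products involving the same matrix [B]
    give the identity multiplied by [\det M ^+ n], and regularity cancels this power. *)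
Lemma det_add_rank1 (M : 'M[{poly R}]_n) (u : 'cV_n) (v : 'rV_n) :
  (forall a : {poly R}, \det M * a = 0 -> a = 0) ->
  \det (M + u *m v) = \det M + (v *m \adj M *m u) 0 0.
Proof.
move=> regM.
have detM_reg k a : \det M ^+ k * a = 0 -> a = 0.
  elim: k a => [|k IH] a; first by rewrite mul1r.
  by rewrite exprSr -mulrA => /IH/regM.
pose B := block_mx M (- u) v (1%:M : 'M[{poly R}]_1).
have B1 : block_mx (M + u *m v) (- u) 0 (1%:M : 'M[{poly R}]_1) *m block_mx 1%:M 0 v 1%:M = B.
  rewrite mulmx_block !mulmx1 !mulmx0 !mul1mx !add0r.
  by rewrite mulNmx addrK.
have detB : \det B = \det (M + u *m v).
  by rewrite -B1 det_mulmx det_ublock det_lblock !det1 !mulr1.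
have B2 : block_mx (\adj M) 0 (- (v *m \adj M)) (\det M)%:M *m B =
    block_mx (\det M)%:M (- (\adj M *m u)) 0 (v *m \adj M *m u + (\det M)%:M).
  rewrite mulmx_block !mul0mx !addr0 mul_adj_mx mulmx1 mulmxN mulNmx mulNmx.
  rewrite -(mulmxA v _ M) mul_adj_mx mul_mx_scalar mul_scalar_mx addNr.
  by rewrite mulmxN opprK.
have := congr1 determinant B2.
rewrite det_mulmx det_lblock det_ublock detB !det_scalar expr1.
rewrite det_mx11 !mxE /= mulr1n => E.
apply/eqP; rewrite eq_sym -subr_eq0; apply/eqP/(detM_reg n).
have detMn : \det M ^+ n = \det (\adj M) * \det M.
  by rewrite -det_mulmx mul_adj_mx det_scalar.
by rewrite mulrBr detMn E -detMn addrC subrr.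
Qed.

Lemma revchar_add_rank1 A (u : 'cV[R]_n) (v : 'rV[R]_n) k :
  (revchar (A + u *m v))`_k =
  (revchar A)`_k -
    \sum_(j < k) (v *m A ^+ j *m u) 0 0 * (revchar A)`_(k.-1 - j).
Proof.
pose M := revchar_mx A.
have -> : revchar (A + u *m v) =
    \det (M + (- 'X *: map_mx polyC u) *m map_mx polyC v).
  rewrite /revchar /revchar_mx /polymx map_mxD map_mxM scalerDr opprD addrA.
  by rewrite -scalemxAl scaleNr.
rewrite det_add_rank1; last first.
  move=> a eq0; apply/polyP => m; elim/ltn_ind: m => m IH; rewrite coef0.
  have := congr1 (fun p : {poly R} => p`_m) eq0.
  rewrite coef0 coefM big_ord_recl subn0 -/(revchar A) revchar0 mul1r big1 ?addr0 //.
  move=> i _; rewrite IH ?coef0 ?mulr0 //= /bump /= ltn_subrL add1n /=.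
  by rewrite (leq_ltn_trans _ (ltn_ord i)).
rewrite -/(revchar A) coefD -scalemxAr mxE mulNr coefN coefXM; congr (_ - _).
case: k => [|k]; first by rewrite big_ord0.
rewrite /= !mxE coef_sum.
have uE i : map_mx polyC u i 0 = (u i 0)%:P by rewrite mxE.
have vE i : map_mx polyC v 0 i = (v 0 i)%:P by rewrite mxE.
under [LHS]eq_bigr do rewrite uE mxE coefMC coef_sum mulr_suml.
under [LHS]eq_bigr do under eq_bigr do rewrite vE coefCM adj_revchar_coef mulr_sumr mulr_suml.
rewrite [RHS](eq_bigr (fun l : 'I_k.+1 => \sum_i \sum_j
  v 0 j * ((revchar A)`_(k - l) * (A ^+ l) j i) * u i 0)).
  by rewrite [RHS]exchange_big; apply: eq_bigr => i _; rewrite exchange_big.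
move=> l _; rewrite !mxE mulr_suml; apply: eq_bigr => i _.
rewrite !mxE mulrAC !mulr_suml; apply: eq_bigr => j _.
by congr (_ * _); rewrite mulrA mulrAC.
Qed.

Lemma deriv_prod (I : finType) (F : I -> {poly R}) :
  (\prod_i F i)^`() = \sum_i (F i)^`() * \prod_(j | j != i) F j.
Proof.
suff H (r : seq I) : uniq r -> (\prod_(i <- r) F i)^`() =
    \sum_(i <- r) (F i)^`() * \prod_(j <- r | j != i) F j.
  exact: (H (index_enum I) (index_enum_uniq I)).
elim: r => [|x r IH] /=; first by rewrite !big_nil derivC.
move=> /andP[xr ur]; rewrite !big_cons derivM IH // eqxx mulr_sumr.
congr (_ * _ + _).
  rewrite [LHS]big_seq [RHS]big_seq_cond; apply: eq_bigl => y.
  by case: eqVneq => [->|]; rewrite ?andbT ?(negPf xr).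
rewrite !big_seq; apply: eq_bigr => y yr; rewrite big_cons mulrCA.
by case: eqVneq => // xy; rewrite -xy (negPf xr) in yr.
Qed.

(** Jacobi's formula: differentiate one row at a time, then expand along that row to produce its
    cofactors. *)
Lemma deriv_det m (M : 'M[{poly R}]_m) :
  (\det M)^`() = \tr (\adj M *m map_mx deriv M).
Proof.
have signM (b : bool) (p : {poly R}) : ((-1) ^+ b * p)^`() = (-1) ^+ b * p^`().
  by case: b; rewrite ?expr0 ?expr1 ?mul1r ?mulN1r ?derivN.
rewrite /determinant raddf_sum /=.
under eq_bigr do rewrite signM deriv_prod mulr_sumr.
rewrite exchange_big /mxtrace /=.
under [RHS]eq_bigr => j _ do rewrite mxE.
rewrite [RHS]exchange_big; apply: eq_bigr => i _ /=.
pose N := \matrix_(i', j) (if i' == i then (M i j)^`() else M i' j).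
transitivity (\det N).
  rewrite /determinant; apply: eq_bigr => s _; congr (_ * _).
  rewrite [RHS](bigD1 i) //= mxE eqxx; congr (_ * _).
  by apply: eq_bigr => j /negPf ji; rewrite mxE ji.
rewrite (expand_det_row _ i); apply: eq_bigr => j _.
rewrite !mxE eqxx mulrC; congr (_ * _).
rewrite /cofactor; congr (_ * \det _).
by apply/matrixP => a b; rewrite !mxE eq_sym (negPf (neq_lift _ _)).
Qed.

(** Newton's identities, read off Jacobi's formula: the derivative of [1 - X A] is [- A], and the
    coefficients of the adjugate are known. *)
Lemma revchar_newton A k :
  k%:R * (revchar A)`_k =
  - \sum_(j < k) \tr (A ^+ j.+1) * (revchar A)`_(k.-1 - j).
Proof.
case: k => [|k]; first by rewrite mul0r big_ord0 oppr0.
have E : (revchar A)^`() = - \tr (\adj (revchar_mx A) *m polymx A).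
  rewrite deriv_det; have -> : map_mx deriv (revchar_mx A) = - polymx A.
    apply/matrixP => i j; rewrite !mxE derivB derivM derivX derivC mul1r mulr0 addr0.
    by case: eqP; rewrite ?mulr1n ?mulr0n ?derivC ?sub0r // deriv0 sub0r.
  by rewrite mulmxN raddfN.
have := congr1 (fun p : {poly R} => p`_k) E.
rewrite coef_deriv coefN mulr_natl => ->; congr (- _).
rewrite /mxtrace coef_sum.
have AE i j : polymx A i j = (A i j)%:P by rewrite mxE.
under eq_bigr do rewrite mxE coef_sum.
under eq_bigr do under eq_bigr do rewrite AE coefMC adj_revchar_coef mulr_suml.
under eq_bigr do rewrite exchange_big.
rewrite exchange_big /=; apply: eq_bigr => l _.
rewrite mulr_suml; apply: eq_bigr => i _.
rewrite exprSr mxE mulr_suml; apply: eq_bigr => j _.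
by rewrite -[LHS]mulrA [LHS]mulrC.
Qed.

End CharPoly.

(** * Collisions of walks *)

Lemma map_uniq_inj (T1 T2 : eqType) (f : T1 -> T2) (s : seq T1) :
  uniq (map f s) -> {in s &, injective f}.
Proof.
elim: s => // x s IH /= /andP[fx us] y z; rewrite !inE.
case/orP=> [/eqP ->|ys] /orP[/eqP ->|zs] e //; last exact: IH.
- by move: fx; rewrite e map_f.
- by move: fx; rewrite -e map_f.
Qed.

Section Walks.
Variables d n : nat.
Local Notation Q := {ffun 'I_d -> 'S_n}.
Implicit Types (q : Q) (u w : seq 'I_d) (s : seq (seq 'I_d)).

Definition walk q (v : 'I_n) w : 'I_n := foldl (fun x c => q c x) v w.

Lemma walk_rcons q v w c : walk q v (rcons w c) = q c (walk q v w).
Proof. exact: foldl_rcons. Qed.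

Lemma walk_cat q v w w' : walk q v (w ++ w') = walk q (walk q v w) w'.
Proof. exact: foldl_cat. Qed.

Lemma walk_inj q w : injective (fun v => walk q v w).
Proof.
elim/last_ind: w => [|w c IH] x y; first by [].
by rewrite !walk_rcons => /perm_inj/IH.
Qed.

(* Lists of distinct words, latest first, in which the longest proper prefix of
   a word always comes before it: exploring the endpoints in this order queries
   one new value of one permutation at a time. *)
Fixpoint prefix_closed s : bool :=
  if s is u :: s' then
    if s' is [::] then u == [::]
    else [&& u \notin s', (if u is x :: u' then belast x u' \in s' else false)
          & prefix_closed s']
  else false.

Lemma prefix_closed_rcons s u : prefix_closed (u :: s) -> s != [::] ->
  exists w c, [/\ u = rcons w c, w \in s, u \notin s & prefix_closed s].
Proof.
case: s => // u' s /and3P[us ps cs] _.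
case: u ps us => // x u ps us; exists (belast x u), (last x u).
by rewrite -lastI.
Qed.

Lemma prefix_closed_extend s u : prefix_closed s ->
  exists s', [/\ prefix_closed s', {subset s <= s'}, u \in s' &
                 (size s' <= size s + size u)%N].
Proof.
move=> cs; elim/last_ind: u => [|u c [s' [cs' ss' us' szs']]].
  exists s; split=> //; last by rewrite addn0.
  elim: s cs => // w [|w' s] IH; first by rewrite inE eq_sym.
  by move=> /and3P[_ _ /IH]; rewrite [_ \in w :: _]inE => ->; rewrite orbT.
have [ucs'|ucs'] := boolP (rcons u c \in s').
  by exists s'; split=> //; rewrite size_rcons (leq_trans szs') // leq_add2l.
exists (rcons u c :: s'); split.
- case: s' cs' us' ucs' {ss' szs'} => // w s' cs' us' ucs'.
  rewrite /= -/(prefix_closed (w :: s')) ucs' cs' andbT /=.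
  case: u us' {ucs'} => [|x u] us' /=; first by [].
  by rewrite belast_rcons.
- by move=> w /ss' ws'; rewrite inE ws' orbT.
- by rewrite inE eqxx.
- by rewrite /= size_rcons addnS ltnS.
Qed.

(** Permutation products apply the left factor first: the arrow of colour [c] which ended at [x] now
    ends at [z], and the one which ended at [z] now ends at [x]. *)
Definition reroute q c (x z : 'I_n) : Q :=
  [ffun c' => if c' == c then (q c' * tperm x z)%g else q c'].

(** Exploring [s0] never uses an arrow of colour [c] into [walk q v u'] or into [z]. The first would
    start at the endpoint of [w] by injectivity of [q c], and since endpoints are distinct it would
    belong to the word [rcons w c], which is absent; the second would make [z] an endpoint. *)
Lemma reroute_walk q c v w u' z s s0 :
  uniq [seq walk q v u | u <- s] -> rcons w c \notin s -> w \in s -> u' \in s ->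
  z \notin [seq walk q v u | u <- s] ->
  q c (walk q v w) = walk q v u' ->
  prefix_closed s0 -> {subset s0 <= s} ->
  {in s0, forall u, walk (reroute q c (walk q v u') z) v u = walk q v u}.
Proof.
move=> us wcs ws u's zs qcw; elim: s0 => // u s0 IH cs0 sub u1.
have [s00|s00] := eqVneq s0 [::].
  by move: cs0; rewrite s00 inE /= => /eqP -> /eqP ->.
have [w1 [c1 [eu w1s0 us0 cs0']]] := prefix_closed_rcons cs0 s00.
have sub0 : {subset s0 <= s} by move=> y ys; apply: sub; rewrite inE ys orbT.
rewrite inE => /orP[/eqP -> {u1}|]; last exact: IH.
rewrite eu !walk_rcons IH // ffunE; case: eqP => // cc1.
rewrite permM tpermD //.
- rewrite -qcw cc1; apply/eqP => /perm_inj e.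
  move/negP: wcs; apply.
  rewrite (map_uniq_inj us ws (sub0 _ w1s0) e) -cc1 -eu.
  by apply: sub; rewrite inE eqxx.
- apply: contra zs => /eqP ->; rewrite -walk_rcons -eu.
  by apply: map_f; apply: sub; rewrite inE eqxx.
Qed.

(** On this event the arrow queried last falls on an already visited point. Redirecting it to any of
    the [n - size s] unvisited points produces tuples which are all distinct, even when the original
    tuple varies. *)
Lemma card_first_collision v w c u' s :
  prefix_closed (rcons w c :: s) -> w \in s -> u' \in s ->
  (#|[set q : Q | uniq [seq walk q v u | u <- s]
        & q c (walk q v w) == walk q v u']| * (n - size s) <= #|Q|)%N.
Proof.
move=> cs ws u's.
have [wcs cs'] : rcons w c \notin s /\ prefix_closed s.
  have s0 : s != [::] by apply: contraTneq ws => ->.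
  by have [w1 [c1 []]] := prefix_closed_rcons cs s0.
set Z := [set q | _].
pose D := [set qz : Q * 'I_n | (qz.1 \in Z) && (qz.2 \notin [seq walk qz.1 v u | u <- s])].
have cardD : #|D| = (#|Z| * (n - size s))%N.
  rewrite -sum1_card (eq_bigl (fun qz : Q * 'I_n => (qz.1 \in Z) &&
    (qz.2 \notin [seq walk qz.1 v u | u <- s]))); last by move=> qz; rewrite inE.
  rewrite -(pair_big_dep (fun q => q \in Z)
    (fun q z => z \notin [seq walk q v u | u <- s]) (fun _ _ => 1%N)) /=.
  rewrite -sum_nat_const; apply: eq_bigr => q; rewrite inE => /andP[us _].
  rewrite sum1_card; have := cardC (mem [seq walk q v u | u <- s]).
  rewrite card_ord (card_uniqP us) size_map => e.
  by rewrite -[X in (X - _)%N]e addKn; apply: eq_card => z; rewrite !inE.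
rewrite -cardD -(card_in_imset (f := fun qz : Q * 'I_n =>
    reroute qz.1 c (walk qz.1 v u') qz.2)); first exact: max_card.
have walkE qz : qz \in D -> {in s, forall u,
    walk (reroute qz.1 c (walk qz.1 v u') qz.2) v u = walk qz.1 v u}.
  rewrite !inE => /andP[/andP[us /eqP qe] zs].
  exact: reroute_walk us wcs ws u's zs qe cs' _.
(* Decoding: the walks of [s] are unchanged, so [z] is the new image of the endpoint of [w]; the
   point [walk q v u'] is then known as well and the transposition can be undone. *)
have zE qz : qz \in D ->
    reroute qz.1 c (walk qz.1 v u') qz.2 c
     (walk (reroute qz.1 c (walk qz.1 v u') qz.2) v w) = qz.2.
  move=> qzD; rewrite (walkE _ qzD _ ws) ffunE eqxx permM.
  by move: qzD; rewrite !inE => /andP[/andP[us /eqP ->] zs]; rewrite tpermL.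
move=> [q1 z1] [q2 z2] /= D1 D2 e.
have z12 : z1 = z2 by rewrite -[z1](zE (q1, z1)) // e (zE (q2, z2)).
have w12 : walk q1 v u' = walk q2 v u'.
  by rewrite -(walkE _ D1 _ u's) -(walkE _ D2 _ u's) e.
congr (_, _) => //; apply/ffunP => c'; have := congr1 (fun q : Q => q c') e.
rewrite !ffunE; case: eqP => // _; rewrite z12 w12.
by move/mulIg.
Qed.

(** Union bound over the first collision: adding the word [u] allows at most [size s] new
    collisions, each controlled by [card_first_collision]. *)
Lemma card_collision_list v s : prefix_closed s ->
  (#|[set q : Q | ~~ uniq [seq walk q v u | u <- s]]| * (n - size s) <=
   size s ^ 2 * #|Q|)%N.
Proof.
elim: s => // u s IH cs.
have [->|s0] := eqVneq s [::].
  by rewrite eq_card0 // => q; rewrite !inE.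
have [w [c [eu ws us cs']]] := prefix_closed_rcons cs s0.
set E1 := [set q : Q | ~~ uniq [seq walk q v u | u <- s]] in IH.
pose E2 (u' : seq 'I_d) := [set q : Q | uniq [seq walk q v u | u <- s]
        & q c (walk q v w) == walk q v u'].
have card_le : (#|[set q : Q | ~~ uniq [seq walk q v u | u <- u :: s]]| <=
    #|E1| + \sum_(u' <- s) #|E2 u'|)%N.
  rewrite -!sum1_card; under [X in (_ <= _ + X)%N]eq_bigr do rewrite -sum1_card big_mkcond.
  rewrite exchange_big /= big_mkcond [X in (_ <= X + _)%N]big_mkcond -big_split /=.
  apply: leq_sum => q _; rewrite !inE /= negb_and negbK.
  have [us' /=|_] := boolP (uniq [seq walk q v u | u <- s]); last by rewrite orbT.
  case: ifP => //; rewrite orbF => /mapP[u' u's e].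
  by rewrite (big_rem u') //= inE us' -walk_rcons -eu e eqxx.
have sz : (n - size (u :: s) <= n - size s)%N by rewrite leq_sub2l //= leqW.
apply: (@leq_trans ((#|E1| + \sum_(u' <- s) #|E2 u'|) * (n - size s))%N).
  by rewrite leq_mul.
rewrite mulnDl; apply: (@leq_trans (size s ^ 2 * #|Q| + size s * #|Q|)%N).
  apply: leq_add; first exact: IH.
  rewrite big_distrl /= (leq_trans (n := (\sum_(u' <- s) #|Q|)%N)) //.
    rewrite !big_seq; apply: leq_sum => u' u's.
    by apply: card_first_collision => //; rewrite -eu.
  by rewrite big_const_seq count_predT iter_addn_0 mulnC.
by rewrite -mulnDl leq_mul2r; apply/orP; right => /=; lia.
Qed.

(** A prefix closed list containing two given words of length at most [L] needs at most [2 L + 1]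
    entries, the empty word included. The factor 2 pays for replacing [n - W] by [n]. *)
Definition collision_bound L := (2 * (L.*2.+1) ^ 2)%N.

(** For one starting point a collision has probability [O(1/n)], so the sum over the [n] starting
    points stays bounded. *)
Lemma sum_collision L u u' : (size u <= L)%N -> (size u' <= L)%N -> u != u' ->
  (\sum_(q : Q) \sum_v (walk q v u == walk q v u') <= collision_bound L * #|Q|)%N.
Proof.
move=> uL u'L uu'; rewrite exchange_big /=.
have [s [cs _ us szs]] := prefix_closed_extend u (isT : prefix_closed [:: [::]]).
have [s' [cs' ss' us' szs']] := prefix_closed_extend u' cs.
have szL : (size s' <= L.*2.+1)%N.
  rewrite (leq_trans szs') // (leq_trans (leq_add szs u'L)) //=.
  by rewrite -addnn add1n addSn ltnS leq_add2r.
rewrite /collision_bound; set W := L.*2.+1 in szL *.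
have bd v : (\sum_q (walk q v u == walk q v u') <=
    #|[set q : Q | ~~ uniq [seq walk q v u | u <- s']]|)%N.
  rewrite -sum1_card [leqRHS]big_mkcond; apply: leq_sum => q _.
  rewrite inE; case: eqP => // e; case: (boolP (uniq _)) => // us1.
  by move/negP: uu'; case; apply/eqP; apply: (map_uniq_inj us1) => //; exact: ss'.
have [nW|Wn] := leqP n (W + W).
  apply: (leq_trans (n := (\sum_(v < n) #|Q|)%N)).
    by apply: leq_sum => v _; rewrite (leq_trans (bd v)) // max_card.
  by rewrite sum_nat_const card_ord leq_mul2r (leq_trans nW) ?orbT //; nia.
apply: (@leq_trans (\sum_(v < n) #|[set q : Q | ~~ uniq [seq walk q v u | u <- s']]|)%N).
  by apply: leq_sum => v _; exact: bd.
have bdv v : (#|[set q : Q | ~~ uniq [seq walk q v u | u <- s']]| * n <= 2 * W ^ 2 * #|Q|)%N.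
  have := card_collision_list v cs'.
  set N := #|[set q | _]| => h.
  apply: (@leq_trans (2 * (N * (n - size s')))%N); first by nia.
  rewrite -mulnA leq_mul2l /= (leq_trans h) // leq_mul2r leq_sqr szL.
  by rewrite orbT.
have n0 : (0 < n)%N by apply: leq_ltn_trans Wn.
rewrite -(leq_pmul2r n0) big_distrl /=.
apply: (@leq_trans (\sum_(v < n) 2 * W ^ 2 * #|Q|)%N).
  by apply: leq_sum => v _; exact: bdv.
by rewrite sum_nat_const card_ord mulnC.
Qed.

End Walks.

(** * Swapping two values of one permutation *)

Section Swap.
Variables d n : nat.
Local Notation Q := {ffun 'I_d -> 'S_n}.
Implicit Types (q : Q).

Definition amx q : 'M[int]_n := \sum_c perm_mx (q c).

Lemma amxE q i j : amx q i j = \sum_c (q c i == j)%:R.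
Proof. by rewrite summxE; apply: eq_bigr => c _; rewrite !mxE. Qed.

Fixpoint words j : seq (seq 'I_d) :=
  if j is j'.+1 then [seq rcons w c | w <- words j', c <- enum 'I_d] else [:: [::]].

Lemma size_words j : size (words j) = (d ^ j)%N.
Proof. by elim: j => //= j IH; rewrite size_allpairs IH size_enum_ord expnSr. Qed.

Lemma mem_words j w : w \in words j -> size w = j.
Proof.
elim: j w => [|j IH] w /=; first by rewrite inE => /eqP ->.
by case/allpairsP => -[w' c] /= [/IH <- _ ->]; rewrite size_rcons.
Qed.

Lemma uniq_words j : uniq (words j).
Proof.
elim: j => //= j IH; apply: allpairs_uniq => //; first exact: enum_uniq.
by move=> [w c] [w' c'] /= _ _ /rcons_inj.
Qed.

Definition npaths q j (y a : 'I_n) := (\sum_(w <- words j) (walk q y w == a))%N.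

Lemma amx_exp q j y a : (amx q ^+ j) y a = (npaths q j y a)%:R.
Proof.
rewrite /npaths; elim: j a => [|j IH] a.
  by rewrite expr0 /= big_seq1 !mxE.
rewrite exprSr mxE /= big_allpairs_dep natr_sum.
under eq_bigr do rewrite IH natr_sum mulr_suml.
rewrite exchange_big /=; apply: eq_bigr => w _.
rewrite (bigD1 (walk q y w)) //= eqxx mul1r big1 ?addr0; last first.
  by move=> z; rewrite eq_sym => /negPf ->; rewrite mul0r.
rewrite amxE natr_sum enumT; apply: eq_bigr => c _.
by rewrite walk_rcons.
Qed.

Lemma sum_npaths_row q j y : (\sum_a npaths q j y a = d ^ j)%N.
Proof.
rewrite exchange_big /= -(size_words j) -sum1_size; apply: eq_bigr => w _.
by rewrite (bigD1 (walk q y w)) //= eqxx big1 // => a; rewrite eq_sym => /negPf ->.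
Qed.

Lemma sum_npaths_col q j a : (\sum_y npaths q j y a = d ^ j)%N.
Proof.
rewrite exchange_big /= -(size_words j) -sum1_size; apply: eq_bigr => w _.
transitivity (\sum_y (y == a))%N.
  by rewrite [RHS](reindex_inj (walk_inj (q := q) (w := w))).
by rewrite (bigD1 a) //= eqxx big1 // => y /negPf ->.
Qed.

Lemma npaths_le q j y a : (npaths q j y a <= d ^ j)%N.
Proof. by rewrite -(sum_npaths_row q j y) (bigD1 a) //= leq_addr. Qed.

Lemma trace_npaths q j : \tr (amx q ^+ j.+1) = \sum_c \sum_a (npaths q j (q c a) a)%:R.
Proof.
rewrite exchange_big; apply: eq_bigr => a _ /=.
rewrite exprS mxE.
under [LHS]eq_bigr do rewrite amxE mulr_suml.
rewrite exchange_big /=; apply: eq_bigr => c _.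
rewrite (bigD1 (q c a)) //= eqxx mul1r big1 ?addr0 ?amx_exp //.
by move=> z; rewrite eq_sym => /negPf ->; rewrite mul0r.
Qed.

Lemma trace_ge0 q j : 0 <= \tr (amx q ^+ j.+1).
Proof. by rewrite trace_npaths; do 2!apply: sumr_ge0 => ? _; rewrite ler0n. Qed.

(** The transposition acts first, so the values of [q c] at [a] and [b] are exchanged. For fixed
    [c], [a], [b] this is an involution of the finite set of tuples: a uniform tuple and its swap
    form an exchangeable pair. *)
Definition swap c (a b : 'I_n) q : Q :=
  [ffun c' => if c' == c then (tperm a b * q c')%g else q c'].

Lemma swapK c a b : involutive (swap c a b).
Proof.
move=> q; apply/ffunP => c'; rewrite !ffunE; case: eqP => // _.
by rewrite mulgA tperm2 mul1g.
Qed.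

Lemma amx_swap c a b q : amx (swap c a b q) =
  amx q + (delta_mx a 0 - delta_mx b 0 : 'cV_n) *m
          (delta_mx 0 (q c b) - delta_mx 0 (q c a) : 'rV_n).
Proof.
rewrite /amx (bigD1 c) //= [in RHS](bigD1 c) //= ffunE eqxx addrAC.
congr (_ + _); last first.
  by apply: eq_bigr => c' /negPf c'c; rewrite ffunE c'c.
rewrite mulmxBr !mulmxBl !mul_delta_mx.
apply/matrixP => i j; rewrite !mxE permM ![_ == j]eq_sym.
case: tpermP => [->|->|/eqP/negPf ia /eqP/negPf ib].
- by rewrite eqxx; have [->|_] := eqVneq a b => /=; ring.
- by rewrite eqxx; have [->|_] := eqVneq b a => /=; ring.
- by rewrite ia ib /=; ring.
Qed.

(** The scalar [v A^j u] of the rank one update. A path from [q c b] to [a] is closed by the new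
    arrow out of [a], one from [q c a] to [a] by the old arrow: this is the number of closed paths
    of length [j.+1] gained minus the number lost, counted with the paths of [q]. *)
Definition nodiff q c a b j : int :=
  (npaths q j (q c b) a)%:R + (npaths q j (q c a) b)%:R
  - (npaths q j (q c a) a)%:R - (npaths q j (q c b) b)%:R.

Lemma revchar_swap q c a b k :
  (revchar (amx (swap c a b q)))`_k = (revchar (amx q))`_k -
    \sum_(j < k) nodiff q c a b j * (revchar (amx q))`_(k.-1 - j).
Proof.
rewrite amx_swap revchar_add_rank1; congr (_ - _); apply: eq_bigr => j _.
congr (_ * _).
have subE (A B : 'M[int]_1) : (A - B) 0 0 = A 0 0 - B 0 0 by rewrite !mxE.
rewrite mulmxBr !mulmxBl !subE.
have E (x y : 'I_n) : ((delta_mx 0 x : 'rV[int]_n) *m amx q ^+ j *m (delta_mx y 0 : 'cV_n)) 0 0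
    = (npaths q j x y)%:R.
  by rewrite -rowE -colE !mxE amx_exp.
by rewrite !E /nodiff; ring.
Qed.

End Swap.

(** * The net counts of a swap and of its reverse *)

Section Reversal.
Variables d n : nat.
Local Notation Q := {ffun 'I_d -> 'S_n}.
Implicit Types (q : Q).

Local Notation coefG q k := ((revchar (amx q))`_k).

Lemma revchar_expseq (F : numFieldType) q k :
  (coefG q k)%:~R = expseq (fun j => - (\tr (amx q ^+ j))%:~R : F) k.
Proof.
apply: (@expseq_uniq _ _ k (fun k => (coefG q k)%:~R : F)) => //.
  by rewrite revchar0.
move=> m _; have -> : m.+1%:R = (m.+1%:R : int)%:~R :> F by rewrite rmorph_nat.
rewrite -rmorphM revchar_newton /= rmorphN rmorph_sum -sumrN; apply: eq_bigr => j _ /=.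
by rewrite rmorphM mulNr.
Qed.

Lemma conv_inj (g a b : nat -> int) K : g 0%N = 1 ->
  (forall k, (k < K)%N ->
     \sum_(j < k.+1) a j * g (k - j)%N = \sum_(j < k.+1) b j * g (k - j)%N) ->
  forall k, (k < K)%N -> a k = b k.
Proof.
move=> g0 eqab; elim/ltn_ind => k IH kK.
have := eqab k kK; rewrite !big_ord_recr /= subnn g0 !mulr1.
rewrite (eq_bigr (fun j : 'I_k => b j * g (k - j)%N)); first by move/addrI.
by move=> j _; rewrite IH // (ltn_trans _ kK).
Qed.

(** From [G' = (1 - X N) G] and, the swap being an involution, [G = (1 - X N') G'], one gets
    [N' G' = - N G]. *)
Lemma nodiff_rev q c a b k :
  \sum_(j < k.+1) nodiff (swap c a b q) c a b j * coefG (swap c a b q) (k - j) =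
  - \sum_(j < k.+1) nodiff q c a b j * coefG q (k - j).
Proof.
have := revchar_swap (swap c a b q) c a b k.+1; rewrite swapK revchar_swap /= => E.
by lia.
Qed.

(** In [N' G' = - N G] both [G] and [G'] start with 1, so [N'] and [- N] agree up to and including
    the first index where [N] may be nonzero. *)
Lemma nodiff_rev_lead q c a b k : (forall j, (j < k)%N -> nodiff q c a b j = 0) ->
  nodiff (swap c a b q) c a b k = - nodiff q c a b k.
Proof.
move=> Nk; suff: forall j, (j <= k)%N ->
    nodiff (swap c a b q) c a b j = - nodiff q c a b j by apply.
elim/ltn_ind => j IH jk; have := nodiff_rev q c a b j.
rewrite !big_ord_recr /= subnn !revchar0 !mulr1 !big1 ?add0r //.
  by move=> i _; rewrite Nk ?mul0r // (leq_trans (ltn_ord i)).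
move=> i _; rewrite IH ?Nk ?oppr0 ?mul0r //.
  by rewrite (leq_trans (ltn_ord i)).
by rewrite (leq_trans (ltnW (ltn_ord i))).
Qed.

Section Create.
Variables (q : Q) (c : 'I_d) (a b : 'I_n) (l K : nat).
Hypothesis lK : (l < K)%N.
Hypothesis Nl : forall j, (j < K)%N -> nodiff q c a b j = (j == l)%:R.

(** With [N = X^l] below degree [K], the update is multiplication by [1 - X^(l+1)], the effect of
    one new cycle of length [l.+1]. *)
Lemma revchar_create k : (k <= K)%N ->
  coefG (swap c a b q) k = coefG q k - shiftseq l.+1 (fun k => coefG q k) k.
Proof.
move=> kK; rewrite revchar_swap /shiftseq; congr (_ - _).
case: ifP => [lk|/negbT]; last first.
  rewrite -ltnNge ltnS => kl; rewrite big1 // => j _.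
  rewrite Nl ?(leq_trans (ltn_ord j)) //.
  by rewrite ltn_eqF ?mul0r // (leq_trans (ltn_ord j)).
rewrite (bigD1 (Ordinal lk)) //= Nl // eqxx mul1r big1 ?addr0; last first.
  move=> j jl; rewrite Nl ?(leq_trans (ltn_ord j)) //.
  by rewrite (negPf (_ : nat_of_ord j != l)) ?mul0r.
by congr (coefG q _); lia.
Qed.

(** [1 - X^(l+1)] is the exponential of [- sum (l+1) X^j / j] over the multiples [j] of [l+1], so
    comparing exponents through [expseq_inj] gives the traces. The computation takes place in [rat]
    because [expseq] divides. *)
Lemma trace_create j : (j < K)%N -> \tr (amx (swap c a b q) ^+ j.+1) =
  \tr (amx q ^+ j.+1) + (if (l.+1 %| j.+1)%N then l.+1%:R else 0).
Proof.
move=> jK; apply: (@intr_inj rat).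
pose T q j := (\tr (amx q ^+ j))%:~R : rat.
have := @expseq_inj _ (fun j => - T (swap c a b q) j)
  (fun j => - T q j - (if (l.+1 %| j)%N then l.+1%:R * 1 ^+ (j %/ l.+1) else 0)) K.
move=> /(_ _ j.+1 jK) H; rewrite rmorphD /=.
apply: oppr_inj; rewrite H.
  rewrite opprD /T; case: ifP => _; last by rewrite rmorph0.
  by rewrite expr1n mulr1 rmorph_nat.
move=> k kK; rewrite expseq_shift // mul1r -revchar_expseq revchar_create //.
rewrite rmorphB /= /shiftseq; congr (_ - _); first by rewrite revchar_expseq.
by case: ifP => // _; rewrite revchar_expseq.
Qed.

(** Divide [N' G' = - X^l G] by [G' = (1 - X^(l+1)) G]: the quotient [- X^l / (1 - X^(l+1))] is
    supported on the [j] for which [l.+1] divides [j.+1]. *)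
Lemma nodiff_create j : (j < K)%N ->
  nodiff (swap c a b q) c a b j = - (l.+1 %| j.+1)%:R.
Proof.
move: j; apply: (@conv_inj (fun k => coefG (swap c a b q) k)); first by rewrite revchar0.
move=> k kK; rewrite nodiff_rev.
have := revchar_swap q c a b k.+1.
rewrite revchar_create //= => /addrI/oppr_inj <-.
rewrite -[shiftseq _ _ _]mul1r -(telescope_shiftseq _ _ _ (ltn0Sn l)) -sumrN.
apply: eq_bigr => j _; rewrite mul1r revchar_create; last first.
  by rewrite (leq_trans (leq_subr _ _)) // ltnW.
by rewrite mulNr; case: ifP; rewrite ?expr1n.
Qed.

End Create.
End Reversal.

Lemma sum_pairs_neq (I : eqType) (s : seq I) (b : I -> bool) : uniq s ->
  ((\sum_(w <- s) b w) * (\sum_(w <- s) b w).-1 =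
   \sum_(w <- s) \sum_(w' <- s | w' != w) (b w && b w'))%N.
Proof.
move=> us; rewrite big_distrl /= big_seq [RHS]big_seq; apply: eq_bigr => w ws.
rewrite (bigD1_seq w) //=; case: (b w) => /=; last by rewrite mul0n big1.
by rewrite mul1n.
Qed.

(** * The error term of the exchangeable pair *)

Section ErrorTerm.
Variables d n : nat.
Local Notation Q := {ffun 'I_d -> 'S_n}.
Implicit Types (q : Q).

Fixpoint short_words K : seq (seq 'I_d) :=
  if K is K'.+1 then short_words K' ++ words d K' else [::].

Lemma mem_short_words K w : w \in short_words K -> (size w < K)%N.
Proof.
elim: K => //= K IH; rewrite mem_cat => /orP[/IH/ltnW //|/mem_words ->].
exact: ltnSn.
Qed.

Lemma uniq_short_words K : uniq (short_words K).
Proof.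
elim: K => //= K IH; rewrite cat_uniq IH uniq_words andbT /=.
by apply/hasPn => w /mem_words szw; apply/negP => /mem_short_words; rewrite szw ltnn.
Qed.

Definition nshort q K y a := (\sum_(j < K) npaths q j y a)%N.

Lemma nshortE q K y a : nshort q K y a = (\sum_(w <- short_words K) (walk q y w == a))%N.
Proof.
elim: K => [|K IH]; first by rewrite /nshort big_ord0 big_nil.
by rewrite /= big_cat /= -IH /nshort big_ord_recr.
Qed.

Definition row_const K := (\sum_(j < K) d ^ j)%N.

Lemma sum_nshort_row q K y : (\sum_a nshort q K y a = row_const K)%N.
Proof. by rewrite exchange_big; apply: eq_bigr => j _; rewrite /= sum_npaths_row. Qed.

Lemma sum_nshort_col q K a : (\sum_y nshort q K y a = row_const K)%N.
Proof. by rewrite exchange_big; apply: eq_bigr => j _; rewrite /= sum_npaths_col. Qed.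

Definition nnew q K c a b := (nshort q K (q c b) a + nshort q K (q c a) b)%N.
Definition nold q K c a b := (nshort q K (q c a) a + nshort q K (q c b) b)%N.

(** Vanishes exactly in the cases which are treated without error: no new closed path, or a single
    new one and no old one. Otherwise it is at least [nnew]. *)
Definition swap_error q K c a b :=
  (nnew q K c a b * (nnew q K c a b).-1 + nnew q K c a b * nold q K c a b)%N.

(** The square of [y a b + y b a] splits into pairs of paths with the same ends and pairs of paths
    which close up to a loop. In the products with [nold] the free point is summed first, which
    gives the factor [row_const]. *)
Lemma sum_swap_error q K c : (\sum_a \sum_b swap_error q K c a b =
  (\sum_y \sum_a nshort q K y a * (nshort q K y a).-1 +
   \sum_y \sum_a nshort q K y a * (nshort q K y a).-1) +
  (\sum_a \sum_b nshort q K (q c b) a * nshort q K (q c a) b +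
   \sum_a \sum_b nshort q K (q c b) a * nshort q K (q c a) b) +
  4 * row_const K * \sum_a nshort q K (q c a) a)%N.
Proof.
pose y a b := nshort q K (q c b) a.
have E a b : swap_error q K c a b = (y a b * (y a b).-1 + y b a * (y b a).-1 +
    (y a b * y b a + y a b * y b a) + (y a b * (y a a + y b b) + y b a * (y b b + y a a)))%N.
  have alg (u v s t : nat) : ((u + v) * (u + v).-1 + (u + v) * (s + t) =
      u * u.-1 + v * v.-1 + (u * v + u * v) + (u * (s + t) + v * (t + s)))%N.
    case: u => [|u]; first lia. case: v => [|v]; first lia.
    have -> : ((u.+1 + v.+1).-1 = (u + v).+1)%N by lia.
    by rewrite !succnK; lia.
  exact: alg.
under eq_bigr do under eq_bigr do rewrite E.
under eq_bigr do rewrite !big_split /=.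
rewrite !big_split /=.
rewrite [X in (_ + X + _ + _)%N]exchange_big /= [X in (_ + (_ + X))%N]exchange_big /=.
have -> : (\sum_a \sum_b y a b * (y a b).-1 =
    \sum_y \sum_a nshort q K y a * (nshort q K y a).-1)%N.
  rewrite exchange_big /= [RHS](reindex_inj (@perm_inj _ (q c))).
  by [].
have -> : (\sum_i \sum_j y i j * (y i i + y j j) =
    2 * row_const K * \sum_a y a a)%N.
  transitivity (\sum_i \sum_j (y i j * y i i) + \sum_i \sum_j (y i j * y j j))%N.
    rewrite -big_split; apply: eq_bigr => i _; rewrite -big_split.
    by apply: eq_bigr => j _; rewrite mulnDr.
  rewrite [X in (_ + X)%N]exchange_big /= -mulnA mul2n -addnn; congr (_ + _)%N.
    rewrite big_distrr /=; apply: eq_bigr => i _; rewrite -big_distrl /=.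
    rewrite -(sum_nshort_col q K i) [in RHS](reindex_inj (@perm_inj _ (q c))).
    by [].
  rewrite big_distrr /=; apply: eq_bigr => j _; rewrite -big_distrl /=.
  by rewrite sum_nshort_row.
have alg (A B C r : nat) : (A + A + (B + B) + (2 * r * C + 2 * r * C) =
  A + A + (B + B) + 4 * r * C)%N by lia.
exact: alg.
Qed.

(** The factor [d] is the sum over colours, [(1 + S)^2] with [S] short words dominates both [S] and
    [S^2], and [2 K] bounds the length of the closed words [c w c w'] with [w] and [w'] shorter than
    [K]. *)
Definition error_const K :=
  (4 * (d * (1 + size (short_words K)) ^ 2 * collision_bound K.*2 * (1 + row_const K)))%N.

(** Each sum of [sum_swap_error] counts collisions: between two distinct words with the same ends,
    between [c w c w'] and the empty word, between [c w] and the empty word. *)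
Lemma sum_swap_error_le K :
  (\sum_q \sum_c \sum_a \sum_b swap_error q K c a b <= error_const K * #|Q|)%N.
Proof.
set S := size (short_words K); set CB := collision_bound K.*2.
have sz (w w' : seq 'I_d) (c : 'I_d) : w \in short_words K -> w' \in short_words K ->
    (size (c :: w ++ c :: w') <= K.*2)%N.
  by move=> /mem_short_words h /mem_short_words h'; rewrite /= size_cat /= -addSn -addnn leq_add.
have szl (w : seq 'I_d) : w \in short_words K -> (size w <= K.*2)%N.
  by move=> /mem_short_words h; rewrite -addnn (leq_trans (ltnW h)) ?leq_addr.
have szc (w : seq 'I_d) (c : 'I_d) : w \in short_words K -> (size (c :: w) <= K.*2)%N.
  by move=> /mem_short_words h /=; rewrite -addnn (leq_trans h) ?leq_addr.
have S1 : (\sum_(q : Q) \sum_y \sum_a nshort q K y a * (nshort q K y a).-1 <=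
    S ^ 2 * CB * #|Q|)%N.
  under eq_bigr => q _.
    under eq_bigr => y _.
      under eq_bigr => a _ do rewrite nshortE sum_pairs_neq ?uniq_short_words //.
      rewrite exchange_big /=; over.
    rewrite exchange_big /=; over.
  rewrite exchange_big /= (@leq_trans (\sum_(w <- short_words K) S * CB * #|Q|)%N) //; last first.
    by rewrite big_const_seq count_predT iter_addn_0 -/S; lia.
  rewrite big_seq [leqRHS]big_seq; apply: leq_sum => w ws.
  rewrite (@leq_trans (\sum_(w' <- short_words K) CB * #|Q|)%N) //; last first.
    by rewrite big_const_seq count_predT iter_addn_0 -/S; lia.
  under eq_bigr => q _.
    under eq_bigr => y _ do rewrite exchange_big /=.
    rewrite exchange_big /=; over.
  rewrite exchange_big /= big_mkcond /= big_seq [leqRHS]big_seq; apply: leq_sum => w' ws'.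
  case: ifP => //; rewrite eq_sym => ww'.
  apply: leq_trans (@sum_collision d n K.*2 w w' (szl _ ws) (szl _ ws') ww').
  apply: leq_sum => q _; apply: leq_sum => y _.
  rewrite (bigD1 (walk q y w)) //= eqxx /= big1 ?addn0 1?eq_sym //.
  by move=> a; rewrite eq_sym => /negPf ->.
have S2 c : (\sum_(q : Q) \sum_a \sum_b nshort q K (q c b) a * nshort q K (q c a) b <=
    S ^ 2 * CB * #|Q|)%N.
  under eq_bigr => q _.
    rewrite exchange_big /=; under eq_bigr => b _.
      under eq_bigr => a _ do rewrite !nshortE big_distrl /=.
      rewrite exchange_big /=; over.
    rewrite exchange_big /=; over.
  rewrite exchange_big /= (@leq_trans (\sum_(w <- short_words K) S * CB * #|Q|)%N) //; last first.
    by rewrite big_const_seq count_predT iter_addn_0 -/S; lia.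
  rewrite big_seq [leqRHS]big_seq; apply: leq_sum => w ws.
  rewrite (@leq_trans (\sum_(w' <- short_words K) CB * #|Q|)%N) //; last first.
    by rewrite big_const_seq count_predT iter_addn_0 -/S; lia.
  under eq_bigr => q _.
    under eq_bigr => b _.
      rewrite (bigD1 (walk q (q c b) w)) //= eqxx /= mul1n [X in (_ + X)%N]big1 ?addn0; last first.
        by move=> a; rewrite eq_sym => /negPf ->.
      over.
    rewrite exchange_big /=; over.
  rewrite exchange_big /= big_seq [leqRHS]big_seq; apply: leq_sum => w' ws'.
  apply: leq_trans (@sum_collision d n K.*2 (c :: w ++ c :: w') [::] (sz _ _ _ ws ws') isT isT).
  by apply: leq_sum => q _; apply: leq_sum => b _; rewrite /= walk_cat.
have S3 c : (\sum_(q : Q) \sum_a nshort q K (q c a) a <= S * CB * #|Q|)%N.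
  under eq_bigr => q _.
    under eq_bigr => a _ do rewrite nshortE.
    rewrite exchange_big /=; over.
  rewrite exchange_big /= (@leq_trans (\sum_(w <- short_words K) CB * #|Q|)%N) //; last first.
    by rewrite big_const_seq count_predT iter_addn_0 -/S; lia.
  rewrite big_seq [leqRHS]big_seq; apply: leq_sum => w ws.
  exact: (@sum_collision d n K.*2 (c :: w) [::] (szc _ _ ws) isT isT).
rewrite exchange_big /= (@leq_trans (\sum_(c < d) 4 * (S ^ 2 * CB * #|Q|) +
  \sum_(c < d) 4 * row_const K * (S * CB * #|Q|))%N) //.
  rewrite -big_split /=; apply: leq_sum => c _.
  under eq_bigr do rewrite sum_swap_error.
  rewrite !big_split /= -!big_distrr /= leq_add // ?leq_mul2l ?S3 ?orbT //.
  rewrite (_ : (4 * (S ^ 2 * CB * #|Q|) = S ^ 2 * CB * #|Q| + S ^ 2 * CB * #|Q| +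
    (S ^ 2 * CB * #|Q| + S ^ 2 * CB * #|Q|))%N); last by lia.
  by rewrite !leq_add ?S1 ?S2.
rewrite !sum_nat_const card_ord /error_const -/S -/CB.
have h1 : (S ^ 2 <= (1 + S) ^ 2)%N by rewrite leq_sqr leq_addl.
have h2 : (S <= (1 + S) ^ 2)%N by rewrite (leq_trans (leq_addl 1 S)) // leq_pmulr.
set U := ((1 + S) ^ 2)%N in h1 h2 *.
rewrite (@leq_trans (d * (4 * (U * CB * #|Q|)) + d * (4 * row_const K * (U * CB * #|Q|)))%N) //.
  by rewrite leq_add // !leq_mul2l !leq_mul2r ?h1 ?h2 ?orbT.
by apply: eq_leq; lia.
Qed.

End ErrorTerm.

(** * The Stein recursion for traces *)

Section TraceStein.
Variables d n : nat.
Local Notation Q := {ffun 'I_d -> 'S_n}.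
Implicit Types (q : Q) (t : nat -> int).

Definition new_paths q c a b j : nat := (npaths q j (q c b) a + npaths q j (q c a) b)%N.
Definition old_paths q c a b j : nat := (npaths q j (q c a) a + npaths q j (q c b) b)%N.

Lemma nodiffE q c a b j :
  nodiff q c a b j = (new_paths q c a b j)%:R - (old_paths q c a b j)%:R.
Proof. by rewrite /nodiff !natrD; ring. Qed.

Lemma sum_new_paths q K c a b : (\sum_(j < K) new_paths q c a b j = nnew q K c a b)%N.
Proof. by rewrite big_split. Qed.

Lemma sum_old_paths q K c a b : (\sum_(j < K) old_paths q c a b j = nold q K c a b)%N.
Proof. by rewrite big_split. Qed.

Lemma new_paths_le q K c a b j : (j < K)%N -> (new_paths q c a b j <= nnew q K c a b)%N.
Proof. by move=> jK; rewrite -sum_new_paths (bigD1 (Ordinal jK)) //= leq_addr. Qed.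

Lemma old_paths_le q K c a b j : (j < K)%N -> (old_paths q c a b j <= nold q K c a b)%N.
Proof. by move=> jK; rewrite -sum_old_paths (bigD1 (Ordinal jK)) //= leq_addr. Qed.

(* Number of closed paths of length [k.+1] destroyed by a swap which only
   destroys short closed paths. *)
Definition destroyed q K c a b k : int :=
  if [forall j : 'I_K, nodiff q c a b j <= 0] then - nodiff q c a b k else 0.

Lemma destroyed_bounds q K c a b k : (k < K)%N ->
  0 <= destroyed q K c a b k <= (old_paths q c a b k)%:R.
Proof.
move=> kK; rewrite /destroyed; case: ifP => [/forallP/(_ (Ordinal kK)) /=|_].
  by rewrite nodiffE; lia.
by rewrite lexx ler0n.
Qed.

(** Without new paths, [- nodiff] is exactly the number of old paths. As soon as there is a new
    path, [swap_error] is at least [nold], which bounds both terms. *)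
Lemma destroyed_direct q K c a b k : (k < K)%N ->
  `|destroyed q K c a b k - (old_paths q c a b k)%:R| <= (swap_error q K c a b)%:R.
Proof.
move=> kK; have dest := destroyed_bounds q c a b kK.
have old_le := old_paths_le q c a b kK.
rewrite /swap_error; have [X0|X0] := posnP (nnew q K c a b).
  rewrite X0 mul0n add0n; rewrite /destroyed ifT; last first.
    apply/forallP => j; rewrite nodiffE.
    by have := new_paths_le q c a b (ltn_ord j); rewrite X0; lia.
  by rewrite nodiffE; have := new_paths_le q c a b kK; rewrite X0; lia.
rewrite (@le_trans _ _ (nold q K c a b)%:R) //; first by lia.
by rewrite ler_nat; case: (nnew q K c a b) X0 => // X _; rewrite mulSn; lia.
Qed.

Definition trace_event q K t : bool := [forall j : 'I_K, \tr (amx q ^+ j.+1) == t j.+1].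

(** When [t] are the traces after the creation of one cycle of length [l], these are the traces
    before it. *)
Definition cycle_shift l t : nat -> int := fun j => t j - (if (l %| j)%N then l%:R else 0).

(** The pair is read backwards, from the swapped tuple. Without new paths, either all net counts
    vanish or the first nonzero count of the reverse swap is positive; in both cases [destroyed] is
    0. With one new path and no old one, [nodiff_create] and [trace_create] are exact. In the
    remaining cases the two terms are bounded separately, by [2 d^k] and by [nnew], and charged to
    [swap_error]. *)
Lemma destroyed_reverse q K c a b k t : (k < K)%N ->
  `| (trace_event (swap c a b q) K t)%:R * destroyed (swap c a b q) K c a b k -
     \sum_(l < K | (l.+1 %| k.+1)%N)
        (trace_event q K (cycle_shift l.+1 t))%:R * (new_paths q c a b l)%:R |
  <= ((d ^ k).*2.+1 * swap_error q K c a b)%:R.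
Proof.
move=> kK; set q' := swap c a b q.
have [X0|X0] := posnP (nnew q K c a b).
  rewrite [X in _ - X]big1 ?subr0; last first.
    move=> l _; have := new_paths_le q c a b (ltn_ord l).
    by rewrite X0 leqn0 => /eqP ->; rewrite mulr0.
  suff -> : destroyed q' K c a b k = 0 by rewrite mulr0 normr0.
  have NE j : (j < K)%N -> nodiff q c a b j = - (old_paths q c a b j)%:R.
    by move=> jK; rewrite nodiffE; have := new_paths_le q c a b jK; rewrite X0; lia.
  have [/existsP exm|/existsPn nex] := boolP [exists j : 'I_K, nodiff q c a b j != 0].
    have exm' : exists m, (m < K)%N && (nodiff q c a b m != 0).
      by case: exm => j Nj; exists j; rewrite ltn_ord.
    case: (ex_minnP exm') => m /andP[mK Nm] minm.
    rewrite /destroyed ifF //; apply/negP => /forallP/(_ (Ordinal mK)) /=.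
    rewrite nodiff_rev_lead ?NE //; first by move: Nm; rewrite NE //; lia.
    move=> j jm; have jK := ltn_trans jm mK.
    by apply/eqP; apply: contraTT jm => Nj; rewrite -leqNgt minm // jK.
  rewrite /destroyed nodiff_rev_lead; last first.
    by move=> j jk; apply/eqP; have := nex (Ordinal (ltn_trans jk kK)); rewrite negbK.
  have /eqP -> : nodiff q c a b k == 0 by have := nex (Ordinal kK); rewrite negbK.
  by rewrite !oppr0; case: ifP.
have [/andP[/eqP X1 /eqP s0]|XS] := boolP ((nnew q K c a b == 1%N) && (nold q K c a b == 0%N)).
  have [l lK newE] : exists2 l, (l < K)%N & forall j, (j < K)%N ->
      new_paths q c a b j = (j == l).
    have /existsP[l Nl] : [exists l : 'I_K, (0 < new_paths q c a b l)%N].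
      apply: contraT; rewrite negb_exists => /forallP h.
      rewrite -sum_new_paths big1 // in X1 => l _.
      by apply/eqP; rewrite -leqn0 leqNgt.
    exists l; rewrite ?ltn_ord // => j jK.
    have := X1; rewrite -sum_new_paths (bigD1 l) //=.
    have [->|jl] := eqVneq j l; first by move: Nl; case: new_paths => // -[|//]; lia.
    rewrite (bigD1 (Ordinal jK)) //=; first by lia.
  have Nl j : (j < K)%N -> nodiff q c a b j = (j == l)%:R.
    move=> jK; rewrite nodiffE newE //; have := old_paths_le q c a b jK.
    by rewrite s0; lia.
  have dE : destroyed q' K c a b k = (l.+1 %| k.+1)%:R.
    rewrite /destroyed ifT; first by rewrite (nodiff_create lK Nl) // opprK.
    by apply/forallP => j; rewrite (nodiff_create lK Nl) // oppr_le0 ler0n.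
  have evE : trace_event q' K t = trace_event q K (cycle_shift l.+1 t).
    apply: eq_forallb => j; rewrite (trace_create lK Nl) //.
    by rewrite /cycle_shift eq_sym -subr_eq eq_sym.
  rewrite dE evE big_mkcond (bigD1 (Ordinal lK)) //= big1 ?addr0; last first.
    move=> j jl; rewrite newE //.
    by rewrite (negPf (_ : nat_of_ord j != l)) // mulr0; case: ifP.
  rewrite newE // eqxx mulr1; case: (l.+1 %| k.+1)%N; rewrite ?mulr1 ?mulr0 subrr normr0 //.
have W1 : (0 < swap_error q K c a b)%N.
  rewrite /swap_error; move: X0 XS; case: (nnew q K c a b) => [//|[|X]] _.
  - by rewrite eqxx /= -lt0n !mul1n.
  - by rewrite addn_gt0 muln_gt0.
have XW : (nnew q K c a b <= swap_error q K c a b)%N.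
  rewrite /swap_error; move: X0 XS; case: (nnew q K c a b) => [//|[|X]] _.
  - by rewrite eqxx /= -lt0n mul1n => h; lia.
  - by rewrite (leq_trans _ (leq_addr _ _)) // leq_pmulr.
rewrite mulSn addnC natrD (le_trans (ler_normB _ _)) // lerD //.
  have /andP[d0 dle] := destroyed_bounds q' c a b kK.
  rewrite normrM [`|destroyed _ _ _ _ _ _|]ger0_norm //.
  rewrite (@le_trans _ _ (destroyed q' K c a b k)) //.
    by case: trace_event; rewrite ?normr1 ?mul1r ?normr0 ?mul0r.
  rewrite (le_trans dle) // ler_nat (@leq_trans (d ^ k).*2) ?leq_pmulr //.
  by rewrite -addnn leq_add // npaths_le.
rewrite ger0_norm; last by apply: sumr_ge0 => l _; rewrite mulr_ge0 ?ler0n.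
rewrite (@le_trans _ _ (nnew q K c a b)%:R) ?ler_nat //.
rewrite -sum_new_paths natr_sum big_mkcond; apply: ler_sum => l _.
by case: ifP => _; [case: trace_event; rewrite ?mul1r ?mul0r|]; rewrite ?ler0n.
Qed.

(** In each of the two terms one of the points [a], [b] is free and contributes a factor [n]. *)
Lemma sum_old_trace q k :
  \sum_c \sum_a \sum_b (old_paths q c a b k)%:R = (2 * n)%:R * \tr (amx q ^+ k.+1) :> int.
Proof.
rewrite trace_npaths mulr_sumr; apply: eq_bigr => c _.
under eq_bigr do under eq_bigr do rewrite natrD.
under eq_bigr do rewrite big_split /= sumr_const card_ord.
rewrite big_split /= sumr_const card_ord.
rewrite sumrMnl -[X in X + _]mulr_natl -[X in _ + X]mulr_natl natrM; ring.
Qed.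

Lemma sum_new_total q k :
  (\sum_c \sum_a \sum_b new_paths q c a b k = 2 * n * d ^ k.+1)%N.
Proof.
transitivity (\sum_(c < d) 2 * (n * d ^ k))%N; last first.
  by rewrite sum_nat_const card_ord expnS; lia.
apply: eq_bigr => c _.
under eq_bigr do rewrite big_split /=.
rewrite big_split /= exchange_big /= mul2n -addnn; congr (_ + _)%N.
  under eq_bigr do rewrite sum_npaths_row.
  by rewrite sum_nat_const card_ord.
under eq_bigr do rewrite sum_npaths_row.
by rewrite sum_nat_const card_ord.
Qed.

Definition trace_count K t : nat := #|[pred q : Q | trace_event q K t]|.

Lemma trace_countE K t : (trace_count K t)%:R = \sum_q (trace_event q K t)%:R :> int.
Proof.
rewrite /trace_count -sum1_card natr_sum big_mkcond /=.
by apply: eq_bigr => q _; rewrite inE; case: trace_event.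
Qed.

(** The total [L] of destroyed closed paths is computed twice: directly it is close to [2 n t_(k+1)]
    times the count, and after reindexing by the swap it is close to the sum over the created
    cycles. The constant [2 d^k + 2] adds the two errors [1] and [2 d^k + 1]. *)
Lemma trace_stein K k t : (k < K)%N ->
  (2 * n)%:R * `| t k.+1 * (trace_count K t)%:R -
    \sum_(l < K | (l.+1 %| k.+1)%N)
       (d ^ l.+1)%:R * (trace_count K (cycle_shift l.+1 t))%:R |
  <= ((d ^ k).*2.+2 * error_const d K * #|Q|)%:R.
Proof.
move=> kK.
pose L := \sum_q \sum_c \sum_a \sum_b (trace_event q K t)%:R * destroyed q K c a b k.
have LE : L = \sum_q \sum_c \sum_a \sum_b (trace_event (swap c a b q) K t)%:R *
    destroyed (swap c a b q) K c a b k.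
  rewrite /L exchange_big [RHS]exchange_big; apply: eq_bigr => c _ /=.
  rewrite exchange_big [RHS]exchange_big; apply: eq_bigr => a _ /=.
  rewrite exchange_big [RHS]exchange_big; apply: eq_bigr => b _ /=.
  by rewrite (reindex_inj (inv_inj (@swapK _ _ c a b))).
have err_le : \sum_(q : Q) \sum_c \sum_a \sum_b (swap_error q K c a b)%:R <=
    (error_const d K * #|Q|)%:R :> int.
  under eq_bigr do under eq_bigr do under eq_bigr do rewrite -natr_sum.
  under eq_bigr do under eq_bigr do rewrite -natr_sum.
  under eq_bigr do rewrite -natr_sum.
  by rewrite -natr_sum ler_nat sum_swap_error_le.
have L1 : `|L - (2 * n)%:R * (t k.+1 * (trace_count K t)%:R)| <=
    (error_const d K * #|Q|)%:R.
  rewrite trace_countE !mulr_sumr -sumrB (le_trans (ler_norm_sum _ _ _)) //.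
  apply: le_trans err_le; apply: ler_sum => q _.
  case ev : (trace_event q K t); last first.
    rewrite !mulr0 subr0 big1 ?normr0; last first.
      by move=> c _; rewrite big1 // => a _; rewrite big1 // => b _; rewrite mul0r.
    by do 3!(apply: sumr_ge0 => ? _); rewrite ler0n.
  rewrite mulr1; move/forallP/(_ (Ordinal kK))/eqP: ev => /= <-.
  rewrite -sum_old_trace -sumrB (le_trans (ler_norm_sum _ _ _)) //; apply: ler_sum => c _.
  rewrite -sumrB (le_trans (ler_norm_sum _ _ _)) //; apply: ler_sum => a _.
  rewrite -sumrB (le_trans (ler_norm_sum _ _ _)) //; apply: ler_sum => b _.
  by rewrite mul1r; exact: destroyed_direct.
have L2 : `|L - (2 * n)%:R * \sum_(l < K | (l.+1 %| k.+1)%N)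
       (d ^ l.+1)%:R * (trace_count K (cycle_shift l.+1 t))%:R| <=
    ((d ^ k).*2.+1 * (error_const d K * #|Q|))%:R.
  have -> : (2 * n)%:R * \sum_(l < K | (l.+1 %| k.+1)%N)
       (d ^ l.+1)%:R * (trace_count K (cycle_shift l.+1 t))%:R =
     \sum_q \sum_c \sum_a \sum_b \sum_(l < K | (l.+1 %| k.+1)%N)
       (trace_event q K (cycle_shift l.+1 t))%:R * (new_paths q c a b l)%:R :> int.
    rewrite mulr_sumr.
    under [RHS]eq_bigr do under eq_bigr do under eq_bigr do rewrite exchange_big /=.
    under [RHS]eq_bigr do under eq_bigr do rewrite exchange_big /=.
    under [RHS]eq_bigr do rewrite exchange_big /=.
    rewrite [RHS]exchange_big /=; apply: eq_bigr => l _.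
    rewrite trace_countE mulrA mulr_sumr; apply: eq_bigr => q _.
    under eq_bigr do under eq_bigr do rewrite -mulr_sumr -natr_sum.
    under eq_bigr do rewrite -mulr_sumr -natr_sum.
    by rewrite -mulr_sumr -natr_sum sum_new_total -[in LHS]natrM; exact: mulrC.
  rewrite LE -sumrB (le_trans (ler_norm_sum _ _ _)) //.
  rewrite natrM; apply: le_trans (ler_wpM2l (ler0n _ _) err_le).
  rewrite mulr_sumr; apply: ler_sum => q _.
  rewrite mulr_sumr -sumrB (le_trans (ler_norm_sum _ _ _)) //; apply: ler_sum => c _.
  rewrite mulr_sumr -sumrB (le_trans (ler_norm_sum _ _ _)) //; apply: ler_sum => a _.
  rewrite mulr_sumr -sumrB (le_trans (ler_norm_sum _ _ _)) //; apply: ler_sum => b _.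
  by rewrite -natrM; exact: destroyed_reverse.
rewrite -[(2 * n)%:R in leLHS]ger0_norm ?ler0n // -normrM mulrBr.
set A := _ * (t k.+1 * _) in L1 *; set B := _ * \sum_(l < K | _) _ in L2 *.
have -> : A - B = (L - B) - (L - A) by ring.
rewrite (le_trans (ler_normB _ _)) //.
by rewrite (le_trans (lerD L2 L1)) // -natrD ler_nat; apply: eq_leq; lia.
Qed.

End TraceStein.

(** * Second moments of the coefficients *)

Section SecondMoment.
Variables d n : nat.
Local Notation Q := {ffun 'I_d -> 'S_n}.
Local Notation Fun := {ffun 'I_n -> option 'I_d}.
Implicit Types (q : Q) (f : Fun).

(** Multilinearity expands row [i] of [1 - X A] into the identity row, chosen when [f i = None], or
    one of the [d] permutation rows. Hence the completion of the partial function by the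
    identity. *)
Definition gmap q f (i : 'I_n) : 'I_n := if f i is Some c then q c i else i.
Definition fsupp f : {set 'I_n} := [set i | f i != None].
Definition fcol f c : {set 'I_n} := [set i | f i == Some c].
Definition fun_mx (g : 'I_n -> 'I_n) : 'M[int]_n := \matrix_(i, j) (g i == j)%:R.
Definition fdet q f : int := \det (fun_mx (gmap q f)).

Lemma big_option (R : Type) (idx : R) (op : Monoid.com_law idx) (I : finType) (F : option I -> R) :
  \big[op/idx]_(o : option I) F o = op (F None) (\big[op/idx]_c F (Some c)).
Proof.
rewrite (bigD1 None) //=; congr (op _ _).
rewrite (reindex_omap Some id) /=; last by case.
by apply: eq_bigl => c; rewrite /= eqxx.
Qed.

Lemma revchar_expand q : revchar (amx q) =
  \sum_f (- 'X) ^+ #|fsupp f| * (fdet q f)%:P.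
Proof.
pose E (i : 'I_n) (j : 'I_n) (o : option 'I_d) : {poly int} :=
  if o is Some c then - 'X * ((q c i == j)%:R)%:P else ((i == j)%:R)%:P.
have ME i j : revchar_mx (amx q) i j = \sum_(o : option 'I_d) E i j o.
  rewrite big_option /= !mxE amxE -mulr_sumr; congr (_ + _).
    by case: eqP; rewrite ?mulr1n ?mulr0n.
  by rewrite mulNr rmorph_sum.
rewrite /revchar /determinant.
under eq_bigr => s _.
  under eq_bigr do rewrite ME.
  rewrite bigA_distr_bigA mulr_sumr /=; over.
rewrite exchange_big /=; apply: eq_bigr => f _.
rewrite /fdet /determinant rmorph_sum mulr_sumr; apply: eq_bigr => s _.
rewrite rmorphM rmorph_sign mulrCA /=; congr (_ * _).
rewrite rmorph_prod -prodr_const [X in _ = X * _]big_mkcond -big_split /=.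
apply: eq_bigr => i _; rewrite /E !mxE /gmap inE.
by case: (f i) => [c|] /=; rewrite ?mul1r.
Qed.

Lemma revchar_coefE q k :
  (revchar (amx q))`_k = (-1) ^+ k * \sum_(f : Fun | #|fsupp f| == k) fdet q f.
Proof.
rewrite revchar_expand coef_sum mulr_sumr [RHS]big_mkcond; apply: eq_bigr => f _.
have NXE m : ((- 'X) ^+ m : {poly int})`_k = (-1) ^+ m * (k == m)%:R.
  rewrite [in LHS]exprNn -[in LHS]signr_odd -[in RHS]signr_odd.
  by case: odd; rewrite ?expr1 ?mulN1r ?coefN ?expr0 ?mul1r coefXn.
rewrite coefMC NXE eq_sym; case: eqP => [->|_]; first by rewrite mulr1.
by rewrite mulr0 mul0r.
Qed.

Lemma fdet_le q f : `|fdet q f| <= (injectiveb (gmap q f))%:R.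
Proof.
rewrite /fdet; case: (boolP (injectiveb _)) => [/injectiveP inj|ninj].
  have -> : fun_mx (gmap q f) = perm_mx (perm inj).
    by apply/matrixP => i j; rewrite !mxE permE.
  by rewrite det_perm normrX normrN normr1 expr1n.
have /injectivePn[a [b ab gab]] := ninj.
rewrite (determinant_alternate ab) ?normr0 // => j.
by rewrite !mxE gab.
Qed.

Lemma gmap_swap q f c a b i : f a = Some c -> f b = Some c ->
  gmap (swap c a b q) f i = gmap q f (tperm a b i).
Proof.
move=> fa fb; rewrite /gmap; case: tpermP => [->|->|ia ib].
- by rewrite fa fb ffunE eqxx permM tpermL.
- by rewrite fa fb ffunE eqxx permM tpermR.
- case: (f i) => // c'; rewrite ffunE; case: eqP => // _.
  by rewrite permM tpermD //; apply/eqP => e; [apply: ia | apply: ib].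
Qed.

Lemma gmap_swap_off q f c a b i : f a != Some c -> f b != Some c ->
  gmap (swap c a b q) f i = gmap q f i.
Proof.
move=> fa fb; rewrite /gmap; case fi: (f i) => [c'|//]; rewrite ffunE.
case: eqP => // c'c; rewrite permM tpermD //; apply/eqP => e.
  by move: fa; rewrite e fi c'c eqxx.
by move: fb; rewrite e fi c'c eqxx.
Qed.

(** Swapping the values of [q c] at [a] and [b] exchanges two rows of the first matrix and leaves
    the second one unchanged, so the sum equals its opposite. *)
Lemma sum_fdet_cancel f f' c a b : a != b ->
  a \in fcol f c -> b \in fcol f c -> a \notin fcol f' c -> b \notin fcol f' c ->
  \sum_q fdet q f * fdet q f' = 0.
Proof.
rewrite !inE => ab /eqP fa /eqP fb f'a f'b.
set s := \sum_q _; suff : s = - s by lia.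
rewrite {1}/s (reindex_inj (inv_inj (@swapK _ _ c a b))) -sumrN.
apply: eq_bigr => q _; rewrite -mulNr; congr (_ * _); last first.
  congr (\det _); apply/matrixP => i j; rewrite !mxE.
  by rewrite gmap_swap_off.
have -> : fdet (swap c a b q) f = \det (row_perm (tperm a b) (fun_mx (gmap q f))).
  congr (\det _); apply/matrixP => i j; rewrite !mxE.
  by rewrite gmap_swap.
by rewrite row_permE det_mulmx det_perm odd_tperm ab expr1 mulN1r.
Qed.

Definition ninj f := #|[set q : Q | injectiveb (gmap q f)]|.
Definition ninj2 f f' := #|[set q : Q | injectiveb (gmap q f) && injectiveb (gmap q f')]|.

(** The pairs which survive the cancellation of [sum_fdet_cancel]. *)
Definition compat f f' := [forall c, (#|fcol f c :\: fcol f' c| <= 1)%N &&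
                                     (#|fcol f' c :\: fcol f c| <= 1)%N].

Lemma sum_fdet_le f f' :
  `|\sum_q fdet q f * fdet q f'| <= (if compat f f' then ninj2 f f' else 0%N)%:R.
Proof.
case: ifP => [_|/negbT].
  rewrite (le_trans (ler_norm_sum _ _ _)) // /ninj2 -sum1_card natr_sum [leRHS]big_mkcond.
  apply: ler_sum => q _; rewrite inE normrM.
  have := fdet_le q f; have := fdet_le q f'.
  case: (injectiveb _) => h; case: (injectiveb _) => h' /=; rewrite ?inE.
  - by rewrite -[leRHS]mulr1 ler_pM.
  - by move: h'; rewrite normr_le0 => /eqP ->; rewrite normr0 mul0r.
  - by move: h; rewrite normr_le0 => /eqP ->; rewrite normr0 mulr0.
  - by move: h; rewrite normr_le0 => /eqP ->; rewrite normr0 mulr0.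
rewrite negb_forall => /existsP[c]; rewrite negb_and -!ltnNge.
have two (A : {set 'I_n}) : (1 < #|A|)%N -> exists a b, [/\ a \in A, b \in A & a != b].
  by move=> /card_gt1P[a [b [aA bA ab]]]; exists a, b.
case/orP => /two[a [b [+ + ab]]]; rewrite !finset.in_setD => /andP[a1 a2] /andP[b1 b2].
  by rewrite (sum_fdet_cancel ab a2 b2 a1 b1) normr0.
under eq_bigr do rewrite mulrC.
by rewrite (sum_fdet_cancel ab a2 b2 a1 b1) normr0.
Qed.

Lemma exists_perm_imset (S T : {set 'I_n}) : #|S| = #|T| ->
  exists r : 'S_n, r @: S = T.
Proof.
move=> ST; pose eS := enum S ++ enum (~: S); pose eT := enum T ++ enum (~: T).
have uS : uniq eS.
  rewrite cat_uniq !enum_uniq andbT /=; apply/hasPn => x.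
  by rewrite !mem_enum inE.
have uT : uniq eT.
  rewrite cat_uniq !enum_uniq andbT /=; apply/hasPn => x.
  by rewrite !mem_enum inE.
have mS x : x \in eS by rewrite mem_cat !mem_enum inE orbN.
have szS : size eS = size eT.
  rewrite !size_cat -!cardE; apply/eqP.
  by rewrite !cardsC.
pose g x := nth x eT (index x eS).
have gE x y : g x = nth y eT (index x eS).
  by apply: set_nth_default; rewrite -szS index_mem.
have ginj : injective g.
  move=> x y; rewrite (gE x x) (gE y x) => /eqP.
  rewrite nth_uniq ?uT // -?szS ?index_mem // => /eqP e.
  by rewrite -(nth_index x (mS x)) e (nth_index x (mS y)).
exists (perm ginj); apply/eqP; rewrite eqEcard card_imset ?ST; last exact: perm_inj.
rewrite leqnn andbT; apply/fintype.subsetP => _ /imsetP[x xS ->].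
rewrite permE /g index_cat mem_enum xS nth_cat -cardE -ST cardE index_mem mem_enum xS.
by rewrite -mem_enum mem_nth // -cardE -ST cardE index_mem mem_enum.
Qed.

Lemma gmap_imset q f : injective (gmap q f) -> gmap q f @: fsupp f = fsupp f.
Proof.
move=> inj; apply/eqP; rewrite eqEcard card_imset // leqnn andbT.
apply/fintype.subsetP => _ /imsetP[i iS ->]; rewrite inE; apply: contraTneq iS => e.
rewrite inE negbK; have : gmap q f (gmap q f i) = gmap q f i by rewrite {1}/gmap e.
by move/inj => ei; rewrite -ei e.
Qed.

(** An injective completed map preserves its support [S]. Composing all permutations with a chosen
    one taking [S] to [T] makes the image of [S] equal to [T], so that [T] and then the original
    tuple can be recovered. *)
Lemma ninj_le f : ('C(n, #|fsupp f|) * ninj f <= #|Q|)%N.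
Proof.
set S := fsupp f; pose k := #|S|.
pose rT (T : {set 'I_n}) : 'S_n := odflt 1%g [pick r : 'S_n | r @: S == T].
have rTE (T : {set 'I_n}) : #|T| == k -> rT T @: S = T.
  move=> /eqP Tk; rewrite /rT; case: pickP => [r /eqP //|].
  by have [r /eqP rST] := exists_perm_imset (esym Tk); move=> /(_ r); rewrite rST.
pose h (qT : Q * {set 'I_n}) : Q := [ffun c => (qT.1 c * rT qT.2)%g].
pose D := finset.setX [set q : Q | injectiveb (gmap q f)] [set T : {set 'I_n} | #|T| == k].
have hE q (T : {set 'I_n}) : injectiveb (gmap q f) -> #|T| == k ->
    [set (if f i is Some c then h (q, T) c i else i) | i in S] = T.
  move=> /injectiveP inj Tk; have gS : gmap q f @: S = S := gmap_imset inj.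
  rewrite -[RHS](rTE T Tk) -[in RHS]gS -imset_comp.
  apply: eq_in_imset => i; rewrite inE /= /gmap; case: (f i) => // c _.
  by rewrite ffunE permM.
have cardD : #|D| = ('C(n, k) * ninj f)%N.
  by rewrite cardsX card_draws card_ord mulnC.
rewrite -/k -cardD -(card_in_imset (f := h)) ?max_card //.
move=> [q T] [q' T']; rewrite !inE /= => /andP[qi Tk] /andP[qi' Tk'] e.
have TT' : T = T' by rewrite -(hE q T) // e hE.
congr (_, _) => //; apply/ffunP => c; have := congr1 (fun q : Q => q c) e.
by rewrite !ffunE /= TT' => /mulIg.
Qed.

Lemma card_fsupp k : #|[pred f : Fun | #|fsupp f| == k]| = ('C(n, k) * d ^ k)%N.
Proof.
rewrite -sum1_card (partition_big fsupp (fun S : {set 'I_n} => #|S| == k)) //=.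
rewrite (eq_bigr (fun=> d ^ k)%N); last first.
  move=> S /eqP Sk; transitivity (#|predC1 (None : option 'I_d)| ^ #|S|)%N; last first.
    by rewrite cardC1 card_option card_ord Sk.
  rewrite -(card_pffun_on None) -sum1_card; apply: eq_bigl => f; rewrite inE.
  apply/andP/pffun_onP => [[_ /eqP <-]|[fS Sf]].
    split; first by apply/supportP => i; rewrite inE negbK => /eqP.
    by move=> o /fintype.imageP[i iS eo]; rewrite inE in iS; rewrite inE eo.
  have eS : fsupp f = S.
    apply/setP => i; rewrite inE; apply/idP/idP => [fi|iS].
      by apply: contraNT fi => /(supportP fS) ->.
    have : f i \in [seq f x | x in S] by apply: fintype.image_f.
    by move/Sf.
  by rewrite eS Sk !eqxx.
rewrite sum_nat_const; congr (_ * _)%N.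
by rewrite -[n in RHS]card_ord -card_draws; apply: eq_card => S; rewrite !inE.
Qed.

(** The number ['C(n, k) * d ^ k] of partial functions with support of size [k] cancels the binomial
    coefficient of [ninj_le]. *)
Lemma sum_ninj k : (\sum_(f : Fun | #|fsupp f| == k) ninj f <= d ^ k * #|Q|)%N.
Proof.
have [nk|kn] := ltnP n k.
  rewrite big1 // => f /eqP fk; have := max_card (mem (fsupp f)).
  by rewrite fk card_ord leqNgt nk.
have C0 : (0 < 'C(n, k))%N by rewrite bin_gt0.
rewrite -(leq_pmul2l C0) big_distrr /= mulnA -card_fsupp -sum_nat_const.
by apply: leq_sum => f /eqP <-; exact: ninj_le.
Qed.

End SecondMoment.

(** * Pairs of compatible partial functions *)

Section SecondMomentBound.
Variables d n : nat.
Local Notation Q := {ffun 'I_d -> 'S_n}.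
Local Notation Fun := {ffun 'I_n -> option 'I_d}.
Implicit Types (q : Q) (f : Fun).

Section Reassign.
Variables (f f' : Fun) (i0 : 'I_n).
Hypothesis cff' : compat f f'.

Let C : {set 'I_d} := [set c | fcol f' c :\: fcol f c != finset.set0].
Let a c : 'I_n := odflt i0 [pick i in fcol f' c :\: fcol f c].

Let aE c : c \in C -> fcol f' c :\: fcol f c = [set a c].
Proof.
rewrite inE => nC; apply/esym/eqP; rewrite eqEcard cards1.
move/forallP/(_ c)/andP: cff' => [_ ->]; rewrite andbT finset.sub1set /a.
by case: pickP => // h; case/set0Pn: nC => i; rewrite h.
Qed.

Let a_new c : c \in C -> (a c \notin fcol f c) && (a c \in fcol f' c).
Proof. by move=> /aE e; rewrite -finset.in_setD e inE. Qed.

(** Admissible new positions for the point [a c]. Colours outside [C] get a singleton, so that the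
    family has cardinality the product of the [n - #|fcol f c|] over [C]. *)
Let Om c : {set 'I_n} := if c \in C then ~: fcol f c else [set i0].

Let move_new (s : {ffun 'I_d -> 'I_n}) q : Q :=
  [ffun c => if c \in C then (tperm (a c) (s c) * q c)%g else q c].

Let move_newK s : involutive (move_new s).
Proof.
move=> q; apply/ffunP => c; rewrite !ffunE; case: (c \in C) => //.
by rewrite mulgA tperm2 mul1g.
Qed.

Let OmP (s : {ffun 'I_d -> 'I_n}) c : s \in family Om -> c \in C -> s c \notin fcol f c.
Proof. by move=> /familyP/(_ c); rewrite /Om; case: ifP => // _; rewrite inE. Qed.

Let gmap_move s q : s \in family Om -> gmap (move_new s q) f =1 gmap q f.
Proof.
move=> sO i; rewrite /gmap; case fi: (f i) => [c|//]; rewrite ffunE.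
case: ifP => // cC; rewrite permM tpermD //.
  by apply: contraTneq (a_new cC) => ->; rewrite !inE fi eqxx.
by apply: contraNneq (OmP sO cC) => ->; rewrite inE fi.
Qed.

Let A : {set 'I_n} := [set a c | c in C].

Let gmap_move_off s q i : s \in family Om -> i \notin A ->
  gmap (move_new s q) f' i = gmap q f' i.
Proof.
move=> sO iA; rewrite /gmap; case f'i: (f' i) => [c|//]; rewrite ffunE.
case: ifP => // cC; have ia : i != a c.
  by apply: contraNneq iA => ->; apply: imset_f.
have ifc : i \in fcol f c.
  have : i \notin fcol f' c :\: fcol f c by rewrite (aE cC) inE.
  by rewrite finset.in_setD negb_and negbK [i \in fcol f' c]inE f'i eqxx orbF.
rewrite permM tpermD //; first by rewrite eq_sym.
by apply: contraNneq (OmP sO cC) => ->.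
Qed.

(** The moved points must take values in the complement [W] of the values at the other points, which
    [s] does not affect. As [W] has at most [d] elements and each [q c] is injective, there are at
    most [d] choices per colour. *)
Let card_valid q :
  (#|[set s in family Om | injectiveb (gmap (move_new s q) f')]| <= d ^ d)%N.
Proof.
set V := [set s in _ | _].
have [->|] := eqVneq V finset.set0; first by rewrite cards0.
case/set0Pn => s0; rewrite inE => /andP[s0O /injectiveP inj0].
pose W : {set 'I_n} := ~: (gmap q f' @: ~: A).
have Wd : (#|W| <= d)%N.
  rewrite /W cardsCs finset.setCK card_in_imset; last first.
    move=> i j; rewrite !inE => iA jA.
    by rewrite -(gmap_move_off q s0O iA) -(gmap_move_off q s0O jA) => /inj0.
  have := cardsC A => <-; rewrite addnK.
  by rewrite (leq_trans (leq_imset_card _ _)) // -[leqRHS]card_ord max_card.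
pose h (s : {ffun 'I_d -> 'I_n}) : {ffun 'I_d -> 'I_n} := [ffun c => q c (s c)].
have hinj : injective h.
  move=> s s' e; apply/ffunP => c; have := congr1 (fun s : {ffun _ -> _} => s c) e.
  by rewrite !ffunE => /perm_inj.
pose T c : {set 'I_n} := if c \in C then W else [set q c i0].
rewrite -(card_imset _ hinj) (@leq_trans #|family T|) //.
  apply: subset_leq_card; apply/fintype.subsetP => _ /imsetP[s + ->].
  rewrite inE => /andP[sO /injectiveP inj]; apply/familyP => c; rewrite /T ffunE.
  case: ifP => cC; last first.
    by move/familyP/(_ c): sO; rewrite /Om cC !inE => /eqP ->.
  have ga : gmap (move_new s q) f' (a c) = q c (s c).
    have := a_new cC; rewrite [_ \in fcol f' _]inE /gmap => /andP[_ /eqP ->].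
    by rewrite ffunE cC permM tpermL.
  rewrite inE -ga; apply/negP => h1; have [i iA0] := imsetP h1.
  have iA : i \notin A by move: iA0; rewrite inE.
  rewrite -(gmap_move_off q sO iA) => /inj e.
  by move: iA; rewrite -e imset_f.
rewrite card_family foldrE big_map big_enum /=.
rewrite (@leq_trans (\prod_(c < d) d)%N) //; last by rewrite prod_nat_const card_ord.
apply: leq_prod => c _; rewrite /T; case: ifP => // _; rewrite cards1.
exact: leq_ltn_trans (ltn_ord c).
Qed.

(** Double counting of pairs [(q, s)]: for fixed [s] the involution [move_new s] leaves the map of
    [f] unchanged, so [s] contributes [ninj2]; for fixed [q] at most [d ^ d] choices of [s] are
    valid. *)
Lemma ninj2_le_aux :
  (\prod_c (if c \in C then n - #|fcol f c| else 1) * ninj2 f f' <= d ^ d * ninj f)%N.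
Proof.
have -> : (\prod_c (if c \in C then n - #|fcol f c| else 1) = #|family Om|)%N.
  rewrite card_family foldrE big_map big_enum /=; apply: eq_bigr => c _.
  by rewrite /Om; case: ifP => _; rewrite ?cards1 // [RHS]cardsCs finset.setCK card_ord.
rewrite mulnC [leqRHS]mulnC.
apply: (@leq_trans (\sum_(q : Q) \sum_(s in family Om)
   (injectiveb (gmap q f) && injectiveb (gmap (move_new s q) f')))%N).
  rewrite exchange_big /= mulnC -sum_nat_const; apply: leq_sum => s sO.
  rewrite (reindex_inj (inv_inj (move_newK s))) /= /ninj2 -sum1_card [leqLHS]big_mkcond.
  apply: leq_sum => q _; rewrite inE move_newK.
  by rewrite (eq_injectiveb (gmap_move q sO)); case: (_ && _).
rewrite /ninj -sum_nat_const [leqRHS]big_mkcond; apply: leq_sum => q _.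
rewrite inE; case: (injectiveb (gmap q f)) => /=; last by rewrite big1.
apply: leq_trans (card_valid q).
rewrite -sum1_card [leqLHS]big_mkcond [leqRHS]big_mkcond; apply: leq_sum => s _.
by rewrite inE; case: (s \in family Om); case: injectiveb.
Qed.

End Reassign.

Definition new_weight f c (V : {set 'I_n}) : rat := ((n - #|fcol f c|)%:R^-1) ^+ #|V|.

Lemma ninj2_le f f' : compat f f' ->
  (ninj2 f f')%:R <= (d ^ d * ninj f)%:R * \prod_c new_weight f c (fcol f' c :\: fcol f c).
Proof.
move=> cff'; have [n0|n0] := posnP n.
  rewrite big1; last first.
    move=> c _; rewrite /new_weight.
    have -> : #|fcol f' c :\: fcol f c| = 0%N.
      by apply/eqP; rewrite -leqn0 -[X in (_ <= X)%N]n0 -[X in (_ <= X)%N]card_ord max_card.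
    by rewrite expr0.
  rewrite mulr1 ler_nat (@leq_trans (ninj f)) //; last first.
    by rewrite leq_pmull // expn_gt0; case: (d).
  by apply: subset_leq_card; apply/fintype.subsetP => q; rewrite !inE => /andP[].
have := ninj2_le_aux (Ordinal n0) cff'.
set C := [set c | _]; rewrite -(ler_nat rat) natrM natr_prod => h.
have pos c : c \in C -> (0 < n - #|fcol f c|)%N.
  rewrite inE => /set0Pn[j]; rewrite finset.in_setD => /andP[jF _].
  rewrite subn_gt0 -[X in (_ < X)%N]card_ord -cardsT.
  by apply: proper_card; apply/properP; split; [exact: finset.subsetT | exists j].
have wE c : new_weight f c (fcol f' c :\: fcol f c) =
    (if c \in C then (n - #|fcol f c|)%N else 1%N)%:R^-1.
  rewrite /new_weight inE; case: eqVneq => [->|ne] /=; first by rewrite cards0 expr0 invr1.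
  have -> : #|fcol f' c :\: fcol f c| = 1%N.
    apply/eqP; rewrite eqn_leq; move/forallP/(_ c)/andP: cff' => [_ ->] /=.
    by rewrite card_gt0.
  by rewrite expr1.
under eq_bigr do rewrite wE.
rewrite prodfV ler_pdivlMr; first by rewrite mulrC.
by apply: prodr_gt0 => c _; case: ifP => [/pos|_]; rewrite ltr0n.
Qed.

Lemma sum_small_subsets (B : {set 'I_n}) (x : rat) :
  \sum_(U : {set 'I_n} | (U \subset B) && (#|U| <= 1)%N) x ^+ #|U| = 1 + #|B|%:R * x.
Proof.
rewrite (bigID (fun U : {set 'I_n} => #|U| == 0%N)) /=; congr (_ + _).
  rewrite (eq_bigl (fun U => U == finset.set0)) ?big_pred1_eq ?cards0 ?expr0 //.
  move=> U; rewrite cards_eq0; case: eqP => [->|]; rewrite ?andbF //.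
  by rewrite finset.sub0set cards0.
rewrite (eq_bigl (fun U => U \in [set U : {set 'I_n} | (U \subset B) & (#|U| == 1%N)])).
  rewrite (eq_bigr (fun=> x)) => [|U].
    by rewrite sumr_const cards_draws bin1 mulr_natl.
  by rewrite inE => /andP[_ /eqP ->]; rewrite expr1.
move=> U; rewrite inE -andbA; congr (_ && _).
by case: #|U| => [|[|]].
Qed.

(** A compatible [f'] is determined by the sets of points removed from and added to each colour, of
    size at most 1. Dropping all other constraints factorises the sum: for a colour with [m] points
    there are [m + 1] removals, and the additions weigh at most [1 + (n - m) / (n - m)]. *)
Lemma sum_compat_weight f :
  \sum_(f' | compat f f') \prod_c new_weight f c (fcol f' c :\: fcol f c) <=
  \prod_(c < d) (2 * (#|fcol f c| + 1))%:R.
Proof.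
pose P c (UV : {set 'I_n} * {set 'I_n}) : bool :=
  [&& UV.1 \subset fcol f c, #|UV.1| <= 1, UV.2 \subset ~: fcol f c & #|UV.2| <= 1]%N.
pose h f' : {ffun 'I_d -> {set 'I_n} * {set 'I_n}} :=
  [ffun c => (fcol f c :\: fcol f' c, fcol f' c :\: fcol f c)].
have hinj : injective h.
  move=> f1 f2 e; have colE c : fcol f1 c = fcol f2 c.
    have := congr1 (fun g : {ffun _ -> _} => g c) e; rewrite !ffunE => -[e1 e2].
    have rec f' : fcol f' c = (fcol f c :\: (fcol f c :\: fcol f' c)) :|:
        (fcol f' c :\: fcol f c).
      by apply/setP => i; rewrite !inE; case: (f i == _); case: (f' i == _).
    by rewrite rec e1 e2 -rec.
  apply/ffunP => i; case f1i: (f1 i) => [c|].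
    by have := colE c => /setP/(_ i); rewrite !inE f1i eqxx => /esym/eqP ->.
  case f2i: (f2 i) => [c|//].
  by have := colE c => /setP/(_ i); rewrite !inE f1i f2i eqxx.
have w0 c V : 0 <= new_weight f c V by rewrite exprn_ge0 // invr_ge0 ler0n.
pose H (g : {ffun 'I_d -> {set 'I_n} * {set 'I_n}}) : rat :=
  \prod_c (if P c (g c) then new_weight f c (g c).2 else 0).
have H0 g : 0 <= H g by apply: prodr_ge0 => c _; case: ifP.
apply: (@le_trans _ _ (\sum_g H g)).
  apply: (@le_trans _ _ (\sum_(g in h @: [set f' | compat f f']) H g)).
    rewrite big_imset /=; last by move=> ? ? _ _; exact: hinj.
    rewrite (eq_bigl (fun f' => f' \in [set f' | compat f f'])); last first.
      by move=> f'; rewrite inE.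
    apply: ler_sum => f'; rewrite inE => /forallP cff'.
    rewrite /H; rewrite le_eqVlt; apply/orP; left; apply/eqP; apply: eq_bigr => c _; rewrite ffunE /P /= ifT //.
    have /andP[-> ->] := cff' c; rewrite finset.subsetDl andbT /=.
    by apply/fintype.subsetP => i; rewrite !inE => /andP[].
  by rewrite [leRHS](bigID (mem (h @: [set f' | compat f f']))) /= lerDl sumr_ge0.
rewrite /H -(bigA_distr_bigA (fun c UV => if P c UV then new_weight f c UV.2 else 0)) /=.
apply: ler_prod => c _; apply/andP; split.
  by apply: sumr_ge0 => UV _; case: ifP.
rewrite -big_mkcond /= (eq_bigl (fun UV : {set 'I_n} * {set 'I_n} =>
  ((UV.1 \subset fcol f c) && (#|UV.1| <= 1)%N) &&
  ((UV.2 \subset ~: fcol f c) && (#|UV.2| <= 1)%N))); last by move=> UV; rewrite /P andbA.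
rewrite -(pair_big (fun U : {set 'I_n} => (U \subset fcol f c) && (#|U| <= 1)%N)
  (fun V : {set 'I_n} => (V \subset ~: fcol f c) && (#|V| <= 1)%N)
  (fun U V => new_weight f c V)) /=.
rewrite /new_weight sum_small_subsets.
have -> : #|~: fcol f c| = (n - #|fcol f c|)%N by rewrite cardsCs finset.setCK card_ord.
have e : \sum_(U : {set 'I_n} | (U \subset fcol f c) && (#|U| <= 1)%N) 1 =
    1 + #|fcol f c|%:R :> rat.
  have := sum_small_subsets (fcol f c) 1; rewrite mulr1 => <-.
  by apply: eq_bigr => U _; rewrite expr1n.
rewrite -[X in \sum_(_ | _) X]mul1r -mulr_suml e mulrC [_ + #|_|%:R]addrC natrM natrD.
rewrite ler_wpM2r ?addr_ge0 ?ler0n // -[leRHS]/(1 + 1) lerD2l.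
by have [->|m0] := posnP (n - #|fcol f c|); rewrite ?mul0r // divff // pnatr_eq0 -lt0n.
Qed.

Lemma fcol_le f c : (#|fcol f c| <= #|fsupp f|)%N.
Proof.
apply: subset_leq_card; apply/fintype.subsetP => i; rewrite !inE.
by case: (f i).
Qed.

(** [d ^ d] comes from [ninj2_le], [(2 (k+1)) ^ d] from [sum_compat_weight] as each colour has at
    most [k] points, and [d ^ k] from [sum_ninj]. *)
Definition moment_const k : nat := (d ^ d * (2 * k.+1) ^ d * d ^ k)%N.

Lemma sum_revchar_sqr k :
  \sum_(q : Q) ((revchar (amx q))`_k) ^+ 2 <= (moment_const k * #|Q|)%:R.
Proof.
have -> : \sum_(q : Q) ((revchar (amx q))`_k) ^+ 2 =
    \sum_(f : Fun | #|fsupp f| == k) \sum_(f' : Fun | #|fsupp f'| == k)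
      \sum_q fdet q f * fdet q f'.
  under [RHS]eq_bigr do rewrite exchange_big /=.
  rewrite [RHS]exchange_big /=; apply: eq_bigr => q _.
  rewrite revchar_coefE exprMn sqrr_sign mul1r.
  by rewrite expr2 mulr_suml; apply: eq_bigr => f _; rewrite mulr_sumr.
rewrite -(ler_int rat) rmorph_sum /=.
apply: (@le_trans _ _ (\sum_(f : Fun | #|fsupp f| == k)
   (d ^ d * ninj f)%:R * ((2 * k.+1) ^ d)%:R)); last first.
  rewrite -mulr_suml -natr_sum -natrM rmorph_nat ler_nat -big_distrr /=.
  rewrite /moment_const.
  by rewrite mulnAC -[leqRHS]mulnA leq_mul2l sum_ninj orbT.
apply: ler_sum => f /eqP fk; rewrite rmorph_sum /=.
apply: (@le_trans _ _ ((d ^ d * ninj f)%:R *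
  \sum_(f' | compat f f') \prod_c new_weight f c (fcol f' c :\: fcol f c))).
  rewrite mulr_sumr [leRHS]big_mkcond [leLHS]big_mkcond; apply: ler_sum => f' _.
  have nn : 0 <= (if compat f f' then (d ^ d * ninj f)%:R *
      \prod_c new_weight f c (fcol f' c :\: fcol f c) else 0) :> rat.
    case: ifP => // _; rewrite mulr_ge0 ?ler0n // prodr_ge0 // => c _.
    by rewrite exprn_ge0 // invr_ge0 ler0n.
  case: ifP => // _; have := sum_fdet_le f f'.
  case: ifP nn => [cff' _ h|_ nn h].
    rewrite (le_trans _ (ninj2_le cff')) //.
    rewrite -[leRHS](rmorph_nat (intr : int -> rat)) ler_int.
    exact: le_trans (ler_norm _) h.
  by rewrite lerz0; apply: le_trans (ler_norm _) h.
rewrite ler_wpM2l ?ler0n // (le_trans (sum_compat_weight f)) //.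
rewrite natrX -[d in _ ^+ d]card_ord -prodr_const.
apply: ler_prod => c _; rewrite ler0n ler_nat leq_mul2l /= addn1 ltnS -fk.
exact: fcol_le.
Qed.

End SecondMomentBound.

(** * Power series on the unit disc *)

Local Open Scope classical_set_scope.
Local Open Scope complex_scope.
Import Normc.
Local Notation Re := complex.Re.
Local Notation Im := complex.Im.

Section ComplexBasics.
Variable R : realType.
Implicit Types (z : R[i]) (u : nat -> R[i]).

Lemma normCE z : `|z| = (normc z)%:C. Proof. by []. Qed.

Lemma normc_ge0 z : 0 <= normc z.
Proof. by rewrite -ler0c -normCE normr_ge0. Qed.

Lemma unit_discE z : unit_disc z <-> normc z < 1.
Proof. by rewrite /unit_disc /= normCE -(ltcR (normc z) 1). Qed.

Lemma Re_le_normc z : `|Re z| <= normc z.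
Proof. by rewrite -lecR -normCE normc_ge_Re. Qed.

Lemma Im_le_normc z : `|Im z| <= normc z.
Proof.
case: z => a b /=; rewrite -sqrtr_sqr; apply: ler_wsqrtr.
by rewrite lerDr sqr_ge0.
Qed.

Lemma normc_real (x : R) : normc x%:C = `|x|.
Proof. by rewrite /= expr0n addr0 sqrtr_sqr. Qed.

Lemma normc_le z : normc z <= `|Re z| + `|Im z|.
Proof.
case: z => a b; have -> : a +i* b = a%:C + (0 +i* b).
  by apply/eqP; rewrite eq_complex /= addr0 add0r !eqxx.
rewrite (le_trans (le_normcD _ _)) // normc_real /= add0r addr0 lerD2l.
by rewrite expr0n add0r sqrtr_sqr.
Qed.

Lemma normcX z k : normc (z ^+ k) = normc z ^+ k.
Proof. by elim: k => [|k IH]; rewrite ?expr0 ?normc1 // !exprS normcM IH. Qed.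

Lemma ReD z z' : Re (z + z') = Re z + Re z'. Proof. by case: z; case: z'. Qed.
Lemma ImD z z' : Im (z + z') = Im z + Im z'. Proof. by case: z; case: z'. Qed.
Lemma ReN z : Re (- z) = - Re z. Proof. by case: z. Qed.
Lemma ImN z : Im (- z) = - Im z. Proof. by case: z. Qed.
Lemma ReM z z' : Re (z * z') = Re z * Re z' - Im z * Im z'.
Proof. by case: z; case: z'. Qed.
Lemma ImM z z' : Im (z * z') = Re z * Im z' + Im z * Re z'.
Proof. by case: z; case: z'. Qed.
Lemma ReZ (x : R) z : Re (x%:C * z) = x * Re z.
Proof. by case: z => a b /=; rewrite mul0r subr0. Qed.
Lemma ImZ (x : R) z : Im (x%:C * z) = x * Im z.
Proof. by case: z => a b /=; rewrite mul0r addr0. Qed.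
Lemma Re_sum I (r : seq I) (F : I -> R[i]) : Re (\sum_(i <- r) F i) = \sum_(i <- r) Re (F i).
Proof. by elim: r => [|x r IH]; rewrite ?big_nil // !big_cons ReD IH. Qed.
Lemma Im_sum I (r : seq I) (F : I -> R[i]) : Im (\sum_(i <- r) F i) = \sum_(i <- r) Im (F i).
Proof. by elim: r => [|x r IH]; rewrite ?big_nil // !big_cons ImD IH. Qed.

Lemma complex_eta z : z = Re z +i* Im z. Proof. by case: z. Qed.

Lemma complex_ext z z' : Re z = Re z' -> Im z = Im z' -> z = z'.
Proof. by case: z => a b; case: z' => a' b' /= -> ->. Qed.

Lemma realC_pow (x : R) k : (x ^+ k)%:C = x%:C ^+ k.
Proof. exact: rmorphXn. Qed.

(* Convergence in [R[i]], whose norm takes values in [R[i]] itself, is reduced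
   to convergence of the real and imaginary parts. *)
Lemma gt0_complex (e : R[i]) : 0 < e -> exists2 e' : R, 0 < e' & e = e'%:C.
Proof.
case: e => a b; rewrite ltcE /= => /andP[/eqP e0 a0].
by exists a => //; rewrite e0.
Qed.

Lemma cvg_complexP (T : Type) (F : set_system T) (FF : Filter F) (u : T -> R[i]) (l : R[i]) :
  (Re (u x) @[x --> F] --> Re l) -> (Im (u x) @[x --> F] --> Im l) -> u @ F --> l.
Proof.
move=> ReP ImP; apply/cvgrPdist_lt => e /gt0_complex[e' e'0 ->].
have e20 : 0 < e' / 2 by rewrite divr_gt0.
move/cvgrPdist_lt/(_ _ e20): ReP => ReP; move/cvgrPdist_lt/(_ _ e20): ImP => ImP.
apply: filterS2 ReP ImP => x h1 h2; rewrite normCE ltcR.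
rewrite (le_lt_trans (normc_le _)) // ReD ImD ReN ImN.
by rewrite [e']splitr ltrD.
Qed.

Lemma cvg_Re (T : Type) (F : set_system T) (FF : Filter F) (u : T -> R[i]) (l : R[i]) :
  u @ F --> l -> Re (u x) @[x --> F] --> Re l.
Proof.
move=> /cvgrPdist_lt cu; apply/cvgrPdist_lt => e e0.
have eC : 0 < e%:C :> R[i] by rewrite ltcR.
apply: filterS (cu _ eC) => x; rewrite normCE ltcR; apply: le_lt_trans.
by rewrite -ReN -ReD Re_le_normc.
Qed.

Lemma cvg_Im (T : Type) (F : set_system T) (FF : Filter F) (u : T -> R[i]) (l : R[i]) :
  u @ F --> l -> Im (u x) @[x --> F] --> Im l.
Proof.
move=> /cvgrPdist_lt cu; apply/cvgrPdist_lt => e e0.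
have eC : 0 < e%:C :> R[i] by rewrite ltcR.
apply: filterS (cu _ eC) => x; rewrite normCE ltcR; apply: le_lt_trans.
by rewrite -ImN -ImD Im_le_normc.
Qed.

End ComplexBasics.

Section Tame.
Variable R : realType.
Implicit Types (a b : nat -> R).

(* Coefficients of power series which converge on the open unit disc. *)
Definition tame a := forall r : R, 0 <= r < 1 -> exists M : R, forall k, `|a k| * r ^+ k <= M.

Lemma tame_le a b : (forall k, `|a k| <= `|b k|) -> tame b -> tame a.
Proof.
move=> ab tb r r01; have [M MP] := tb r r01; exists M => k.
by rewrite (le_trans _ (MP k)) // ler_wpM2r // exprn_ge0; case/andP: r01.
Qed.

Lemma tameD a b : tame a -> tame b -> tame (fun k => a k + b k).
Proof.
move=> ta tb r r01; have [M MP] := ta r r01; have [N NP] := tb r r01.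
exists (M + N) => k; rewrite (le_trans _ (lerD (MP k) (NP k))) // -mulrDl.
by rewrite ler_wpM2r ?ler_normD // exprn_ge0; case/andP: r01.
Qed.

Lemma tameN a : tame a -> tame (fun k => - a k).
Proof. by apply: tame_le => k; rewrite normrN. Qed.

Lemma tameZ (x : R) a : tame a -> tame (fun k => x * a k).
Proof.
move=> ta r r01; have [M MP] := ta r r01; exists (`|x| * M) => k.
by rewrite normrM -mulrA ler_wpM2l.
Qed.

Lemma between_radius (r : R) : 0 <= r < 1 -> exists s : R, [/\ r < s, 0 < s & s < 1].
Proof. by move=> /andP[r0 r1]; exists ((r + 1) / 2); split; lra. Qed.

Lemma tame_shift a : tame a -> tame (fun k => a k.+1).
Proof.
move=> ta r r01; have [s [rs s0 s1]] := between_radius r01.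
have [M MP] := ta s (introT andP (conj (ltW s0) s1)); exists (M / s) => k.
rewrite ler_pdivlMr // (le_trans _ (MP k.+1)) // exprSr mulrA ler_wpM2r ?(ltW s0) //.
by rewrite ler_wpM2l // lerXn2r ?nnegrE ?(ltW rs) ?(ltW s0) //; case/andP: r01.
Qed.

(** Comparison with the geometric series of ratio [r / s], for a radius [s] strictly between [r] and
    1. *)
Lemma summable_series a (r : R) : tame a -> 0 <= r < 1 ->
  cvgn (series (fun k => `|a k| * r ^+ k)).
Proof.
move=> ta r01; have [s [rs s0 s1]] := between_radius r01.
have [M MP] := ta s (introT andP (conj (ltW s0) s1)).
have rs1 : `|r / s| < 1.
  by rewrite ger0_norm ?divr_ge0 ?(ltW s0) ?ltr_pdivrMr ?mul1r //; case/andP: r01.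
apply: (@series_le_cvg _ _ (geometric M (r / s))).
- by move=> k; rewrite mulr_ge0 // exprn_ge0; case/andP: r01.
- move=> k; rewrite /= mulr_ge0 // ?exprn_ge0 ?divr_ge0 ?(ltW s0) //; last by case/andP: r01.
  by rewrite (le_trans _ (MP 0%N)) // mulr_ge0 // exprn_ge0 // ltW.
- move=> k; rewrite /= expr_div_n mulrA ler_pdivlMr ?exprn_gt0 // mulrAC.
  by rewrite ler_wpM2r // exprn_ge0 //; case/andP: r01.
- exact: is_cvg_geometric_series.
Qed.

End Tame.

(** * Sums of power series with real coefficients at complex points *)

Section PowerSeries.
Variable R : realType.
Implicit Types (a b : nat -> R) (z : R[i]).

Definition abs_sum a (r : R) : R := limn (series (fun k => `|a k| * r ^+ k)).

Definition psum a z : R[i] :=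
  limn (series (fun k => a k * Re (z ^+ k))) +i* limn (series (fun k => a k * Im (z ^+ k))).

(** Meant for [f] equal to [Re] or [Im]: domination by the norm is what the comparison with
    [abs_sum] uses. *)
Lemma cvg_part (f : R[i] -> R) a z : (forall z', `|f z'| <= normc z') ->
  tame a -> normc z < 1 ->
  cvgn [normed series (fun k => a k * f (z ^+ k))] /\
  `|limn (series (fun k => a k * f (z ^+ k)))| <= abs_sum a (normc z).
Proof.
move=> fn ta z1; have z01 : 0 <= normc z < 1 by rewrite normc_ge0.
have cs := summable_series ta z01.
have le_k k : `|a k * f (z ^+ k)| <= `|a k| * normc z ^+ k.
  by rewrite normrM ler_wpM2l // -normcX.
have nc : cvgn [normed series (fun k => a k * f (z ^+ k))].
  apply: (@series_le_cvg _ _ (fun k => `|a k| * normc z ^+ k)) => //.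
    by move=> k /=; rewrite normr_ge0.
  by move=> k /=; rewrite mulr_ge0 // exprn_ge0 // normc_ge0.
split=> //; rewrite (le_trans (lim_series_norm nc)) //.
exact: lim_series_le.
Qed.

Lemma cvg_psum_Re a z : tame a -> normc z < 1 ->
  cvgn (series (fun k => a k * Re (z ^+ k))).
Proof. by move=> ta z1; apply: normed_cvg; case: (cvg_part (@Re_le_normc R) ta z1). Qed.

Lemma cvg_psum_Im a z : tame a -> normc z < 1 ->
  cvgn (series (fun k => a k * Im (z ^+ k))).
Proof. by move=> ta z1; apply: normed_cvg; case: (cvg_part (@Im_le_normc R) ta z1). Qed.

Lemma Re_partial a z n :
  Re (\sum_(0 <= k < n) (a k)%:C * z ^+ k) = series (fun k => a k * Re (z ^+ k)) n.
Proof. by rewrite Re_sum; apply: eq_bigr => k _; rewrite ReZ. Qed.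

Lemma Im_partial a z n :
  Im (\sum_(0 <= k < n) (a k)%:C * z ^+ k) = series (fun k => a k * Im (z ^+ k)) n.
Proof. by rewrite Im_sum; apply: eq_bigr => k _; rewrite ImZ. Qed.

Lemma cvg_psum a z : tame a -> normc z < 1 ->
  (\sum_(0 <= k < n) (a k)%:C * z ^+ k) @[n --> \oo] --> psum a z.
Proof.
move=> ta z1; apply: cvg_complexP.
  rewrite (_ : (fun x => _) = series (fun k => a k * Re (z ^+ k))).
    exact: cvg_psum_Re.
  by apply/funext => n; rewrite Re_partial.
rewrite (_ : (fun x => _) = series (fun k => a k * Im (z ^+ k))).
  exact: cvg_psum_Im.
by apply/funext => n; rewrite Im_partial.
Qed.

Lemma abs_sum_ge0 a r : tame a -> 0 <= r < 1 -> 0 <= abs_sum a r.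
Proof.
move=> ta r01; apply: limr_ge; first exact: summable_series.
apply: nearW => n; apply: sumr_ge0 => k _; rewrite mulr_ge0 // exprn_ge0 //.
by case/andP: r01.
Qed.

Lemma le_abs_sum a b r s : tame a -> tame b -> 0 <= r -> r <= s -> s < 1 ->
  (forall k, `|a k| <= `|b k|) -> abs_sum a r <= abs_sum b s.
Proof.
move=> ta tb r0 rs s1 ab; apply: lim_series_le.
- by apply: summable_series; rewrite // r0 (le_lt_trans rs).
- by apply: summable_series; rewrite // s1 (le_trans r0).
- move=> k; apply: ler_pM => //; first by rewrite exprn_ge0.
  by rewrite lerXn2r ?nnegrE // (le_trans r0).
Qed.

Lemma normc_psum_le a z r : tame a -> normc z <= r -> r < 1 ->
  normc (psum a z) <= 2 * abs_sum a r.
Proof.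
move=> ta zr r1; have z1 : normc z < 1 by exact: le_lt_trans r1.
rewrite (le_trans (normc_le _)) //= (@le_trans _ _ (2 * abs_sum a (normc z))) //.
  rewrite mulr2n mulrDl mul1r lerD //.
    by have [] := cvg_part (@Re_le_normc R) ta z1.
  by have [] := cvg_part (@Im_le_normc R) ta z1.
by rewrite ler_wpM2l // le_abs_sum // normc_ge0.
Qed.

Lemma psumD a b z : tame a -> tame b -> normc z < 1 ->
  psum (fun k => a k + b k) z = psum a z + psum b z.
Proof.
move=> ta tb z1; apply: complex_ext.
  rewrite ReD /= -lim_seriesD; [|exact: cvg_psum_Re..].
  by congr (limn (series _)); apply/funext => k; rewrite mulrDl.
rewrite ImD /= -lim_seriesD; [|exact: cvg_psum_Im..].
by congr (limn (series _)); apply/funext => k; rewrite mulrDl.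
Qed.

Lemma psumN a z : tame a -> normc z < 1 -> psum (fun k => - a k) z = - psum a z.
Proof.
move=> ta z1; apply: complex_ext.
  rewrite ReN /= -lim_seriesN; last exact: cvg_psum_Re.
  by congr (limn (series _)); apply/funext => k; rewrite mulNr.
rewrite ImN /= -lim_seriesN; last exact: cvg_psum_Im.
by congr (limn (series _)); apply/funext => k; rewrite mulNr.
Qed.

Lemma psumB a b z : tame a -> tame b -> normc z < 1 ->
  psum (fun k => a k - b k) z = psum a z - psum b z.
Proof. by move=> ta tb z1; rewrite psumD ?psumN //; exact: tameN. Qed.

Lemma psumZ (x : R) a z : tame a -> normc z < 1 ->
  psum (fun k => x * a k) z = x%:C * psum a z.
Proof.
move=> ta z1.
have limZ (f : nat -> R) : cvgn (series (fun k => a k * f k)) ->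
    limn (series (fun k => x * a k * f k)) = x * limn (series (fun k => a k * f k)).
  move=> cf; rewrite -[RHS]/(x *: _) -lim_seriesZ //.
  by congr (limn (series _)); apply/funext => k; rewrite -mulrA.
apply: complex_ext; rewrite ?ReZ ?ImZ /= limZ //; first exact: cvg_psum_Re.
exact: cvg_psum_Im.
Qed.

Lemma psum_finite a n z : (forall k, (n <= k)%N -> a k = 0) ->
  psum a z = \sum_(k < n) (a k)%:C * z ^+ k.
Proof.
move=> an; have lim_fin (f : nat -> R) : limn (series (fun k => a k * f k)) =
    \sum_(k < n) a k * f k.
  apply: lim_near_cst => //; exists n => // m /= nm.
  rewrite /series /= (big_cat_nat (n := n)) //= big_mkord [X in _ + X]big_nat_cond.
  by rewrite [X in _ + X]big1 ?addr0 // => k /andP[/andP[nk _] _]; rewrite an ?mul0r.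
apply: complex_ext; rewrite /= lim_fin ?Re_sum ?Im_sum; apply: eq_bigr => k _.
  by rewrite ReZ.
by rewrite ImZ.
Qed.

Lemma psumX a z : tame a -> normc z < 1 ->
  psum (fun k => if k is k'.+1 then a k' else 0) z = z * psum a z.
Proof.
move=> ta z1.
have tb : tame (fun k => if k is k'.+1 then a k' else 0).
  move=> r r01; have [M MP] := ta r r01; exists M => -[|k] /=.
    by rewrite normr0 mul0r (le_trans _ (MP 0%N)) // mulr_ge0 // exprn_ge0 //; case/andP: r01.
  have [r0 r1] := andP r01.
  by rewrite exprS mulrCA (le_trans _ (MP k)) // ler_piMl ?mulr_ge0 ?exprn_ge0 // ltW.
have := cvg_psum tb z1; rewrite -cvg_shiftS.
rewrite (_ : (fun n => _) = (fun n => z * \sum_(0 <= k < n) (a k)%:C * z ^+ k)).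
  move=> c1; apply: (cvg_unique _ c1); first exact: norm_hausdorff.
  by apply: cvgMr; exact: cvg_psum.
apply/funext => n; rewrite big_nat_recl //= mul0r add0r big_distrr /=.
by apply: eq_bigr => k _; rewrite exprS mulrCA.
Qed.

Definition conv a b k : R := \sum_(i < k.+1) a i * b (k - i)%N.

Lemma big_conv (S : comPzRingType) (x y : nat -> S) n :
  \sum_(k < n) \sum_(i < k.+1) x i * y (k - i)%N =
  \sum_(i < n) \sum_(j < n | (i + j < n)%N) x i * y j.
Proof.
transitivity (\sum_(k < n) \sum_(i < n | (i <= k)%N) x i * y (k - i)%N).
  apply: eq_bigr => k _; rewrite (big_ord_widen n (fun i => x i * y (k - i)%N)) //.
rewrite (exchange_big_dep predT) //=; apply: eq_bigr => i _.
rewrite -(big_mkord (fun k => (i <= k)%N) (fun k => x i * y (k - i)%N)).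
rewrite (big_cat_nat (n := i)) //=; last by rewrite ltnW.
rewrite big_nat_cond big1 ?add0r; last by move=> k /andP[/andP[_ h1] h2]; lia.
rewrite big_nat_cond -{1}[val i]add0n big_addn.
rewrite -(big_mkord (fun j => (i + j < n)%N) (fun j => x i * y j)).
rewrite [RHS](big_cat_nat (n := (n - i)%N)) //=; last exact: leq_subr.
rewrite [X in _ = _ + X]big_nat_cond [X in _ = _ + X]big1 ?addr0; last first.
  by move=> k /andP[/andP[h1 _] h2]; lia.
rewrite big_nat_cond [RHS]big_nat_cond; apply: eq_big => k.
  by apply/idP/idP; lia.
by rewrite addnK.
Qed.

Lemma conv_error (S : comPzRingType) (x y : nat -> S) n :
  (\sum_(i < n) x i) * (\sum_(j < n) y j) -
  \sum_(k < n) \sum_(i < k.+1) x i * y (k - i)%N =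
  \sum_(i < n) \sum_(j < n | ~~ (i + j < n)%N) x i * y j.
Proof.
rewrite big_conv mulr_suml -sumrB; apply: eq_bigr => i _.
rewrite mulr_sumr (bigID (fun j : 'I_n => (i + j < n)%N)) /=.
by rewrite addrAC subrr add0r.
Qed.

Lemma tame_conv a b : tame a -> tame b -> tame (conv a b).
Proof.
move=> ta tb r r01; have [r0 r1] := andP r01.
exists (abs_sum a r * abs_sum b r) => k.
have le_lim c n : tame c -> \sum_(i < n) `|c i| * r ^+ i <= abs_sum c r.
  move=> tc; rewrite -(big_mkord predT (fun i => `|c i| * r ^+ i)).
  apply: (nondecreasing_cvgn_le (u_ := series (fun i => `|c i| * r ^+ i))).
    by apply: nondecreasing_series => i _ _; rewrite mulr_ge0 // exprn_ge0.
  exact: summable_series.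
apply: (@le_trans _ _ (\sum_(i < k.+1) (`|a i| * r ^+ i) * (`|b (k - i)%N| * r ^+ (k - i)))).
  rewrite (le_trans (ler_wpM2r _ (ler_norm_sum _ _ _))) ?exprn_ge0 // mulr_suml.
  apply: ler_sum => i _; rewrite normrM mulrACA -exprD subnKC // -ltnS.
  by [].
apply: (@le_trans _ _ ((\sum_(i < k.+1) `|a i| * r ^+ i) * (\sum_(i < k.+1) `|b i| * r ^+ i))).
  rewrite mulr_suml; apply: ler_sum => i _.
  rewrite ler_wpM2l ?mulr_ge0 ?exprn_ge0 //.
  have ki : (k - i < k.+1)%N by rewrite ltnS leq_subr.
  rewrite (bigD1 (Ordinal ki)) //= lerDl sumr_ge0 // => j _.
  by rewrite mulr_ge0 // exprn_ge0.
apply: ler_pM; rewrite ?le_lim // sumr_ge0 // => i _; by rewrite mulr_ge0 ?exprn_ge0.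
Qed.

(* The error made by truncating a Cauchy product is dominated by the same error
   for the absolute values, where it vanishes by monotonicity. *)
Lemma psumM a b z : tame a -> tame b -> normc z < 1 ->
  psum (conv a b) z = psum a z * psum b z.
Proof.
move=> ta tb z1; set r := normc z; have r0 : 0 <= r by exact: normc_ge0.
have r01 : 0 <= r < 1 by rewrite r0.
pose x k := `|a k| * r ^+ k; pose y k := `|b k| * r ^+ k.
have x0 k : 0 <= x k by rewrite mulr_ge0 // exprn_ge0.
have y0 k : 0 <= y k by rewrite mulr_ge0 // exprn_ge0.
pose cxy k := \sum_(i < k.+1) x i * y (k - i)%N.
have cxy0 k : 0 <= cxy k by apply: sumr_ge0 => i _; rewrite mulr_ge0.
have cx : cvgn (series x) by exact: summable_series.
have cy : cvgn (series y) by exact: summable_series.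
have serE (u : nat -> R) n : series u n = \sum_(k < n) u k by rewrite /series /= big_mkord.
have cxy_nd : nondecreasing_seq (series cxy) by apply: nondecreasing_series => k _ _.
have prod_ge n : series cxy n <= series x n * series y n.
  rewrite !serE -subr_ge0 conv_error; do 2!(apply: sumr_ge0 => ? _).
  by rewrite mulr_ge0.
(* The square of side [n] lies in the triangle of side [2 n]; with [prod_ge] this squeezes the limit
   of the Cauchy product. *)
have prod_le n : series x n * series y n <= series cxy n.*2.
  rewrite !serE big_conv mulr_suml.
  rewrite (big_ord_widen n.*2 (fun i => x i * \sum_(j < n) y j)); last by lia.
  rewrite [leLHS]big_mkcond; apply: ler_sum => i _; case: ifP => ltin; last first.
    by apply: sumr_ge0 => j _; rewrite mulr_ge0.
  rewrite mulr_sumr (big_ord_widen n.*2 (fun j => x i * y j)); last by lia.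
  rewrite [leLHS]big_mkcond [leRHS]big_mkcond; apply: ler_sum => j _.
  case: ifP => ltjn; last by case: ifP => // _; rewrite mulr_ge0.
  by rewrite ifT //; lia.
have cprod : (fun n => series x n * series y n) @ \oo --> limn (series x) * limn (series y).
  exact: cvgM.
have ccxy : cvgn (series cxy).
  apply: nondecreasing_is_cvgn => //; exists (limn (series x) * limn (series y)).
  move=> _ [n _ <-]; rewrite (le_trans (prod_ge n)) //.
  apply: ler_pM; rewrite ?serE ?sumr_ge0 // -serE; apply: nondecreasing_cvgn_le => //;
    by apply: nondecreasing_series.
have cdbl : (fun n => series cxy n.*2) @ \oo --> limn (series cxy).
  apply: cvg_comp ccxy; apply/cvgnyPge => A; near=> n.
  by rewrite (@leq_trans n) //; [near: n; exact: nbhs_infty_ge | rewrite -addnn leq_addr].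
have limE : limn (series cxy) = limn (series x) * limn (series y).
  apply: le_anti; apply/andP; split.
    by apply: (ler_cvg_to ccxy cprod); exact: nearW.
  by apply: (ler_cvg_to cprod cdbl); exact: nearW.
have err0 : (fun n => series x n * series y n - series cxy n) @ \oo --> (0 : R).
  by rewrite -(subrr (limn (series cxy))) {1}limE; exact: cvgB.
pose u n := (\sum_(0 <= k < n) (a k)%:C * z ^+ k) * (\sum_(0 <= k < n) (b k)%:C * z ^+ k).
pose v n := \sum_(0 <= k < n) (conv a b k)%:C * z ^+ k.
have cu : u @ \oo --> psum a z * psum b z by apply: cvgM; exact: cvg_psum.
have cv : v @ \oo --> psum (conv a b) z by apply: cvg_psum => //; exact: tame_conv.
have uv n : normc (u n - v n) <= series x n * series y n - series cxy n.
  pose X k := (a k)%:C * z ^+ k; pose Y k := (b k)%:C * z ^+ k.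
  have -> : v n = \sum_(k < n) \sum_(i < k.+1) X i * Y (k - i)%N.
    rewrite /v big_mkord; apply: eq_bigr => k _.
    rewrite rmorph_sum mulr_suml; apply: eq_bigr => i _.
    have ik : (i <= k)%N by rewrite -ltnS.
    by rewrite rmorphM /= /X /Y mulrACA -exprD subnKC.
  rewrite /u !big_mkord conv_error !serE conv_error.
  rewrite -lecR -normCE rmorph_sum /= (le_trans (ler_norm_sum _ _ _)) //.
  apply: ler_sum => i _; rewrite rmorph_sum /= (le_trans (ler_norm_sum _ _ _)) //.
  apply: ler_sum => j _; rewrite normCE lecR /X /Y !normcM !normc_real !normcX.
  by [].
have uv0 : (fun n => u n - v n) @ \oo --> (0 : R[i]).
  apply/cvgrPdist_lt => e /gt0_complex[e' e'0 ->].
  move/cvgrPdist_lt/(_ _ e'0): err0; apply: filterS => n.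
  rewrite !sub0r => h; rewrite normrN normCE ltcR (le_lt_trans (uv n)) //.
  by rewrite normrN in h; rewrite (le_lt_trans (ler_norm _)).
have cuv := cvgB cu cv.
have E : 0 = psum a z * psum b z - psum (conv a b) z.
  exact: (cvg_unique (@norm_hausdorff _ _) uv0 (cuv _)).
by apply/esym/eqP; rewrite -subr_eq0 -E.
Unshelve. all: by end_near. Qed.

End PowerSeries.

Section TameMore.
Variable R : realType.
Implicit Types (a b : nat -> R) (z : R[i]).

Lemma bernoulli_ineq (x : R) k : 0 <= x -> k%:R * x <= (1 + x) ^+ k.
Proof.
move=> x0; have [->|k0] := posnP k; first by rewrite mul0r expr0.
suff: 1 + k%:R * x <= (1 + x) ^+ k by apply: le_trans; rewrite lerDr.
elim: k {k0} => [|k IH]; first by rewrite mul0r addr0 expr0.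
rewrite exprS (le_trans _ (ler_wpM2l _ IH)) ?addr_ge0 //.
rewrite -natr1; have : 0 <= k%:R * x * x by rewrite !mulr_ge0.
nra.
Qed.

(** The factor [k] is absorbed by a larger radius: [k x <= (1 + x)^k] with [1 + x = u / s]. *)
Lemma tame_natmul a : tame a -> tame (fun k => k%:R * a k).
Proof.
move=> ta r r01; have [s [rs s0 s1]] := between_radius r01.
have [u [su u0 u1]] := between_radius (introT andP (conj (ltW s0) s1)).
have [M MP] := ta u (introT andP (conj (ltW u0) u1)).
pose x := u / s - 1; have x0 : 0 < x by rewrite subr_gt0 ltr_pdivlMr // mul1r.
exists (M / x) => k; rewrite ler_pdivlMr //.
have r0 : 0 <= r by case/andP: r01.
rewrite normrM ger0_norm ?ler0n //.
apply: (@le_trans _ _ ((k%:R * x) * (`|a k| * s ^+ k))).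
  have -> : k%:R * `|a k| * r ^+ k * x = (k%:R * x) * (`|a k| * r ^+ k) by ring.
  rewrite ler_wpM2l ?mulr_ge0 ?(ltW x0) // ler_wpM2l //.
  by rewrite lerXn2r ?nnegrE ?(ltW s0) // ltW.
have := bernoulli_ineq k (ltW x0); rewrite [in X in _ <= X]/x [1 + _]addrC subrK => h.
rewrite (le_trans (ler_wpM2r _ h)) ?mulr_ge0 ?exprn_ge0 ?(ltW s0) //.
by rewrite expr_div_n mulrCA divfK ?expf_neq0 ?gt_eqF.
Qed.

Lemma tame_div a : tame a -> tame (fun k => a k / k%:R).
Proof.
apply: tame_le => k; rewrite normrM normfV ler_piMr //.
case: k => [|k]; first by rewrite normr0 invr0.
by rewrite ger0_norm // invf_le1 ?ltr0n // ler1n.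
Qed.

Lemma tame_pow (c : R) : `|c| <= 1 -> tame (fun k => c ^+ k).
Proof.
move=> c1 r /andP[r0 r1]; exists 1 => k; rewrite normrX -exprMn exprn_ile1 //.
  by rewrite mulr_ge0.
by rewrite mulr_ile1 // ltW.
Qed.

(** Put [F_k = |expseq a k| r^k]. By the recursion [(k+1) F_(k+1)] is at most [S] times any bound
    for the previous [F], with [S] the absolute sum of [a]. From the index [N >= S] on, a bound for
    the earlier terms persists. *)
Lemma tame_expseq a : tame a -> tame (expseq a).
Proof.
move=> ta r r01; have [r0 r1] := andP r01.
pose F k := `|expseq a k| * r ^+ k.
have F0 k : 0 <= F k by rewrite mulr_ge0 // exprn_ge0.
pose S := abs_sum a r.
have S0 : 0 <= S by exact: abs_sum_ge0.
pose N := (Num.truncn S).+1.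
have SN : S <= N%:R by rewrite ltW // truncnS_gt.
pose C := \sum_(i < N) F i.
exists C => k; rewrite -/(F k); elim/ltn_ind: k => k IH.
have [kN|Nk] := ltnP k N.
  by rewrite /C (bigD1 (Ordinal kN)) //= lerDl sumr_ge0.
case: k Nk IH => // k Nk IH.
have k0 : 0 < k.+1%:R :> R by rewrite ltr0n.
have C0 : 0 <= C by rewrite sumr_ge0.
rewrite -(ler_pM2l k0) (@le_trans _ _ (S * C)) //; last first.
  by rewrite ler_wpM2r // (le_trans SN) // ler_nat.
rewrite /F mulrA -[k.+1%:R in leLHS]ger0_norm ?ler0n // -normrM expseqS.
rewrite (le_trans (ler_wpM2r _ (ler_norm_sum _ _ _))) ?exprn_ge0 //.
apply: (@le_trans _ _ ((\sum_(j < k.+1) `|a j.+1| * r ^+ j.+1) * C)).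
  rewrite !mulr_suml; apply: ler_sum => j _.
  have jk : (j <= k)%N by rewrite -ltnS.
  have rk : r ^+ k.+1 = r ^+ j.+1 * r ^+ (k - j) by rewrite -exprD addSn subnKC.
  rewrite normrM -mulrA rk.
  have -> : `|expseq a (k - j)| * (r ^+ j.+1 * r ^+ (k - j)) = r ^+ j.+1 * F (k - j)%N.
    by rewrite mulrCA.
  by rewrite mulrA ler_wpM2l ?mulr_ge0 ?exprn_ge0 // IH // ltnS leq_subr.
rewrite ler_wpM2r //.
apply: (@le_trans _ _ (\sum_(j < k.+2) `|a j| * r ^+ j)).
  by rewrite [leRHS]big_ord_recl /= lerDr mulr_ge0 // exprn_ge0.
rewrite -(big_mkord predT (fun i => `|a i| * r ^+ i)).
apply: (nondecreasing_cvgn_le (u_ := series (fun i => `|a i| * r ^+ i))).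
  by apply: nondecreasing_series => i _ _; rewrite mulr_ge0 // exprn_ge0.
exact: summable_series.
Qed.

End TameMore.

(** * Complex differentiability inside the disc *)

Section Derivative.
Variable R : realType.
Implicit Types (a b : nat -> R) (z h : R[i]).

(** The remainder for [k.+1] is [(z + h)] times the one for [k] plus [k h^2 z^(k-1)], and
    [k^2 + k <= (k+1)^2]. Carrying [r^2] on the left avoids negative powers. *)
Lemma pow_taylor2 z h (r : R) k : 0 <= r -> normc z <= r -> normc (z + h) <= r ->
  normc ((z + h) ^+ k - z ^+ k - k%:R * h * z ^+ k.-1) * r ^+ 2 <=
  normc h ^+ 2 * k%:R ^+ 2 * r ^+ k.
Proof.
move=> r0 zr zhr; elim: k => [|k IH].
  by rewrite !expr0 subrr !mul0r subr0 normc0 mul0r expr0n /= mulr0 mul0r.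
set E := (z + h) ^+ k - z ^+ k - k%:R * h * z ^+ k.-1 in IH.
have -> : (z + h) ^+ k.+1 - z ^+ k.+1 - k.+1%:R * h * z ^+ k.+1.-1 =
    (z + h) * E + k%:R * h ^+ 2 * z ^+ k.-1.
  rewrite /E /=; case: k {IH E} => [|k] /=; first by rewrite !expr1 !expr0; ring.
  by rewrite -[in LHS]natr1 !exprS; ring.
have h0 : 0 <= normc h by exact: normc_ge0.
rewrite (le_trans (ler_wpM2r _ (le_normcD _ _))) ?exprn_ge0 // mulrDl.
apply: (@le_trans _ _ (r * (normc h ^+ 2 * k%:R ^+ 2 * r ^+ k) +
    k%:R * normc h ^+ 2 * r ^+ k.+1)); last first.
  have -> : r * (normc h ^+ 2 * k%:R ^+ 2 * r ^+ k) + k%:R * normc h ^+ 2 * r ^+ k.+1 =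
      normc h ^+ 2 * (k%:R ^+ 2 + k%:R) * r ^+ k.+1 by rewrite [r ^+ k.+1]exprS; ring.
  rewrite ler_wpM2r ?exprn_ge0 // ler_wpM2l ?exprn_ge0 // -natr1.
  have : 0 <= k%:R :> R by []. nra.
apply: lerD.
  rewrite normcM -[leLHS]mulrA; apply: ler_pM => //.
    exact: normc_ge0.
  by rewrite mulr_ge0 ?normc_ge0 // exprn_ge0.
rewrite !normcM normcX -(rmorph_nat (real_complex R)) normc_real ger0_norm //.
case: k {IH E} => [|k]; first by rewrite !mul0r.
rewrite -!mulrA !ler_wpM2l ?exprn_ge0 // /=.
have -> : r ^+ k.+2 = r ^+ k * r ^+ 2 by rewrite -exprD addn2.
by rewrite ler_wpM2r ?exprn_ge0 // lerXn2r ?nnegrE ?normc_ge0.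
Qed.

Definition dseq a : nat -> R := fun k => k.+1%:R * a k.+1.

Lemma tame_dseq a : tame a -> tame (dseq a).
Proof. by move=> ta; apply: tame_shift (tame_natmul ta). Qed.

Lemma psum_taylor2 a z h (r : R) : tame a -> 0 < r < 1 -> normc z <= r -> normc (z + h) <= r ->
  normc (psum a (z + h) - psum a z - h * psum (dseq a) z) * r ^+ 2 <=
  2 * abs_sum (fun k => k%:R * (k%:R * a k)) r * normc h ^+ 2.
Proof.
move=> ta /andP[r0 r1] zr zhr.
have z1 : normc z < 1 by exact: le_lt_trans r1.
have zh1 : normc (z + h) < 1 by exact: le_lt_trans r1.
set C := abs_sum _ _.
have tk : tame (fun k => k%:R * (k%:R * a k)) by do 2!apply: tame_natmul.
pose t k := (a k)%:C * ((z + h) ^+ k - z ^+ k - k%:R * h * z ^+ k.-1).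
have c : (fun n => \sum_(0 <= k < n.+1) t k) @ \oo -->
    psum a (z + h) - psum a z - h * psum (dseq a) z.
  have -> : (fun n => \sum_(0 <= k < n.+1) t k) = (fun n =>
      \sum_(0 <= k < n.+1) (a k)%:C * (z + h) ^+ k - \sum_(0 <= k < n.+1) (a k)%:C * z ^+ k
      - h * \sum_(0 <= k < n) (dseq a k)%:C * z ^+ k).
    apply/funext => n.
    have -> : h * \sum_(0 <= k < n) (dseq a k)%:C * z ^+ k =
        \sum_(0 <= k < n.+1) (a k)%:C * (k%:R * h * z ^+ k.-1).
      rewrite [RHS]big_nat_recl //= !mul0r mulr0 add0r big_distrr /=.
      apply: eq_bigr => k _; rewrite /dseq rmorphM rmorph_nat; ring.
    by rewrite -!sumrB; apply: eq_bigr => k _; rewrite -!mulrBr.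
  apply: cvgB; first apply: cvgB.
  - have := cvg_psum ta zh1; rewrite -cvg_shiftS; exact.
  - have := cvg_psum ta z1; rewrite -cvg_shiftS; exact.
  - by apply: cvgMr; apply: cvg_psum => //; exact: tame_dseq.
have bound n : normc (\sum_(0 <= k < n.+1) t k) * r ^+ 2 <= C * normc h ^+ 2.
  apply: (@le_trans _ _ ((\sum_(k < n.+1) normc (t k)) * r ^+ 2)).
    rewrite ler_wpM2r ?exprn_ge0 ?(ltW r0) // big_mkord -lecR -normCE rmorph_sum /=.
    exact: ler_norm_sum.
  apply: (@le_trans _ _ ((\sum_(k < n.+1) `|k%:R * (k%:R * a k)| * r ^+ k) * normc h ^+ 2)).
    rewrite !mulr_suml; apply: ler_sum => k _.
    rewrite /t normcM normc_real -[leLHS]mulrA.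
    rewrite (le_trans (ler_wpM2l _ (pow_taylor2 k (ltW r0) zr zhr))) //.
    rewrite !normrM ger0_norm ?ler0n // le_eqVlt; apply/orP; left; apply/eqP; ring.
  rewrite ler_wpM2r ?exprn_ge0 ?normc_ge0 //.
  rewrite -(big_mkord predT (fun k => `|k%:R * (k%:R * a k)| * r ^+ k)).
  apply: (nondecreasing_cvgn_le (u_ := series (fun k => `|k%:R * (k%:R * a k)| * r ^+ k))).
    by apply: nondecreasing_series => i _ _; rewrite mulr_ge0 // exprn_ge0 // ltW.
  by apply: summable_series; rewrite // (ltW r0).
have r20 : 0 < r ^+ 2 by rewrite exprn_gt0.
have lim_le (f : R[i] -> R) (l : R) : (forall z', `|f z'| <= normc z') ->
    (fun n => f (\sum_(0 <= k < n.+1) t k)) @ \oo --> l -> `|l| <= C * normc h ^+ 2 / r ^+ 2.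
  move=> fn cl; have cl' : (fun n => `|f (\sum_(0 <= k < n.+1) t k)|) @ \oo --> `|l|.
    exact: cvg_norm.
  rewrite -(cvg_lim (@Rhausdorff R) cl'); apply: limr_le; first exact: cvgP cl'.
  apply: nearW => n.
  by rewrite (le_trans (fn _)) // ler_pdivlMr.
rewrite -ler_pdivlMr // (le_trans (normc_le _)) //.
rewrite -[2 * C]mulrC mulr2n mulrDr mulr1 !mulrDl.
by apply: lerD; [apply: (lim_le _ _ (@Re_le_normc R)); apply: cvg_Re c |
  apply: (lim_le _ _ (@Im_le_normc R)); apply: cvg_Im c].
Qed.

Lemma derivable_psum a z : tame a -> normc z < 1 -> derivable (psum a) z 1.
Proof.
move=> ta z1; have [r [zr r0 r1]] := between_radius (introT andP (conj (normc_ge0 z) z1)).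
apply/cvg_ex; exists (psum (dseq a) z).
set C := 2 * abs_sum (fun k => k%:R * (k%:R * a k)) r.
have C0 : 0 <= C.
  rewrite mulr_ge0 // abs_sum_ge0 ?r1 ?ltW //.
  by do 2!apply: tame_natmul.
apply/cvgrPdist_lt => e /gt0_complex[e' e'0 ->].
pose del := Num.min (r - normc z) (e' * r ^+ 2 / (C + 1)).
have del0 : 0 < del.
  by rewrite lt_min subr_gt0 zr divr_gt0 ?mulr_gt0 ?exprn_gt0 // ltr_wpDl.
have delC : 0 < del%:C :> R[i] by rewrite ltcR.
near=> h.
have hn0 : h != 0 by near: h; exact: nbhs_dnbhs_neq.
have hdel : normc h < del.
  rewrite -ltcR -normCE; near: h; apply: dnbhs0_lt; exact: delC.
rewrite normCE ltcR.
have hn : 0 < normc h.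
  by rewrite lt_def normc_ge0 andbT; apply: contra_neq hn0; exact: eq0_normc.
have [h1 h2] : normc h < r - normc z /\ normc h < e' * r ^+ 2 / (C + 1).
  by apply/andP; rewrite -lt_min.
have zhr : normc (z + h) <= r.
  by rewrite (le_trans (le_normcD _ _)) // -lerBrDl ltW.
have r01 : 0 < r < 1 by rewrite r0.
have := psum_taylor2 ta r01 (ltW zr) zhr; rewrite -/C => tay.
have -> : psum (dseq a) z - h^-1 *: (psum a (h *: 1 + z) - psum a z) =
    - (h^-1 * (psum a (z + h) - psum a z - h * psum (dseq a) z)).
  rewrite -[h *: 1]/(h * 1) mulr1 [h + z]addrC -[h^-1 *: _]/(h^-1 * _).
  by rewrite [in RHS]mulrBr mulKf // opprB.
rewrite normcN normcM normcV mulrC ltr_pdivrMr //.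
have r20 : 0 < r ^+ 2 by rewrite exprn_gt0.
rewrite -(ltr_pM2r r20) (le_lt_trans tay) //.
move: h2; rewrite ltr_pdivlMr ?ltr_wpDl // => h2.
by nra.
Unshelve. all: by end_near. Qed.

End Derivative.

(** * Exponential of a power series *)

Section ExpSeries.
Variable R : realType.
Implicit Types (a b : nat -> R) (z h : R[i]).

Lemma is_derive_quadratic (f : R -> R) (t D C del : R) : 0 < del ->
  (forall h : R, `|h| <= del -> `|f (t + h) - f t - h * D| <= C * h ^+ 2) ->
  is_derive t (1 : R) f D.
Proof.
move=> del0 fC.
have C0 : 0 <= C.
  have := fC del; rewrite ger0_norm ?(ltW del0) // => /(_ (lexx _)) h.
  by rewrite -(pmulr_lge0 _ (exprn_gt0 2 del0)) (le_trans _ h).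
have cD : h^-1 *: (f (h *: 1 + t) - f t) @[h --> 0^'] --> D.
  apply/cvgrPdist_lt => e e0.
  near=> h.
  have h0 : h != 0 by near: h; exact: nbhs_dnbhs_neq.
  have hn : 0 < `|h| by rewrite normr_gt0.
  have hdel : `|h| < Num.min del (e / (C + 1)).
    by near: h; apply: dnbhs0_lt; rewrite lt_min del0 divr_gt0 // ltr_wpDl.
  move: hdel; rewrite lt_min => /andP[h1 h2].
  have := fC h (ltW h1).
  have -> : D - h^-1 *: (f (h *: 1 + t) - f t) = - (h^-1 * (f (t + h) - f t - h * D)).
    rewrite -[h *: 1]/(h * 1) mulr1 [h + t]addrC -[h^-1 *: _]/(h^-1 * _).
    by rewrite [in RHS]mulrBr mulKf // opprB.
  move=> h3; rewrite normrN normrM normfV [_^-1 * _]mulrC ltr_pdivrMr // (le_lt_trans h3) //.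
  rewrite -[h ^+ 2]real_normK ?num_real // expr2 mulrA ltr_pM2r //.
  move: h2; rewrite ltr_pdivlMr ?ltr_wpDl //; nra.
by apply: DeriveDef; [apply/cvg_ex; exists D | rewrite /derive (cvg_lim (@Rhausdorff R) cD)].
Unshelve. all: by end_near. Qed.

Section Ray.
Variable z : R[i].
Hypothesis z1 : normc z < 1.

Lemma ray_lt1 (t : R) : 0 <= t <= 1 -> normc (t%:C * z) < 1.
Proof.
move=> /andP[t0 t1]; rewrite normcM normc_real ger0_norm //.
by rewrite (le_lt_trans _ z1) // ler_piMl // normc_ge0.
Qed.

(** With [f] equal to [Re] or [Im], the restriction of a power series to a ray becomes a real
    function of a real variable, to which real calculus applies. *)
Lemma is_derive_ray (f : R[i] -> R) a (t : R) :
  (forall z z', f (z - z') = f z - f z') ->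
  (forall (x : R) z, f (x%:C * z) = x * f z) -> (forall z, `|f z| <= normc z) ->
  tame a -> 0 <= t <= 1 ->
  is_derive t (1 : R) (fun t : R => f (psum a (t%:C * z))) (f (z * psum (dseq a) (t%:C * z))).
Proof.
move=> fB fZ fn ta t01; have tz1 := ray_lt1 t01.
have [r [zr r0 r1]] := between_radius (introT andP (conj (normc_ge0 _) tz1)).
have r01 : 0 < r < 1 by rewrite r0.
set C := 2 * abs_sum (fun k => k%:R * (k%:R * a k)) r / r ^+ 2 * normc z ^+ 2.
have del0 : 0 < (r - normc (t%:C * z)) by rewrite subr_gt0.
apply: (@is_derive_quadratic _ _ _ C _ del0) => h hdel.
have hz : normc (t%:C * z + h%:C * z) <= r.
  rewrite (le_trans (le_normcD _ _)) // -lerBrDl normcM normc_real.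
  by rewrite (le_trans _ hdel) // ler_piMr // ltW.
have := psum_taylor2 ta r01 (ltW zr) hz.
rewrite -ler_pdivlMr ?exprn_gt0 // => tay.
have -> : f (psum a ((t + h)%:C * z)) - f (psum a (t%:C * z)) -
    h * f (z * psum (dseq a) (t%:C * z)) =
    f (psum a (t%:C * z + h%:C * z) - psum a (t%:C * z) - h%:C * z * psum (dseq a) (t%:C * z)).
  by rewrite !fB -[h%:C * z * _]mulrA fZ rmorphD /= mulrDl.
rewrite (le_trans (fn _)) // (le_trans tay) // normcM normc_real exprMn real_normK ?num_real //.
by rewrite le_eqVlt; apply/orP; left; apply/eqP; rewrite /C; ring.
Qed.

End Ray.

(** The function is the real part of [exp(- (al + i be)) (f1 + i f2)], and the hypotheses say that
    [f1 + i f2] solves the linear equation of [exp(al + i be)]. *)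
Lemma is_derive_polar (al be f1 f2 : R -> R) (t da db : R) :
  is_derive t (1 : R) al da -> is_derive t (1 : R) be db ->
  is_derive t (1 : R) f1 (da * f1 t - db * f2 t) ->
  is_derive t (1 : R) f2 (da * f2 t + db * f1 t) ->
  is_derive t (1 : R) (fun t => expR (- al t) * (cos (be t) * f1 t + sin (be t) * f2 t)) 0.
Proof.
move=> hal hbe h1 h2.
have he : is_derive t (1 : R) (expR \o (- al)) (expR (- al t) * - da).
  by apply: is_derive1_comp.
have hc : is_derive t (1 : R) (cos \o be) (- sin (be t) * db).
  by apply: is_derive1_comp.
have hs : is_derive t (1 : R) (sin \o be) (cos (be t) * db).
  by apply: is_derive1_comp.
have := is_deriveM he (is_deriveD (is_deriveM hc h1) (is_deriveM hs h2)).
move=> H; apply: (is_derive_eq H).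
transitivity (expR (- al t) *
  (cos (be t) * (da * f1 t - db * f2 t) + f1 t * (- sin (be t) * db) +
   (sin (be t) * (da * f2 t + db * f1 t) + f2 t * (cos (be t) * db))) +
  (cos (be t) * f1 t + sin (be t) * f2 t) * (expR (- al t) * - da)); first by [].
ring.
Qed.

Lemma psum0 a : psum a 0 = (a 0%N)%:C.
Proof.
rewrite (_ : psum a 0 = psum (fun k => if k is 0%N then a 0%N else 0) 0); last first.
  by congr (limn (series _) +i* limn (series _)); apply/funext => -[|k] //;
    rewrite expr0n /= !mulr0.
by rewrite (@psum_finite _ _ 1) ?big_ord1 ?expr0 ?mulr1 // => -[].
Qed.

Lemma dseq_expseq a : dseq (expseq a) = conv (fun j => a j.+1) (expseq a).
Proof. by apply/funext => k; rewrite /dseq expseqS. Qed.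

(** The series of [expseq a] satisfies [F' = A F], where [A] is the derivative of the exponent.
    Along the ray from 0 to [z] the quotient of [F] by the exponential has zero derivative; the mean
    value theorem is applied to its real and imaginary parts. *)
Lemma cexp_psum a z : tame a -> normc z < 1 ->
  cexp (psum (fun j => a j / j%:R) z) = psum (expseq a) z.
Proof.
move=> ta z1; pose b j := a j / j%:R.
have tb : tame b by exact: tame_div.
have tE : tame (expseq a) by exact: tame_expseq.
have ReB (w w' : R[i]) : Re (w - w') = Re w - Re w' by rewrite ReD ReN.
have ImB (w w' : R[i]) : Im (w - w') = Im w - Im w' by rewrite ImD ImN.
pose al t := Re (psum b (t%:C * z)); pose be t := Im (psum b (t%:C * z)).
pose f1 t := Re (psum (expseq a) (t%:C * z)); pose f2 t := Im (psum (expseq a) (t%:C * z)).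
have db : dseq b = (fun j => a j.+1).
  by apply/funext => k; rewrite /dseq /b mulrCA divff ?mulr1 ?pnatr_eq0.
pose D t := z * psum (fun j => a j.+1) (t%:C * z).
have Dal (t : R) : 0 <= t <= 1 -> is_derive t (1 : R) al (Re (D t)).
  by move=> t01; rewrite /D -db; apply: is_derive_ray => //; [exact: ReZ | exact: Re_le_normc].
have Dbe (t : R) : 0 <= t <= 1 -> is_derive t (1 : R) be (Im (D t)).
  by move=> t01; rewrite /D -db; apply: is_derive_ray => //; [exact: ImZ | exact: Im_le_normc].
have dE (t : R) : 0 <= t <= 1 -> z * psum (dseq (expseq a)) (t%:C * z) =
    D t * psum (expseq a) (t%:C * z).
  by move=> t01; rewrite dseq_expseq psumM ?mulrA //; [exact: tame_shift | exact: ray_lt1].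
have Df1 (t : R) : 0 <= t <= 1 -> is_derive t (1 : R) f1 (Re (D t) * f1 t - Im (D t) * f2 t).
  move=> t01; rewrite -ReM -dE //.
  by apply: is_derive_ray => //; [exact: ReZ | exact: Re_le_normc].
have Df2 (t : R) : 0 <= t <= 1 -> is_derive t (1 : R) f2 (Re (D t) * f2 t + Im (D t) * f1 t).
  move=> t01; rewrite -ImM -dE //.
  by apply: is_derive_ray => //; [exact: ImZ | exact: Im_le_normc].
have const (g : R -> R) : (forall t : R, 0 <= t <= 1 -> is_derive t (1 : R) g 0) -> g 1 = g 0.
  move=> Dg; have [||c _] := @MVT R g (fun=> 0) 0 1 ltr01.
  - by move=> t; rewrite in_itv /= => /andP[t0 t1]; apply: Dg; rewrite !ltW.
  - by apply: derivable_within_continuous => t; rewrite in_itv /= => t01; case: (Dg t t01).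
  - by rewrite mul0r => /eqP; rewrite subr_eq0 => /eqP.
have c1 := const _ (fun t t01 => is_derive_polar (Dal t t01) (Dbe t t01) (Df1 t t01) (Df2 t t01)).
(* The imaginary part is the real part for the pair [(f2, - f1)]. *)
have Df1' (t : R) (t01 : 0 <= t <= 1) : is_derive t (1 : R) (- f1) (Re (D t) * (- f1) t - Im (D t) * - f2 t).
  rewrite (_ : _ - _ = - (Re (D t) * f1 t - Im (D t) * f2 t)).
    by have := Df1 t t01 => h; exact: is_deriveN.
  by rewrite -[(- f1) t]/(- f1 t); ring.
have Df2' (t : R) (t01 : 0 <= t <= 1) : is_derive t (1 : R) f2 (Re (D t) * f2 t - Im (D t) * (- f1) t).
  by rewrite -[(- f1) t]/(- f1 t) mulrN opprK; exact: Df2.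
have Df1'' (t : R) (t01 : 0 <= t <= 1) : is_derive t (1 : R) (- f1) (Re (D t) * (- f1) t + Im (D t) * f2 t).
  by have := Df1' t t01; rewrite (mulrN (Im (D t))) opprK.
have c2 := const _ (fun t t01 => is_derive_polar (Dal t t01) (Dbe t t01) (Df2' t t01) (Df1'' t t01)).
move: c1 c2; rewrite -[(- f1) 1]/(- f1 1) -[(- f1) 0]/(- f1 0).
have b0 : psum b (0%:C * z) = 0 by rewrite mul0r psum0 /b invr0 mulr0.
have e0 : psum (expseq a) (0%:C * z) = 1 by rewrite mul0r psum0.
have al0 : al 0 = 0 by rewrite /al b0. have be0 : be 0 = 0 by rewrite /be b0.
have f10 : f1 0 = 1 by rewrite /f1 e0. have f20 : f2 0 = 0 by rewrite /f2 e0.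
rewrite al0 be0 f10 f20 oppr0 expR0 cos0 sin0 !mulr0 !mul0r !addr0 !mul1r.
have E1 : psum b z = al 1 +i* be 1 by rewrite /al /be mul1r -complex_eta.
have E2 : psum (expseq a) z = f1 1 +i* f2 1 by rewrite /f1 /f2 mul1r -complex_eta.
rewrite -/b E1 E2 /cexp /= expRN => c1 c2.
have ex0 : expR (al 1) != 0 by rewrite gt_eqF // expR_gt0.
have c1' : cos (be 1) * f1 1 + sin (be 1) * f2 1 = expR (al 1).
  by apply: (mulfI (x := (expR (al 1))^-1)); rewrite ?invr_eq0 // c1 mulVf.
have c2' : cos (be 1) * f2 1 - sin (be 1) * f1 1 = 0.
  move/eqP: c2; by rewrite mulrN mulf_eq0 invr_eq0 (negPf ex0) /= => /eqP.
have cs := cos2Dsin2 (be 1).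
congr (_ +i* _).
  rewrite -c1'; apply/eqP; rewrite -subr_eq0; apply/eqP.
  transitivity ((cos (be 1) ^+ 2 + sin (be 1) ^+ 2 - 1) * f1 1
     + sin (be 1) * (cos (be 1) * f2 1 - sin (be 1) * f1 1)); first by ring.
  by rewrite cs c2' subrr mul0r mulr0 addr0.
rewrite -c1'; apply/eqP; rewrite -subr_eq0; apply/eqP.
transitivity ((cos (be 1) ^+ 2 + sin (be 1) ^+ 2 - 1) * f2 1
     - cos (be 1) * (cos (be 1) * f2 1 - sin (be 1) * f1 1)); first by ring.
by rewrite cs c2' subrr mul0r mulr0 subr0.
Qed.

End ExpSeries.

(** * The topology of H(D_1) *)

Section BoxCluster.
Import ArrowAsProduct.

(** Tychonoff's theorem in the product of the segments [[- b k, b k]]. A neighbourhood in the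
    product controls finitely many coordinates, which is why only [k < J] appears. *)
Lemma box_cluster (R : realType) (b : nat -> R) (u : nat -> nat -> R) :
  (forall j k, `|u j k| <= b k) ->
  exists2 a : nat -> R, (forall k, `|a k| <= b k) &
    forall j0 J (eta : R), 0 < eta ->
      exists2 j, (j0 <= j)%N & forall k, (k < J)%N -> `|a k - u j k| < eta.
Proof.
move=> ub.
have cI k : compact `[- b k, b k] by exact: segment_compact.
have cbox := @tychonoff nat (fun=> R^o) (fun k => `[- b k, b k]%classic) cI.
have [|a [abox acl]] := cbox (u @ \oo) _.
  by exists 0%N => // j _ k /=; rewrite in_itv /= -ler_norml.
exists a => [k|j0 J eta eta0]; first by have := abox k; rewrite /= in_itv /= -ler_norml.
have nbA : nbhs a [set c | forall k, (k < J)%N -> `|a k - c k| < eta].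
  elim: J => [|J IH]; first by apply: filterS filterT => c _.
  have : nbhs a [set c | `|a J - c J| < eta].
    have := @proj_continuous nat (fun=> R^o) J a.
    by move/cvgrPdist_lt/(_ _ eta0).
  apply: filterS2 IH => c IH h k; rewrite ltnS leq_eqVlt => /orP[/eqP -> //|].
  exact: IH.
have [|_ [[j /= j0j <-] cA]] := acl [set u j | j in [set j | (j0 <= j)%N]] _ _ nbA.
  by exists j0 => // j j0j; exists j.
by exists j.
Qed.

End BoxCluster.

Section DiscTopology.
Variable R : realType.
Implicit Types (f g : disc_fun R) (a b : nat -> R).

Definition near_disc (r e : R) f g : Prop :=
  forall z : set_type (@unit_disc R), normc (val z) <= r -> normc (f z - g z) < e.

Lemma normc_val (z : set_type (@unit_disc R)) : normc (val z) < 1.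
Proof. by apply/unit_discE; exact: set_valP. Qed.

Lemma continuous_normc : continuous (@normc R).
Proof.
move=> z; have nz : `|x| @[x --> z] --> (`|z| : R[i]) by exact: (@norm_continuous R[i] R[i]).
exact: (cvg_Re _ nz).
Qed.

Lemma continuous_normc_val : continuous (fun z : set_type (@unit_disc R) => normc (val z)).
Proof.
move=> z; apply: (@continuous_comp _ _ _ (@set_val _ (@unit_disc R)) (@normc R)).
  exact: initial_continuous.
exact: continuous_normc.
Qed.

Lemma compact_disc_radius (A : set (set_type (@unit_disc R))) : compact A ->
  exists r : R, 0 <= r < 1 /\ forall z, A z -> normc (val z) <= r.
Proof.
move=> cA; have [->|/set0P A0] := eqVneq A set0.
  by exists 0; rewrite lexx ltr01.
have [|c _ cmax] := @compact_EVT_max (set_type (@unit_disc R)) R (fun z => normc (val z)) A A0 cA.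
  exact/continuous_subspaceT/continuous_normc_val.
exists (normc (val c)); split; first by rewrite normc_ge0 normc_val.
by move=> z Az; apply: cmax; rewrite inE.
Qed.

(** The sets [near_disc r e f] generate a filter which converges to [f] uniformly on each compact
    set, because such a set lies in a disc of radius [r < 1]. Hence every neighbourhood of [f]
    belongs to this filter. *)
Lemma nbhs_disc f (V : set (disc_fun R)) : nbhs f V ->
  exists r e : R, [/\ 0 <= r < 1, 0 < e & near_disc r e f `<=` V].
Proof.
pose B := [set re : R * R | 0 <= re.1 < 1 /\ 0 < re.2].
pose G : set_system (disc_fun R) := filter_from B (fun re => near_disc re.1 re.2 f).
have FG : Filter G.
  apply: filter_from_filter; first by exists (0, 1); split=> //=; rewrite lexx ltr01.
  move=> [r e] [r' e'] [/= /andP[r0 r1] e0] [/= /andP[r'0 r'1] e'0].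
  exists (Num.max r r', Num.min e e').
    by split=> /=; rewrite ?le_max ?r0 ?gt_max ?r1 // lt_min e0.
  move=> g /= gP; split=> z zr; have := gP z.
    by rewrite le_max zr lt_min => /(_ isT) /andP[].
  by rewrite le_max zr orbT lt_min => /(_ isT) /andP[].
have : G --> f.
  apply/fam_cvgP => A cA W /uniform_nbhs[E [entE EW]].
  have [r [r01 rP]] := compact_disc_radius cA.
  move: entE; rewrite -entourage_from_ballE => -[e /= /gt0_complex[e' e'0 ee'] eE].
  exists (r, e'); first by split.
  move=> g gP; apply: EW => z Az; apply: eE => /=.
  rewrite -ball_normE /= ee' normCE ltcR; apply: gP; exact: rP.
by move=> /[apply] -[[r e] [r01 e0] sub]; exists r, e.
Qed.

Definition psum_disc a : disc_fun R := fun z => psum a (val z).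

Lemma analytic_psum a : tame a -> analytic_disc (psum_disc a).
Proof.
move=> ta; exists (psum a) => // z /unit_discE z1.
exact: derivable_psum.
Qed.

Lemma near_psum a b r e : tame a -> tame b -> 0 <= r < 1 ->
  2 * abs_sum (fun k => a k - b k) r < e -> near_disc r e (psum_disc a) (psum_disc b).
Proof.
move=> ta tb /andP[r0 r1] h z zr; rewrite /psum_disc -psumB ?normc_val //.
apply: le_lt_trans h; apply: normc_psum_le => //.
by apply: tameD => //; exact: tameN.
Qed.

Definition tailseq J b : nat -> R := fun k => if (k < J)%N then 0 else b k.

Lemma tame_tailseq J b : tame b -> tame (tailseq J b).
Proof. by apply: tame_le => k; rewrite /tailseq; case: ifP => //; rewrite normr0. Qed.

Lemma abs_sumD a b r : tame a -> tame b -> 0 <= r < 1 ->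
  abs_sum (fun k => a k + b k) r <= abs_sum a r + abs_sum b r.
Proof.
move=> ta tb r01; rewrite /abs_sum -lim_seriesD; [|exact: summable_series..].
apply: lim_series_le.
- exact: summable_series (tameD ta tb) r01.
- by apply: is_cvg_seriesD; exact: summable_series.
- move=> k; rewrite -[(_ + _) k]/(_ + _) -mulrDl ler_wpM2r ?ler_normD //.
  by rewrite exprn_ge0; case/andP: r01.
Qed.

Lemma abs_sum_tail_small b r e : tame b -> 0 <= r < 1 -> 0 < e ->
  exists J, abs_sum (tailseq J b) r < e.
Proof.
move=> tb r01 e0; have cb := summable_series tb r01.
pose u := series (fun k => `|b k| * r ^+ k).
have E J : abs_sum (tailseq J b) r = limn u - u J.
  have cu : (fun n => u n - u J) @ \oo --> limn u - u J.
    by apply: cvgB; [exact: cb | exact: cvg_cst].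
  apply: (@cvg_lim _ (@Rhausdorff R)); apply: cvg_trans cu.
  apply: near_eq_cvg; exists J => // n /= Jn.
  rewrite /u /series /= (big_cat_nat (n := J)) //= addrAC subrr add0r.
  rewrite [RHS](big_cat_nat (n := J)) //= [X in _ = X + _]big_nat_cond.
  rewrite [X in _ = X + _]big1 ?add0r; last first.
    by move=> k /andP[/andP[_ kJ] _]; rewrite /tailseq kJ normr0 mul0r.
  by apply: eq_big_nat => k /andP[Jk _]; rewrite /tailseq ltnNge Jk.
move/cvgrPdist_lt/(_ _ e0): cb => -[J _ /(_ J (leqnn J))] /= h.
exists J; rewrite E; exact: le_lt_trans (ler_norm _) h.
Qed.

(** Below [J] each term is at most [eta], since [r ^ k <= 1]; from [J] on the terms are dominated by
    the tail of [b]. *)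
Lemma abs_sum_split a b J eta r : tame a -> tame b -> 0 <= r < 1 -> 0 <= eta ->
  (forall k, (k < J)%N -> `|a k| <= eta) -> (forall k, (J <= k)%N -> `|a k| <= `|b k|) ->
  abs_sum a r <= J%:R * eta + abs_sum (tailseq J b) r.
Proof.
move=> ta tb r01 eta0 aeta ab; have [r0 r1] := andP r01.
pose c (k : nat) : R := if (k < J)%N then eta else 0.
have tc : tame c.
  apply: (@tame_le _ _ (fun k => eta * 1 ^+ k)); last by apply: tameZ; apply: tame_pow; rewrite normr1.
  by move=> k; rewrite /c expr1n mulr1; case: ifP => //; rewrite normr0.
have tt := tame_tailseq J tb.
have abs_norm u : abs_sum u r = abs_sum (fun k => `|u k|) r.
  by rewrite /abs_sum; congr (limn (series _)); apply/funext => k; rewrite normr_id.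
have tn (u : nat -> R) : tame u -> tame (fun k => `|u k|) by apply: tame_le => k; rewrite normr_id.
apply: (@le_trans _ _ (abs_sum (fun k => `|c k| + `|tailseq J b k|) r)).
  apply: le_abs_sum => //; first by apply: tameD; exact: tn.
  move=> k; rewrite /c /tailseq [leRHS]ger0_norm ?addr_ge0 //.
  case: ltnP => kJ; first by rewrite normr0 addr0 [leRHS]ger0_norm // aeta.
  by rewrite normr0 add0r ab.
apply: le_trans (abs_sumD (tn _ tc) (tn _ tt) r01) _; rewrite -!abs_norm.
rewrite lerD2r /abs_sum (@cvg_lim _ (@Rhausdorff R) _ _ _ _ (\sum_(k < J) eta * r ^+ k)) //.
  rewrite mulr_natl -[X in _ *+ X]card_ord -sumr_const; apply: ler_sum => k _.
  by rewrite ler_piMr // exprn_ile1 // ltW.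
apply: cvg_near_cst; exists J => // n /= Jn.
rewrite /series /= (big_cat_nat (n := J)) //= [X in _ + X]big_nat_cond.
rewrite [X in _ + X]big1 ?addr0; last first.
  by move=> k /andP[/andP[Jk _] _]; rewrite /c ltnNge Jk normr0 mul0r.
rewrite big_mkord; apply: eq_bigr => k _; rewrite /c ltn_ord ger0_norm //.
Qed.

Definition trunc_seq K a : nat -> R := fun k => if (k < K)%N then a k else 0.

Lemma tame_trunc K a : tame (trunc_seq K a).
Proof.
move=> r /andP[r0 r1]; exists (\sum_(k < K) `|a k|) => k.
rewrite /trunc_seq; case: ifP => kK; last by rewrite normr0 mul0r sumr_ge0.
rewrite (@le_trans _ _ `|a k|) //; first by rewrite ler_piMr // exprn_ile1 // ltW.
by rewrite (bigD1 (Ordinal kK)) //= lerDl sumr_ge0.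
Qed.

Lemma within_continuous_disc (F : disc_fun R -> R) f e :
  {within @analytic_disc R, continuous F} -> analytic_disc f -> 0 < e ->
  exists r d : R, [/\ 0 <= r < 1, 0 < d &
    forall g, analytic_disc g -> near_disc r d f g -> `|F f - F g| < e].
Proof.
move=> cF Hf e0; have cFf : F g @[g --> within (@analytic_disc R) (nbhs f)] --> F f.
  by rewrite (nbhs_subspace_in Hf); exact: cF.
have [r [d [r01 d0 sub]]] : exists r d : R, [/\ 0 <= r < 1, 0 < d &
    near_disc r d f `<=` [set g | analytic_disc g -> `|F f - F g| < e]].
  apply: nbhs_disc; move/cvgrPdist_lt/(_ _ e0): cFf; exact.
by exists r, d; split=> // g Hg /sub; exact.
Qed.

(* A cluster point of a sequence of counterexamples, which exists by Tychonoff's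
   theorem, would be a point of discontinuity. *)
Lemma uniform_truncation b (F : disc_fun R -> R) e : tame b ->
  {within @analytic_disc R, continuous F} -> 0 < e ->
  exists K0, forall K a, (K0 <= K)%N -> (forall k, `|a k| <= b k) ->
    `|F (psum_disc a) - F (psum_disc (trunc_seq K a))| <= e.
Proof.
move=> tb cF e0; apply: contrapT => /forallNP H.
have {H} H j : exists Ka : nat * (nat -> R), [/\ (j <= Ka.1)%N,
    forall k, `|Ka.2 k| <= b k &
    e < `|F (psum_disc Ka.2) - F (psum_disc (trunc_seq Ka.1 Ka.2))|].
  have /existsNP[K /existsNP[a /not_implyP[jK /not_implyP[ab]]]] := H j.
  by move/negP; rewrite -ltNge => h; exists (K, a).
have [s sP] := choice H.
have [a aP acl] := box_cluster (fun j => let: And3 _ h _ := sP j in h).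
have b0 k : 0 <= b k.
  by case: (sP 0%N) => _ /(_ k) h _; exact: le_trans h.
have inbox_tame c : (forall k, `|c k| <= b k) -> tame c.
  by move=> cb; apply: tame_le tb => k; rewrite [leRHS]ger0_norm.
have ta := inbox_tame _ aP.
have e20 : 0 < e / 2 by rewrite divr_gt0.
have [r [d [r01 d0 near_F]]] := within_continuous_disc cF (analytic_psum ta) e20.
have d80 : 0 < d / 8 by rewrite divr_gt0.
have [J Jsmall] := abs_sum_tail_small (tameZ 2 tb) r01 d80.
(* [near_psum] costs a factor 2: head and tail of the difference are each at most [d / 8], so twice
   their sum stays below [d]. *)
pose eta := d / (8 * J.+1%:R).
have eta0 : 0 < eta by rewrite divr_gt0 // mulr_gt0.
have closeF c : (forall k, `|c k| <= b k) -> (forall k, (k < J)%N -> `|a k - c k| < eta) ->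
    `|F (psum_disc a) - F (psum_disc c)| < e / 2.
  move=> cb ac; have tc := inbox_tame _ cb.
  apply: near_F; first exact: analytic_psum.
  apply: near_psum => //.
  have tac : tame (fun k => a k - c k) by apply: tameD => //; exact: tameN.
  have := @abs_sum_split _ (fun k => 2 * b k) J eta r tac (tameZ 2 tb) r01 (ltW eta0).
  move=> /(_ (fun k kJ => ltW (ac k kJ))) h.
  have {}h : abs_sum (fun k => a k - c k) r <=
      J%:R * eta + abs_sum (tailseq J (fun k => 2 * b k)) r.
    apply: h => k _; rewrite (le_trans (ler_normB _ _)) // [leRHS]ger0_norm ?mulr_ge0 //.
    by rewrite mulr_natl mulr2n lerD.
  have Jeta : J%:R * eta <= d / 8.
    rewrite /eta mulrA ler_pdivrMr ?mulr_gt0 // mulrA divfK // [leRHS]mulrC.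
    by rewrite ler_wpM2r ?(ltW d0) // ler_nat.
  by lra.
have [j Jj cA] := acl J J _ eta0.
have [jK cb big] := sP j.
have h1 := closeF _ cb cA.
have h2 : `|F (psum_disc a) - F (psum_disc (trunc_seq (s j).1 (s j).2))| < e / 2.
  apply: closeF => k; rewrite /trunc_seq.
    by case: ifP => // _; rewrite normr0.
  by move=> kJ; rewrite (leq_trans kJ (leq_trans Jj jK)); exact: cA.
move: big; rewrite ltNge => /negP; apply.
rewrite (le_trans (ler_distD (F (psum_disc a)) _ _)) //.
by rewrite distrC; lra.
Qed.

End DiscTopology.

(** * Poisson vectors *)

Section CountableValued.
Context (R : realType) (dT : measure_display) (T : measurableType dT).
Context (P : probability T R) (C : countType) (Z : T -> C).
Hypothesis mZ : forall c, measurable (Z @^-1` [set c]).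

Lemma measurable_countable_preimage (A : set C) : measurable (Z @^-1` A).
Proof.
have -> : Z @^-1` A = \bigcup_(c in A) Z @^-1` [set c].
  apply/seteqP; split => [w Aw|w [c Ac /= wc]]; first by exists (Z w).
  by rewrite /preimage /= wc.
have -> : \bigcup_(c in A) Z @^-1` [set c] =
    \bigcup_c (if c \in A then Z @^-1` [set c] else set0).
  apply/seteqP; split => w [c Ac]; first by exists c => //; rewrite mem_set.
  by case: ifP => // /set_mem cA Zc; exists c.
by apply: countable_bigcupT_measurable => // c; case: ifP.
Qed.

Lemma measurable_fun_countable (dE : measure_display) (E : measurableType dE) (f : C -> E) :
  measurable_fun setT (fun w => f (Z w)).
Proof.
move=> _ Y _; rewrite setTI.
exact: (measurable_countable_preimage (f @^-1` Y)).
Qed.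

Lemma ge0_integral_countable (f : C -> \bar R) : (forall c, 0 <= f c)%E ->
  (\int[P]_w f (Z w) = \esum_(c in [set: C]) (f c * P (Z @^-1` [set c])))%E.
Proof.
move=> f0; pose F n := Z @^-1` [set c | pickle c = n].
have mF n : measurable (F n) by exact: measurable_countable_preimage.
have UF : [set: T] = \bigcup_n F n.
  by apply/seteqP; split => // w _; exists (pickle (Z w)).
rewrite UF ge0_integral_bigcup //; last 2 first.
- by rewrite -UF; exact: measurable_fun_countable.
- apply/trivIsetP => i j _ _ ij; apply/seteqP; split => // w [/= wi wj].
  by move: ij; rewrite -wi -wj eqxx.
pose g n : \bar R := (\int[P]_(w in F n) f (Z w))%E.
have g0 n : (0 <= g n)%E by exact: integral_ge0.
have gE c : g (pickle c) = (f c * P (Z @^-1` [set c]))%E.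
  have FE : F (pickle c) = Z @^-1` [set c].
    apply/seteqP; split => w; rewrite /F /preimage /=; last by move=> ->.
    exact: (pcan_inj pickleK).
  rewrite /g FE -integral_cst //; apply: eq_integral => w.
  by rewrite inE /preimage /= => ->.
rewrite (nneseries_esum (P := xpredT)) //.
rewrite -(eq_esum (fun c _ => gE c)).
rewrite -(@esum_image R C nat [set: C] pickle g); last first.
  by move=> x y _ _; exact: (pcan_inj pickleK).
rewrite esum_mkcond [RHS]esum_mkcond.
apply: eq_esum => n _; rewrite mem_set //; case: ifPn => // /negP nim.
rewrite -[LHS]/(g n) /g (_ : F n = set0) ?integral_set0 //.
apply/seteqP; split => // w; rewrite /F /preimage /= => wn; apply: nim; apply/mem_set.
by exists (Z w).
by move=> n _; exact: integral_ge0.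
Qed.

End CountableValued.

Section PoissonVector.
Context (R : realType) (dT : measure_display) (T : measurableType dT).
Context (P : probability T R) (d : nat) (L : nat -> {RV P >-> nat}).
Hypothesis d_gt0 : (0 < d)%N.
Hypothesis L_poisson : forall l, (1 <= l)%N -> poisson_rv (d%:R ^+ l / l%:R) (L l).
Hypothesis L_indep : mutually_independent P [set l | (1 <= l)%N] (fun l => L l : T -> nat).

Definition count_vec K (w : T) : {ffun 'I_K -> nat} := [ffun i : 'I_K => L i.+1 w].

Definition poisson_weight K (c : {ffun 'I_K -> nat}) : R :=
  \prod_(i : 'I_K) poisson_pmf (d%:R ^+ i.+1 / i.+1%:R) (c i).

Lemma measurable_L l k : measurable (L l @^-1` [set k]).
Proof. by rewrite -[X in measurable X]setTI; exact: measurable_funPT. Qed.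

Lemma count_vecE K (c : {ffun 'I_K -> nat}) : count_vec K @^-1` [set c] =
  \bigcap_(j in [set` map (fun i : 'I_K => i.+1) (enum 'I_K)])
     (L j @^-1` [set k | forall i : 'I_K, i.+1 = j -> k = c i]).
Proof.
apply/seteqP; split => w /=.
  by move=> <- j /= _ i <-; rewrite ffunE.
move=> h; apply/ffunP => i; rewrite ffunE.
by apply: (h i.+1) => //=; apply: map_f; rewrite mem_enum.
Qed.

Lemma measurable_count_vec K c : measurable (count_vec K @^-1` [set c]).
Proof.
rewrite count_vecE; apply: fin_bigcap_measurable => //= j _.
by apply: (measurable_countable_preimage (measurable_L j)).
Qed.

Lemma count_vec_law K c : P (count_vec K @^-1` [set c]) = (poisson_weight c)%:E.
Proof.
rewrite count_vecE L_indep; last 2 first.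
- by rewrite map_inj_uniq ?enum_uniq // => i j [] /val_inj.
- by move=> j /mapP[i _ ->].
rewrite big_map big_enum /= /poisson_weight -prodEFin; apply: eq_bigr => i _.
rewrite -L_poisson //; congr (P (_ @^-1` _)); apply/seteqP; split => k /=; first exact.
by move=> -> j [] /val_inj ->.
Qed.

Definition add_one K (i : 'I_K) (c : {ffun 'I_K -> nat}) : {ffun 'I_K -> nat} :=
  [ffun j => (c j + (j == i))%N].

Lemma poisson_weight_gt0 K (c : {ffun 'I_K -> nat}) : 0 < poisson_weight c.
Proof.
apply: prodr_gt0 => i _; rewrite /poisson_pmf; case: ifP => // r0.
by rewrite mulr_gt0 ?expR_gt0 // divr_gt0 ?exprn_gt0 // ltr0n fact_gt0.
Qed.

Lemma poisson_weight_add_one K (i : 'I_K) (c : {ffun 'I_K -> nat}) :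
  i.+1%:R * (c i).+1%:R * poisson_weight (add_one i c) = d%:R ^+ i.+1 * poisson_weight c.
Proof.
rewrite /poisson_weight [in LHS](bigD1 i) //= [in RHS](bigD1 i) //= !mulrA.
congr (_ * _); last first.
  by apply: eq_bigr => j /negPf ji; rewrite ffunE ji addn0.
rewrite ffunE eqxx addn1 /poisson_pmf.
have -> : 0 < d%:R ^+ i.+1 / i.+1%:R :> R by rewrite divr_gt0 ?exprn_gt0 ?ltr0n.
rewrite factS natrM exprSr.
field.
by rewrite !lt0r_neq0 ?ltr_pwDl ?ltr0n ?fact_gt0.
Qed.

(** Chen-Stein identity: the configurations with [c i = 0] contribute nothing and the others are
    reindexed by [add_one i]. For nonnegative [f] infinite values are allowed, so the identity can
    itself prove that moments are finite. *)
Lemma poisson_stein_ge0 K (i : 'I_K) (f : {ffun 'I_K -> nat} -> R) : (forall c, 0 <= f c) ->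
  (\int[P]_w (i.+1%:R * (count_vec K w i)%:R * f (count_vec K w))%:E =
   \int[P]_w (d%:R ^+ i.+1 * f (add_one i (count_vec K w)))%:E)%E.
Proof.
move=> f0.
rewrite (@ge0_integral_countable _ _ _ P _ _ (@measurable_count_vec K)
  (fun c => (i.+1%:R * (c i)%:R * f c)%:E)); last by move=> c; rewrite lee_fin !mulr_ge0.
rewrite (@ge0_integral_countable _ _ _ P _ _ (@measurable_count_vec K)
  (fun c => (d%:R ^+ i.+1 * f (add_one i c))%:E)); last first.
  by move=> c; rewrite lee_fin mulr_ge0 // exprn_ge0.
transitivity (\esum_(c in [set c : {ffun 'I_K -> nat} | (0 < c i)%N])
    ((i.+1%:R * (c i)%:R * f c)%:E * P (count_vec K @^-1` [set c]))%E).
  rewrite [RHS]esum_mkcond; apply: eq_esum => c _; case: ifPn => // /negP h.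
  have -> : c i = 0%N by case: (posnP (c i)) => // c0; case: h; rewrite inE.
  by rewrite mulr0 mul0r mul0e.
rewrite (@reindex_esum _ _ _ setT _ (add_one i)); last first.
  split => //=.
  - by move=> c _ /=; rewrite ffunE eqxx addn1.
  - move=> a b _ _ /ffunP ab; apply/ffunP => j.
    by move: (ab j); rewrite !ffunE => /addIn.
  - move=> c /= c0; exists [ffun j => (c j - (j == i))%N] => //.
    by apply/ffunP => j; rewrite !ffunE subnK //; case: eqP => // ->.
apply: eq_esum => c _; rewrite !count_vec_law -!EFinM; congr (_%:E).
rewrite mulrAC [in RHS]mulrAC -poisson_weight_add_one ffunE eqxx addn1.
by [].
Qed.

End PoissonVector.

(** * Moments of functions of a Poisson vector *)

Section PoissonMoments.
Context (R : realType) (dT : measure_display) (T : measurableType dT).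
Context (P : probability T R) (d : nat) (L : nat -> {RV P >-> nat}).
Hypothesis d_gt0 : (0 < d)%N.
Hypothesis L_poisson : forall l, (1 <= l)%N -> poisson_rv (d%:R ^+ l / l%:R) (L l).
Hypothesis L_indep : mutually_independent P [set l | (1 <= l)%N] (fun l => L l : T -> nat).
Variable K : nat.
Implicit Types (c : {ffun 'I_K -> nat}) (f g : {ffun 'I_K -> nat} -> R).

Let cv := @count_vec R dT T P L K.
Let meas_ecv (f : {ffun 'I_K -> nat} -> R) : measurable_fun setT (fun w => (f (cv w))%:E) :=
  measurable_fun_countable (@measurable_count_vec _ _ _ P L K) (fun c => (f c)%:E).

Definition total c : nat := (\sum_i c i)%N.

Lemma total_add_one i c : total (add_one i c) = (total c).+1.
Proof.
rewrite /total; under eq_bigr do rewrite ffunE.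
rewrite big_split /= [X in (_ + X)%N = _](bigD1 i) //= eqxx [X in (_ + (_ + X))%N]big1 ?addn0 ?addn1 //.
by move=> j /negPf ->.
Qed.

Definition poly_bounded f : Prop :=
  exists C p, forall c, `|f c| <= C * (total c).+1%:R ^+ p.

Lemma poly_bounded_cst (a : R) : poly_bounded (fun=> a).
Proof. by exists `|a|, 0%N => c; rewrite expr0 mulr1. Qed.

Lemma poly_bounded_ge0 f : poly_bounded f ->
  exists C p, 0 <= C /\ forall c, `|f c| <= C * (total c).+1%:R ^+ p.
Proof.
case=> C [p fP]; exists `|C|, p; split=> // c; apply: (le_trans (fP c)).
by rewrite ler_wpM2r ?exprn_ge0 ?ler_norm.
Qed.

Lemma poly_boundedD f g : poly_bounded f -> poly_bounded g ->
  poly_bounded (fun c => f c + g c).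
Proof.
move=> /poly_bounded_ge0[C [p [C0 fP]]] /poly_bounded_ge0[D [q [D0 gP]]].
exists (C + D), (p + q)%N => c; rewrite (le_trans (ler_normD _ _)) // mulrDl lerD //.
  apply: (le_trans (fP c)); rewrite ler_wpM2l // ler_weXn2l ?leq_addr //.
  by rewrite ler1n.
apply: (le_trans (gP c)); rewrite ler_wpM2l // ler_weXn2l ?leq_addl //.
by rewrite ler1n.
Qed.

Lemma poly_boundedM f g : poly_bounded f -> poly_bounded g ->
  poly_bounded (fun c => f c * g c).
Proof.
move=> /poly_bounded_ge0[C [p [C0 fP]]] /poly_bounded_ge0[D [q [D0 gP]]].
exists (C * D), (p + q)%N => c; rewrite normrM exprD mulrACA.
exact: ler_pM.
Qed.

Lemma poly_boundedZ (a : R) f : poly_bounded f -> poly_bounded (fun c => a * f c).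
Proof. by apply: poly_boundedM; exact: poly_bounded_cst. Qed.

Lemma poly_boundedB f g : poly_bounded f -> poly_bounded g ->
  poly_bounded (fun c => f c - g c).
Proof.
move=> bf bg; apply: poly_boundedD => //.
by have := poly_boundedZ (-1) bg; congr poly_bounded; apply/funext => c; rewrite mulN1r.
Qed.

Lemma poly_bounded_sum (I : Type) (s : seq I) (Q : pred I) (F : I -> {ffun 'I_K -> nat} -> R) :
  (forall i, Q i -> poly_bounded (F i)) -> poly_bounded (fun c => \sum_(i <- s | Q i) F i c).
Proof.
move=> bF; elim: s => [|i s IH].
  rewrite (_ : (fun c => _) = fun=> 0); first exact: poly_bounded_cst.
  by apply/funext => c; rewrite big_nil.
rewrite (_ : (fun c => _) =
  fun c => (if Q i then F i c else 0) + \sum_(j <- s | Q j) F j c); last first.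
  by apply/funext => c; rewrite big_cons; case: ifP => // _; rewrite add0r.
apply: poly_boundedD => //; case Qi: (Q i); [exact: bF|exact: poly_bounded_cst].
Qed.

Lemma poly_bounded_coord i : poly_bounded (fun c => (c i)%:R).
Proof.
exists 1, 1%N => c; rewrite expr1 mul1r ger0_norm // ler_nat.
by rewrite /total (bigD1 i) //= -addnS leq_addr.
Qed.

Lemma poly_bounded_add_one i f : poly_bounded f -> poly_bounded (fun c => f (add_one i c)).
Proof.
move=> /poly_bounded_ge0[C [p [C0 fP]]]; exists (C * 2 ^+ p), p => c.
rewrite (le_trans (fP _)) // -mulrA ler_wpM2l // -exprMn lerXn2r ?nnegrE ?mulr_ge0 //.
by rewrite total_add_one -natrM ler_nat; lia.
Qed.

(** Induction on [p]: one factor [total + 1] is split into 1 and the coordinates, and the Stein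
    identity trades a coordinate for [add_one], at the price of
    [(total + 2)^p <= 2^p (total + 1)^p]. *)
Lemma moment_lty p : (\int[P]_w ((total (cv w)).+1%:R ^+ p)%:E < +oo)%E.
Proof.
elim: p => [|p IH].
  under eq_integral do rewrite expr0.
  by rewrite integral_cst //= probability_setT mule1 ltry.
have E w : ((total (cv w)).+1%:R ^+ p.+1)%:E = ((total (cv w)).+1%:R ^+ p)%:E +
    \sum_(i < K) ((cv w i)%:R * (total (cv w)).+1%:R ^+ p)%:E :> \bar R.
  by rewrite sumEFin -EFinD -mulr_suml -natr_sum -/(total _) exprS -[X in X * _]natr1
    mulrDl mul1r addrC.
under eq_integral do rewrite E.
rewrite ge0_integralD //; last 3 first.
- by exact: (meas_ecv (fun c => (total c).+1%:R ^+ p)).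
- by move=> w _; apply: sume_ge0 => i _; rewrite lee_fin mulr_ge0 // exprn_ge0.
- apply: emeasurable_sum => i; exact: (meas_ecv (fun c => (c i)%:R * (total c).+1%:R ^+ p)).
rewrite ge0_integral_sum //; last first.
  by move=> i; exact: (meas_ecv (fun c => (c i)%:R * (total c).+1%:R ^+ p)).
apply: lte_add_pinfty => //; apply: lte_sum_pinfty => i _.
apply: (@le_lt_trans _ _ (\int[P]_w (i.+1%:R * (cv w i)%:R * (total (cv w)).+1%:R ^+ p)%:E)%E).
  apply: ge0_le_integral => //.
  - exact: (meas_ecv (fun c => (c i)%:R * (total c).+1%:R ^+ p)).
  - exact: (meas_ecv (fun c => i.+1%:R * (c i)%:R * (total c).+1%:R ^+ p)).
  - by move=> w _; rewrite lee_fin -mulrA ler_peMl ?ler1n.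
rewrite (poisson_stein_ge0 d_gt0 L_poisson L_indep i
  (f := fun c => (total c).+1%:R ^+ p)); last by move=> c; rewrite exprn_ge0.
apply: (@le_lt_trans _ _ (\int[P]_w ((d%:R ^+ i.+1 * 2 ^+ p)%:E *
    ((total (cv w)).+1%:R ^+ p)%:E))%E).
  apply: ge0_le_integral => //.
  - exact: (meas_ecv (fun c => d%:R ^+ i.+1 * (total (add_one i c)).+1%:R ^+ p)).
  - exact: (meas_ecv (fun c => d%:R ^+ i.+1 * 2 ^+ p * (total c).+1%:R ^+ p)).
  - move=> w _; rewrite -EFinM lee_fin -mulrA ler_wpM2l ?exprn_ge0 // -exprMn.
    by rewrite lerXn2r ?nnegrE ?mulr_ge0 // total_add_one -natrM ler_nat /cv; lia.
rewrite ge0_integralZl_EFin //.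
  by rewrite lte_mul_pinfty // lee_fin mulr_ge0 // exprn_ge0.
exact: (meas_ecv (fun c => (total c).+1%:R ^+ p)).
Qed.

Lemma integrable_poly f : poly_bounded f -> P.-integrable setT (EFin \o (fun w => f (cv w))).
Proof.
move=> /poly_bounded_ge0[C [p [C0 fP]]].
apply: (@le_integrable _ _ _ P setT _ _ (fun w => (C * (total (cv w)).+1%:R ^+ p)%:E)) => //.
- exact: meas_ecv.
- move=> w _ /=; rewrite lee_fin [leRHS]ger0_norm //.
  by rewrite mulr_ge0 // exprn_ge0.
- apply/integrableP; split.
    by exact: (meas_ecv (fun c => C * (total c).+1%:R ^+ p)).
  under eq_integral => w _.
    rewrite gee0_abs ?lee_fin ?mulr_ge0 ?exprn_ge0 // EFinM.
    over.
  rewrite ge0_integralZl_EFin //.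
  + by rewrite lte_mul_pinfty //; exact: moment_lty.
  exact: (meas_ecv (fun c => (total c).+1%:R ^+ p)).
Qed.

Definition mean f : R := (\int[P]_w f (cv w))%R.

Lemma eq_mean f g : f =1 g -> mean f = mean g.
Proof. by move=> fg; apply: eq_Rintegral => w _; rewrite fg. Qed.

Lemma meanD f g : poly_bounded f -> poly_bounded g ->
  mean (fun c => f c + g c) = mean f + mean g.
Proof. by move=> bf bg; rewrite /mean RintegralD //; exact: integrable_poly. Qed.

Lemma meanZ (a : R) f : poly_bounded f -> mean (fun c => a * f c) = a * mean f.
Proof. by move=> bf; rewrite /mean RintegralZl //; exact: integrable_poly. Qed.

Lemma meanB f g : poly_bounded f -> poly_bounded g ->
  mean (fun c => f c - g c) = mean f - mean g.
Proof. by move=> bf bg; rewrite /mean RintegralB //; exact: integrable_poly. Qed.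

Lemma mean_cst (a : R) : mean (fun=> a) = a.
Proof. by rewrite /mean Rintegral_cst //= probability_setT /= mulr1. Qed.

Lemma mean_sum (I : Type) (s : seq I) (Q : pred I) (F : I -> {ffun 'I_K -> nat} -> R) :
  (forall i, Q i -> poly_bounded (F i)) ->
  mean (fun c => \sum_(i <- s | Q i) F i c) = \sum_(i <- s | Q i) mean (F i).
Proof.
move=> bF; elim: s => [|i s IH].
  rewrite big_nil; transitivity (mean (fun=> 0)); last exact: mean_cst.
  by apply: eq_mean => c; rewrite big_nil.
rewrite big_cons -IH; case: ifP => Qi; last by apply: eq_mean => c; rewrite big_cons Qi.
rewrite -meanD; [|exact: bF|exact: poly_bounded_sum].
by apply: eq_mean => c; rewrite big_cons Qi.
Qed.

Lemma mean_stein (i : 'I_K) f : poly_bounded f ->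
  mean (fun c => i.+1%:R * (c i)%:R * f c) = d%:R ^+ i.+1 * mean (fun c => f (add_one i c)).
Proof.
move=> bf; pose fp c := Num.max (f c) 0; pose fn c := Num.max (- f c) 0.
have fE c : f c = fp c - fn c.
  by rewrite /fp /fn; case: (leP (f c) 0) => h; case: (leP (- f c) 0); lra.
have [C [p [C0 fP]]] := poly_bounded_ge0 bf.
have bp : poly_bounded fp.
  exists C, p => c; apply: le_trans (fP c); rewrite /fp.
  by case: (leP (f c) 0) => // h; rewrite normr0.
have bn : poly_bounded fn.
  exists C, p => c; apply: le_trans (fP c); rewrite /fn.
  by case: (leP (- f c) 0) => // h; rewrite ?normr0 ?normrN.
have ge0_case g : (forall c, 0 <= g c) -> poly_bounded g ->
    mean (fun c => i.+1%:R * (c i)%:R * g c) = d%:R ^+ i.+1 * mean (fun c => g (add_one i c)).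
  move=> g0 bg; rewrite -meanZ; last exact: poly_bounded_add_one.
  by congr fine; exact: poisson_stein_ge0.
have bc : poly_bounded (fun c => i.+1%:R * (c i)%:R).
  by apply: poly_boundedZ; exact: poly_bounded_coord.
transitivity (mean (fun c => i.+1%:R * (c i)%:R * fp c - i.+1%:R * (c i)%:R * fn c)).
  by apply: eq_mean => c; rewrite [in LHS]fE mulrBr.
rewrite meanB; [|exact: poly_boundedM..].
rewrite !ge0_case //; last 2 first.
- by move=> c; rewrite /fn le_max lexx orbT.
- by move=> c; rewrite /fp le_max lexx orbT.
rewrite -mulrBr -meanB; [|exact: poly_bounded_add_one..].
by congr (_ * _); apply: eq_mean => c; rewrite -fE.
Qed.

(** Each of the [c i] cycles of length [i.+1] contributes its [i.+1] starting points to the closed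
    paths of every length divisible by [i.+1]. *)
Definition cycle_trace j c : nat := (\sum_(i < K | i.+1 %| j) i.+1 * c i)%N.

Lemma poly_bounded_cycle_trace j : poly_bounded (fun c => (cycle_trace j c)%:R).
Proof.
rewrite (_ : (fun c => _) = fun c => \sum_(i < K | (i.+1 %| j)%N) i.+1%:R * (c i)%:R); last first.
  by apply/funext => c; rewrite natr_sum; apply: eq_bigr => i _; rewrite natrM.
by apply: poly_bounded_sum => i _; apply: poly_boundedZ; exact: poly_bounded_coord.
Qed.

Lemma cycle_trace_add_one j (i : 'I_K) c : cycle_trace j (add_one i c) =
  (cycle_trace j c + (if i.+1 %| j then i.+1 else 0))%N.
Proof.
rewrite /cycle_trace; under eq_bigr do rewrite ffunE mulnDr.
rewrite big_split /=; congr (_ + _)%N.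
case: ifP => ij.
  rewrite (bigD1 i) //= eqxx muln1 big1 ?addn0 // => k /andP[_ /negPf ->].
  by rewrite muln0.
by rewrite big1 // => k kj; case: eqP => [ki|]; rewrite ?muln0 // -ki kj in ij *.
Qed.

Lemma mean_trace_stein j f : poly_bounded f ->
  mean (fun c => (cycle_trace j c)%:R * f c) =
  \sum_(i < K | (i.+1 %| j)%N) d%:R ^+ i.+1 * mean (fun c => f (add_one i c)).
Proof.
move=> bf; rewrite -(eq_bigr _ (fun i _ => mean_stein i bf)) -mean_sum.
  by apply: eq_mean => c; rewrite natr_sum mulr_suml; apply: eq_bigr => i _; rewrite natrM.
move=> i _; apply: poly_boundedM => //.
by apply: poly_boundedZ; exact: poly_bounded_coord.
Qed.

(** Coefficients of [exp(- sum T_j X^j / j) / (1 - d X)]: the trivial eigenvalue [d] is removed. *)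
Definition hcoef k c : R := expseq (fun j => d%:R ^+ j - (cycle_trace j c)%:R) k.

Lemma hcoef_add_one (i : 'I_K) k c :
  hcoef k (add_one i c) = hcoef k c - shiftseq i.+1 (hcoef^~ c) k.
Proof.
have := @expseq_shift R (fun j => d%:R ^+ j - (cycle_trace j c)%:R) i.+1 1 k isT.
rewrite mul1r => <-; apply: (@eq_expseq _ _ _ k) => // j _.
rewrite cycle_trace_add_one natrD opprD addrA; congr (_ - _).
by case: ifP => // _; rewrite expr1n mulr1.
Qed.

Lemma poly_bounded_hcoef k : poly_bounded (hcoef k).
Proof.
elim/ltn_ind: k => -[_|k IH].
  rewrite (_ : hcoef 0 = fun=> 1); first exact: poly_bounded_cst.
  by apply/funext => c; rewrite /hcoef expseq0.
rewrite (_ : hcoef k.+1 = fun c => k.+1%:R^-1 *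
   \sum_(j < k.+1) (d%:R ^+ j.+1 - (cycle_trace j.+1 c)%:R) * hcoef (k - j) c); last first.
  by apply/funext => c; rewrite -expseqS mulKf // pnatr_eq0.
apply: poly_boundedZ; apply: poly_bounded_sum => j _; apply: poly_boundedM.
  by apply: poly_boundedB; [exact: poly_bounded_cst | exact: poly_bounded_cycle_trace].
by apply: IH; rewrite ltnS leq_subr.
Qed.

(** The recursion of [expseq] expresses [(k+1) h_(k+1)] through the traces, and the Stein identity
    replaces each trace by shifts. By [telescope_shiftseq] the shifted coefficients recombine into
    [h_(k-i)], so that only a difference of [f] remains. *)
Lemma mean_hcoef_rec k f : (k < K)%N -> poly_bounded f ->
  k.+1%:R * mean (fun c => hcoef k.+1 c * f c) =
  \sum_(i < K | (i <= k)%N) d%:R ^+ i.+1 *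
     mean (fun c => hcoef (k - i) c * (f c - f (add_one i c))).
Proof.
move=> kK bf; have bh j := poly_bounded_hcoef j.
have bhf j : poly_bounded (fun c => hcoef j c * f c) by exact: poly_boundedM.
have bhfa (i : 'I_K) j : poly_bounded (fun c => hcoef j c * f (add_one i c)).
  by apply: poly_boundedM => //; exact: poly_bounded_add_one.
have bct j : poly_bounded (fun c => (cycle_trace j c)%:R) by exact: poly_bounded_cycle_trace.
rewrite -meanZ //.
transitivity (mean (fun c => \sum_(j < k.+1) (d%:R ^+ j.+1 * (hcoef (k - j) c * f c) -
    (cycle_trace j.+1 c)%:R * (hcoef (k - j) c * f c)))).
  apply: eq_mean => c; rewrite mulrA expseqS mulr_suml.
  by apply: eq_bigr => j _; rewrite -mulrA mulrBl.
rewrite mean_sum; last first.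
  by move=> j _; apply: poly_boundedB; [exact: poly_boundedZ | exact: poly_boundedM].
under eq_bigr => j _.
  rewrite meanB; [|exact: poly_boundedZ|exact: poly_boundedM].
  rewrite meanZ // mean_trace_stein //.
  over.
rewrite /= sumrB (exchange_big_dep xpredT) //=.
have -> : \sum_(i < K | (i <= k)%N) d%:R ^+ i.+1 *
     mean (fun c => hcoef (k - i) c * (f c - f (add_one i c))) =
   \sum_(i < K | (i <= k)%N) d%:R ^+ i.+1 * mean (fun c => hcoef (k - i) c * f c) -
   \sum_(i < K | (i <= k)%N) d%:R ^+ i.+1 * mean (fun c => hcoef (k - i) c * f (add_one i c)).
  rewrite -sumrB; apply: eq_bigr => i _; rewrite -mulrBr -meanB //.
  by congr (_ * _); apply: eq_mean => c; rewrite mulrBr.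
congr (_ - _).
  by rewrite (big_ord_widen _ (fun i => d%:R ^+ i.+1 * mean (fun c => hcoef (k - i) c * f c)) kK).
rewrite [RHS]big_mkcond; apply: eq_bigr => i _.
rewrite -mulr_sumr -mean_sum; last first.
  by move=> j _; apply: (poly_bounded_add_one i (bhf _)).
rewrite (@eq_mean _ (fun c => shiftseq i.+1 (hcoef^~ c) k.+1 * f (add_one i c))); last first.
  move=> c; rewrite -mulr_suml; congr (_ * _).
  have := @telescope_shiftseq R (hcoef^~ c) i.+1 1 k isT; rewrite mul1r => <-.
  rewrite big_mkcond; apply: eq_bigr => j _; rewrite hcoef_add_one mul1r expr1n.
  by case: ifP => _; rewrite ?mul1r ?mul0r.
rewrite /shiftseq ltnS subSS; case: ifP => // _.
rewrite (@eq_mean _ (fun=> 0)) ?mean_cst ?mulr0 // => c.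
by rewrite mul0r.
Qed.

(** For [f = h_m] the difference of [f] and its shift by [add_one i] is again a coefficient of [h],
    so the recursion lowers both indices by [i.+1]. On the diagonal each of the [k.+1] terms equals
    [d^(k+1)]. *)
Lemma mean_hcoef_ortho k m : (k <= K)%N -> (m <= K)%N ->
  mean (fun c => hcoef k c * hcoef m c) = if k == m then d%:R ^+ k else 0.
Proof.
have rec k' m' : (k' < K)%N -> k'.+1%:R * mean (fun c => hcoef k'.+1 c * hcoef m' c) =
    \sum_(i < K | (i <= k')%N) d%:R ^+ i.+1 *
      (if (i < m')%N then mean (fun c => hcoef (k' - i) c * hcoef (m' - i.+1) c) else 0).
  move=> k'K; rewrite mean_hcoef_rec //; last exact: poly_bounded_hcoef.
  apply: eq_bigr => i _; congr (_ * _); case: ifP => im.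
    by apply: eq_mean => c; rewrite hcoef_add_one subKr /shiftseq im.
  rewrite -[RHS]mean_cst; apply: eq_mean => c.
  by rewrite hcoef_add_one subKr /shiftseq im mulr0.
have zero k' : (k' < K)%N -> mean (fun c => hcoef k'.+1 c * hcoef 0 c) = 0.
  move=> k'K; apply: (@mulfI _ k'.+1%:R); first by rewrite pnatr_eq0.
  by rewrite rec // mulr0 big1 // => i _; rewrite mulr0.
elim/ltn_ind: k m => -[_ [_ _|m _ mK]|k IH m kK mK].
- by rewrite eqxx expr0 -[RHS]mean_cst; apply: eq_mean => c; rewrite /hcoef expseq0 mulr1.
- by rewrite -[RHS](zero m mK); apply: eq_mean => c; rewrite mulrC.
apply: (@mulfI _ k.+1%:R); first by rewrite pnatr_eq0.
rewrite rec // (eq_bigr (fun=> if k.+1 == m then d%:R ^+ k.+1 else 0)); last first.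
  move=> i ik; case: ifPn => im; last first.
    by case: eqP im => [<-|_ _]; rewrite ?ltnS ?ik ?mulr0.
  rewrite IH ?ltnS ?leq_subr //; [|by lia..].
  rewrite (_ : (k - i == m - i.+1) = (k.+1 == m))%N; last by lia.
  by case: ifP => _; rewrite ?mulr0 // -exprD addSn subnKC.
rewrite -(big_ord_widen _ (fun=> if k.+1 == m then d%:R ^+ k.+1 else 0) kK) /=.
by rewrite sumr_const card_ord mulr_natl.
Qed.

Definition gcoef k c : R := expseq (fun j => - (cycle_trace j c)%:R) k.

Lemma gcoefE k c : gcoef k c = hcoef k c - d%:R * shiftseq 1 (hcoef^~ c) k.
Proof.
rewrite -[RHS](@expseq_shift R (fun j => d%:R ^+ j - (cycle_trace j c)%:R) 1) //.
apply: (@eq_expseq _ _ _ k) => // j _.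
by rewrite dvd1n divn1 mul1r addrAC subrr add0r.
Qed.

Lemma poly_bounded_gcoef k : poly_bounded (gcoef k).
Proof.
rewrite (_ : gcoef k = fun c => hcoef k c - d%:R * shiftseq 1 (hcoef^~ c) k); last first.
  by apply/funext => c; rewrite gcoefE.
apply: poly_boundedB; first exact: poly_bounded_hcoef.
apply: poly_boundedZ; rewrite /shiftseq; case: (1 <= k)%N.
  exact: poly_bounded_hcoef.
exact: poly_bounded_cst.
Qed.

(** Since [g_k = h_k - d h_(k-1)] with orthogonal terms, the mean for [k > 0] is
    [d^k + d^2 d^(k-1)]. *)
Lemma mean_gcoef_sqr k : (k <= K)%N ->
  mean (fun c => gcoef k c ^+ 2) <= d%:R ^+ k * (1 + d%:R).
Proof.
case: k => [_|k kK].
  rewrite (@eq_mean _ (fun=> 1)) ?mean_cst ?expr0 ?mul1r ?lerDl // => c.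
  by rewrite /gcoef expseq0 expr1n.
have bhh i j : poly_bounded (fun c => hcoef i c * hcoef j c).
  by apply: poly_boundedM; exact: poly_bounded_hcoef.
rewrite (@eq_mean _ (fun c => (hcoef k.+1 c * hcoef k.+1 c -
    2 * d%:R * (hcoef k.+1 c * hcoef k c)) + d%:R ^+ 2 * (hcoef k c * hcoef k c))); last first.
  by move=> c; rewrite gcoefE /shiftseq /= subn1 /=; ring.
rewrite meanD ?meanB ?meanZ //; last 3 first.
- exact: poly_boundedZ.
- by apply: poly_boundedB => //; exact: poly_boundedZ.
- exact: poly_boundedZ.
rewrite !mean_hcoef_ortho // ?(ltnW kK) // !eqxx.
rewrite (_ : (k.+1 == k) = false) ?mulr0 ?subr0; last by lia.
by rewrite mulrDr mulr1 lerD2l -exprD -exprSr addnC addn2.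
Qed.

Lemma mean_cycle_trace j : mean (fun c => (cycle_trace j c)%:R) =
  \sum_(i < K | (i.+1 %| j)%N) d%:R ^+ i.+1.
Proof.
rewrite (@eq_mean _ (fun c => (cycle_trace j c)%:R * 1)); last by move=> c; rewrite mulr1.
rewrite mean_trace_stein ?mean_cst; last exact: poly_bounded_cst.
by under eq_bigr do rewrite mulr1.
Qed.

(** Applying the Stein identity to the centred trace leaves only the jumps: the variance is the sum
    of [i d^i] over the divisors [i] of [j]. *)
Lemma variance_cycle_trace j : (0 < j <= K)%N ->
  mean (fun c => ((cycle_trace j c)%:R - \sum_(i < K | (i.+1 %| j)%N) d%:R ^+ i.+1) ^+ 2)
  <= j%:R ^+ 2 * d%:R ^+ j.
Proof.
move=> /andP[j0 jK]; set a := \sum_(i < K | _) _.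
have bT : poly_bounded (fun c => (cycle_trace j c)%:R) by exact: poly_bounded_cycle_trace.
have bTa : poly_bounded (fun c => (cycle_trace j c)%:R - a).
  by apply: poly_boundedB => //; exact: poly_bounded_cst.
have mTa : mean (fun c => (cycle_trace j c)%:R - a) = 0.
  by rewrite meanB ?mean_cst ?mean_cycle_trace ?subrr //; exact: poly_bounded_cst.
rewrite (@eq_mean _ (fun c => (cycle_trace j c)%:R * ((cycle_trace j c)%:R - a) -
   a * ((cycle_trace j c)%:R - a))); last by move=> c; rewrite expr2 mulrBl.
rewrite meanB ?meanZ //; last 2 first.
- exact: poly_boundedM.
- exact: poly_boundedZ.
rewrite mTa mulr0 subr0 mean_trace_stein //.
rewrite (eq_bigr (fun i : 'I_K => d%:R ^+ i.+1 * i.+1%:R)); last first.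
  move=> i ij; congr (_ * _).
  rewrite (@eq_mean _ (fun c => ((cycle_trace j c)%:R - a) + i.+1%:R)); last first.
    by move=> c; rewrite cycle_trace_add_one ij natrD; ring.
  by rewrite meanD ?mTa ?mean_cst ?add0r //; exact: poly_bounded_cst.
apply: (@le_trans _ _ (\sum_(i < K | (i < j)%N) d%:R ^+ j * j%:R)).
  rewrite big_mkcond [leRHS]big_mkcond; apply: ler_sum => i _.
  case: ifP => ij; last by case: ifP => // _; rewrite mulr_ge0 // exprn_ge0.
  have ij' := dvdn_leq j0 ij; rewrite ij' ler_pM ?exprn_ge0 ?ler_nat //.
  by rewrite ler_weXn2l // ler1n.
rewrite -(big_ord_widen _ (fun=> d%:R ^+ j * j%:R) jK) /= sumr_const card_ord.
by rewrite -[_ *+ j]mulr_natl mulrCA expr2 mulrC.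
Qed.

End PoissonMoments.

(** * Tail estimates and expectations of random series *)

Section Probability.
Context (R : realType) (dT : measure_display) (T : measurableType dT) (P : probability T R).

Lemma measurable_gt_normr (X : T -> R) b : measurable_fun setT X ->
  measurable [set w | b < `|X w|].
Proof.
move=> mX; have mN : measurable_fun setT (fun w => `|X w|) by exact: measurableT_comp.
rewrite (_ : [set w | _] = (fun w => `|X w|) @^-1` `]b, +oo[).
  by rewrite -[X in measurable X]setTI; exact: mN.
by apply/seteqP; split => w; rewrite /preimage /= in_itv /= andbT.
Qed.

Lemma tail_probability (X : T -> R) b M : measurable_fun setT X -> 0 < b ->
  (\int[P]_w (X w ^+ 2)%:E <= M%:E)%E ->
  (P [set w | (b < `|X w|)%R] <= (M / b ^+ 2)%:E)%E.
Proof.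
move=> mX b0 XM; set A := [set w | _]; have mA : measurable A by exact: measurable_gt_normr.
have mX2 : measurable_fun setT (fun w => (X w ^+ 2)%:E).
  by apply/measurable_EFinP; exact: measurable_funX.
have h : ((b ^+ 2)%:E * P A <= M%:E)%E.
  rewrite -integral_cst // (le_trans _ XM) //.
  apply: (@le_trans _ _ (\int[P]_(w in A) (X w ^+ 2)%:E)%E); last first.
    by apply: ge0_subset_integral => // w _; rewrite lee_fin sqr_ge0.
  apply: ge0_le_integral => //.
  - by move=> w _; rewrite /cst /= lee_fin sqr_ge0.
  - exact: measurable_funTS.
  - move=> w /= bw; rewrite lee_fin -[leRHS]real_normK ?num_real //.
    by rewrite lerXn2r ?nnegrE ?(ltW b0) // ltW.
have PA : P A \is a fin_num by exact: fin_num_measure.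
move: h; rewrite -(fineK PA) -EFinM !lee_fin => h.
by rewrite ler_pdivlMr ?exprn_gt0 // mulrC.
Qed.

(** The inverses of [(k+1)(k+2)] telescope to at most 1. Chebyshev's bound leaves a further factor
    [e / (M k (k+1) (k+2))], which is at most 1 because [M k >= 1] and [e <= 1]. *)
Lemma union_tail_probability (x : nat -> T -> R) (M : nat -> R) (e : R) :
  (forall k, measurable_fun setT (x k)) ->
  (forall k, \int[P]_w (x k w ^+ 2)%:E <= (M k)%:E)%E ->
  (forall k, 1 <= M k) -> 0 < e <= 1 ->
  (P (\bigcup_k [set w | (M k * (k.+1 * k.+2)%:R / e < `|x k w|)%R]) <= e%:E)%E.
Proof.
move=> mx xM M1 /andP[e0 e1]; have M0 k : 0 < M k by exact: lt_le_trans (M1 k).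
set F := fun k => [set w | _].
have mF k : measurable (F k) by exact: measurable_gt_normr.
have mU : measurable (\bigcup_k F k) by exact: bigcup_measurable.
have sub : \bigcup_k F k `<=` \bigcup_k F k by [].
apply: le_trans (measure_sigma_subadditive P mF mU sub) _.
apply: lime_le; first exact: is_cvg_nneseries.
apply: nearW => n.
have FE k : (P (F k) <= (e * (k.+1%:R^-1 - k.+2%:R^-1))%:E)%E.
  have b0 : 0 < M k * (k.+1 * k.+2)%:R / e by rewrite divr_gt0 ?mulr_gt0 ?ltr0n.
  apply: (le_trans (tail_probability (mx k) b0 (xM k))).
  have k1 : 0 < k.+1%:R :> R by rewrite ltr0n.
  have k2 : 0 < k.+2%:R :> R by rewrite ltr0n.
  rewrite lee_fin natrM.
  have -> : k.+1%:R^-1 - k.+2%:R^-1 = (k.+1%:R * k.+2%:R)^-1 :> R.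
    have -> : k.+2%:R = k.+1%:R + 1 :> R by rewrite natr1.
    have k0 := ler0n R k; field.
    by rewrite !lt0r_neq0 //; lra.
  set N := k.+1%:R * k.+2%:R; have N0 : 0 < N by rewrite mulr_gt0.
  have N1 : 1 <= N by rewrite /N -natrM ler1n.
  have -> : M k / (M k * N / e) ^+ 2 = (e / N) * (e / (M k * N)).
    by field; rewrite !lt0r_neq0 ?M0.
  rewrite ler_piMr ?divr_ge0 ?(ltW e0) ?(ltW N0) //.
  rewrite ler_pdivrMr ?mulr_gt0 // mul1r (le_trans e1) //.
  by rewrite (le_trans (M1 k)) // ler_peMr // ltW.
apply: (@le_trans _ _ (\sum_(0 <= k < n) (e * (k.+1%:R^-1 - k.+2%:R^-1))%:E)%E).
  by apply: lee_sum => k _; exact: FE.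
rewrite sumEFin lee_fin -mulr_sumr ler_piMr ?(ltW e0) //.
rewrite (@telescope_sumr_eq R 0%N n (fun k => - k.+1%:R^-1)) //; last first.
  by move=> k _; rewrite opprK addrC.
by rewrite opprK invr1 addrC gerBl invr_ge0.
Qed.

(** Dominated convergence: the sum of the [|u k|] has finite integral by the geometric bound, and it
    dominates all partial sums. *)
Lemma expectation_series (u : nat -> T -> R) (V : T -> R) C r :
  (forall k, measurable_fun setT (u k)) -> 0 <= C -> 0 <= r < 1 ->
  (forall k, \int[P]_w (`|u k w|)%:E <= (C * r ^+ k)%:E)%E ->
  (forall k, \int[P]_w (u k.+1 w)%:E = 0)%E ->
  (forall w, series (u^~ w) n @[n --> \oo] --> V w) ->
  P.-integrable setT (EFin \o V) /\
  (\int[P]_w (V w)%:E = \int[P]_w (u 0%N w)%:E)%E.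
Proof.
move=> mu C0 /andP[r0 r1] uC u0 uV.
have mau k : measurable_fun setT (fun w => (`|u k w|)%:E).
  by apply/measurable_EFinP; exact: measurableT_comp.
have iu k : P.-integrable setT (EFin \o u k).
  apply/integrableP; split; first exact/measurable_EFinP.
  by apply: le_lt_trans (uC k) _; rewrite ltry.
pose g w : \bar R := (\sum_(0 <= k <oo) (`|u k w|)%:E)%E.
have mg : measurable_fun setT g.
  by apply: ge0_emeasurable_sum => // k w _; rewrite lee_fin.
have g0 w : (0 <= g w)%E by apply: nneseries_ge0 => k _ _; rewrite lee_fin.
have ig : P.-integrable setT g.
  apply/integrableP; split=> //.
  under eq_integral do rewrite gee0_abs //.
  rewrite /g integral_nneseries //.
  apply: (@le_lt_trans _ _ (\sum_(0 <= k <oo) (C * r ^+ k)%:E)%E).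
    by apply: lee_nneseries => k _; rewrite ?integral_ge0.
  apply: (@le_lt_trans _ _ (C / (1 - r))%:E); last exact: ltry.
  apply: lime_le.
    by apply: is_cvg_nneseries => k _ _; rewrite lee_fin mulr_ge0 // exprn_ge0.
  apply: nearW => n; rewrite sumEFin lee_fin -mulr_sumr ler_wpM2l //.
  rewrite big_mkord -[leRHS]mul1r ler_pdivlMr ?subr_gt0 // mulrC -opprB mulNr -subrX1.
  by rewrite opprB gerBl exprn_ge0.
pose S n w : \bar R := (series (u^~ w) n)%:E.
have SE n w : S n w = (\sum_(0 <= k < n) (u k w)%:E)%E by rewrite sumEFin.
have mS n : measurable_fun setT (S n).
  apply/measurable_EFinP; rewrite /series /=.
  by apply: measurable_sum => k.
have mV : measurable_fun setT (fun w => (V w)%:E).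
  apply/measurable_EFinP; apply: (measurable_fun_cvg (h := fun n w => series (u^~ w) n)).
    by move=> n; apply/measurable_EFinP; exact: mS.
  by move=> w _; exact: uV.
have [||iV _ cV] := dominated_convergence measurableT mS mV _ ig.
- apply: aeW => w _; apply: cvg_EFin; [exact: nearW | exact: uV].
- apply: aeW => w n _; rewrite SE (le_trans (lee_abs_sum _ _ _)) //.
  by apply: (@nneseries_lim_ge R (fun k => (`|u k w|)%:E) xpredT 0 n) => k _ _; rewrite lee_fin.
split=> //; apply/esym; apply: (@cvg_unique _ _ _ _ _ _ _ cV) => //.
apply: cvg_near_cst; exists 1%N => // -[//|n] _ /=.
under eq_integral do rewrite SE.
rewrite integral_sum //.
rewrite big_nat_recl //= big1_seq ?adde0 // => k _; exact: u0.
Qed.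

End Probability.

(** * The limiting random function *)

Lemma big_divisors (V : nmodType) (F : nat -> V) j K : (0 < j <= K)%N ->
  \sum_(l <- divisors j) F l = \sum_(i < K | (i.+1 %| j)%N) F i.+1.
Proof.
move=> /andP[j0 jK].
have pe : perm_eq (divisors j) [seq l <- index_iota 1 K.+1 | (l %| j)%N].
  apply: uniq_perm; rewrite ?divisors_uniq ?filter_uniq ?iota_uniq // => l.
  rewrite -dvdn_divisors // mem_filter mem_index_iota; case lj: (l %| j)%N => //=.
  by rewrite (dvdn_gt0 j0 lj) ltnS (leq_trans (dvdn_leq j0 lj) jK).
by rewrite (perm_big _ pe) big_filter big_add1 /= big_mkord.
Qed.

Lemma cexpD (R : realType) (a b : R[i]) : cexp (a + b) = cexp a * cexp b.
Proof.
case: a => a a'; case: b => b b'; rewrite /cexp /=.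
by apply: complex_ext; rewrite ?ReM ?ImM /= expRD ?cosD ?sinD; ring.
Qed.

Lemma cexp_neq0 (R : realType) (a : R[i]) : cexp a != 0.
Proof.
apply/eqP => a0; have : cexp a * cexp (- a) = 0 by rewrite a0 mul0r.
rewrite -cexpD subrr => /(congr1 (@complex.Re R)) /=.
by rewrite expR0 cos0 mul1r => /eqP; rewrite oner_eq0.
Qed.

Lemma tame_natSmul (R : realType) (a : nat -> R) : tame a -> tame (fun k => k.+1%:R * a k).
Proof.
move=> ta; have := tameD (tame_natmul ta) ta; congr tame; apply/funext => k.
by rewrite -natr1 mulrDl mul1r.
Qed.

Lemma tame_mulX (R : realType) (a : nat -> R) : tame a ->
  tame (fun k => if k is k'.+1 then a k' else 0).
Proof.
move=> ta r r01; have [r0 r1] := andP r01; have [M MP] := ta r r01.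
have M0 : 0 <= M by apply: le_trans (MP 0%N); rewrite mulr_ge0 // exprn_ge0.
exists M => -[|k]; first by rewrite normr0 mul0r.
by rewrite exprS mulrCA (le_trans _ (MP k)) // ler_piMl ?mulr_ge0 ?exprn_ge0 // ltW.
Qed.

Lemma tame_cst (R : realType) (c : R) : tame (fun=> c).
Proof.
have := tameZ c (tame_pow (c := 1 : R) _); rewrite normr1 => /(_ (lexx _)).
by congr tame; apply/funext => k; rewrite expr1n mulr1.
Qed.

Lemma cvg_tame (R : realType) (a : nat -> R) :
  (forall z : R[i], normc z < 1 -> cvgn (fun n => \sum_(0 <= k < n) (a k)%:C * z ^+ k)) ->
  tame a.
Proof.
move=> h r /andP[r0 r1]; have nr : normc (r%:C) < 1 by rewrite normc_real ger0_norm.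
have /cvg_ex[l cl] := h _ nr.
have cR : series (fun k => a k * Re (r%:C ^+ k)) @ \oo --> Re l.
  rewrite (_ : series _ = fun n => Re (\sum_(0 <= k < n) (a k)%:C * r%:C ^+ k)).
    exact: (cvg_Re _ cl).
  by apply/funext => n; rewrite Re_partial.
have c0 := cvg_series_cvg_0 (cvgP _ cR).
have [M [_ /(_ (M + 1))]] := cvg_seq_bounded (cvgP _ c0).
rewrite ltrDl ltr01 => /(_ isT) MP; exists (M + 1) => k.
have := MP k I; rewrite /= -realC_pow /= normrM.
by rewrite [X in _ * X]ger0_norm // exprn_ge0.
Qed.

Section LimitFunction.
Context (R : realType) (dT : measure_display) (T : measurableType dT).
Context (P : probability T R) (d : nat) (L : nat -> {RV P >-> nat}).
Hypothesis d_gt0 : (0 < d)%N.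
Hypothesis L_poisson : forall l, (1 <= l)%N -> poisson_rv (d%:R ^+ l / l%:R) (L l).
Hypothesis L_indep : mutually_independent P [set l | (1 <= l)%N] (fun l => L l : T -> nat).

Let s : R := Num.sqrt d%:R.
Let s_gt0 : 0 < s. Proof. by rewrite sqrtr_gt0 ltr0n. Qed.
Let s_neq0 : s != 0. Proof. by rewrite lt0r_neq0. Qed.
Let sqr_s : s ^+ 2 = d%:R. Proof. by rewrite sqr_sqrtr. Qed.
Let s_ge1 : 1 <= s. Proof. by rewrite -sqrtr1 ler_sqrt ?ler1n. Qed.

Definition trace_rv j w : nat := (\sum_(l <- divisors j) l * L l w)%N.

Lemma trace_rvE j K w : (0 < j <= K)%N -> trace_rv j w = cycle_trace j (count_vec L K w).
Proof.
move=> jK; rewrite /trace_rv (big_divisors (fun l => l * L l w)%N jK).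
by apply: eq_bigr => i _; rewrite ffunE.
Qed.

Lemma expectation_L l : (0 < l)%N ->
  l%:R * fine 'E_P[fun w => (L l w)%:R : R]%E = d%:R ^+ l.
Proof.
case: l => // l _.
have := @mean_stein _ _ _ P d L d_gt0 L_poisson L_indep l.+1 ord_max (fun=> 1)
  (poly_bounded_cst _ 1).
rewrite mean_cst mulr1 /= => <-.
rewrite (@eq_mean _ _ _ P L _ _ (fun c => l.+1%:R * (c ord_max)%:R)); last first.
  by move=> c; rewrite mulr1.
rewrite (@meanZ _ _ _ P d L) //; last exact: poly_bounded_coord.
congr (_ * _); rewrite unlock /mean /Rintegral; congr fine.
by apply: eq_integral => w _; rewrite ffunE.
Qed.

Definition trace_mean k : R := \sum_(l <- divisors k) d%:R ^+ l.

(** The coefficient of [z^k] in [Y_d]; at [k = 0] the division by zero gives 0. *)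
Definition ycoef k w : R := ((trace_rv k w)%:R - trace_mean k) / (k%:R * s ^+ k).

Lemma Y_partialE w z n : Y_partial d L w z n = \sum_(0 <= k < n) (ycoef k w)%:C * z ^+ k.
Proof.
case: n => [|n]; first by rewrite /Y_partial !big_geq.
rewrite /Y_partial [RHS]big_ltn // {1}/ycoef mul0r invr0 mulr0 rmorph0 mul0r add0r.
apply: eq_big_nat => k /andP[k0 _].
rewrite (_ : \sum_(l <- _) _ = (trace_rv k w)%:R - trace_mean k); last first.
  rewrite natr_sum -sumrB; apply: eq_big_seq => l.
  rewrite -dvdn_divisors // => lk; rewrite /centered mulrBr expectation_L ?natrM //.
  exact: dvdn_gt0 lk.
rewrite /ycoef /sqrtd -/s [LHS]mulrC [LHS]mulrA [LHS]mulrAC; congr (_ * _).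
by rewrite rmorphM fmorphV rmorphM rmorphXn /= rmorph_nat.
Qed.

(** By [cvg_tame] and [cvg_psum], the event on which the series converges on the whole disc, that
    is, the case distinction of [Y_series]. *)
Definition good_event : set T := [set w | tame (ycoef^~ w)].

Definition ycoef_good k w : R := if `[< good_event w >] then ycoef k w else 0.

Lemma tame_ycoef_good w : tame (ycoef_good^~ w).
Proof.
rewrite /ycoef_good; case: asboolP => // _; exact: tame_cst.
Qed.

Lemma Y_seriesE w z : normc z < 1 -> Y_series d L w z = psum (ycoef_good^~ w) z.
Proof.
move=> z1; rewrite /Y_series.
have eqY z' : Y_partial d L w z' = fun n => \sum_(0 <= k < n) (ycoef k w)%:C * z' ^+ k.
  by apply/funext => n; exact: Y_partialE.
have -> : `[< forall z', unit_disc z' -> cvgn (Y_partial d L w z') >] = `[< good_event w >].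
  apply: asbool_equiv_eq; split=> [h|gw z' /unit_discE z'1].
    by apply: cvg_tame => z' z'1; rewrite -eqY; apply: h; exact/unit_discE.
  by rewrite eqY; apply/cvg_ex; eexists; exact: cvg_psum.
rewrite /ycoef_good; case: asboolP => gw.
  by rewrite eqY; apply/cvg_lim => //; exact: cvg_psum.
by rewrite (psum_finite (n := 0)) ?big_ord0.
Qed.

(** For [j > 0], the part of the mean due to the proper divisors of [j]. It separates [exp(- Y_d)],
    centred by the full mean, from the series of [hcoef], centred by [d^j] alone. *)
Definition mcoef j : R := (trace_mean j - d%:R ^+ j) / s ^+ j.

(** A proper divisor [l] of [j] is at most [j / 2], so that [d^l = s^(2 l) <= s^j], and there are at
    most [j] of them. *)
Lemma tame_mcoef : tame mcoef.
Proof.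
apply: (@tame_le _ _ (fun k => k.+1%:R * d%:R)); last exact/tame_natSmul/tame_cst.
case=> [|j].
  rewrite /mcoef /trace_mean big_cons big_nil addr0 expr1 expr0 divr1 mul1r ger0_norm.
    by rewrite [leRHS]ger0_norm // gerBl.
  by rewrite subr_ge0 ler1n.
rewrite /mcoef /trace_mean (@big_divisors _ _ j.+1 j.+1) ?leqnn //.
rewrite big_mkcond big_ord_recr /= dvdnn addrK -big_mkcond /=.
rewrite ger0_norm; last by rewrite divr_ge0 ?exprn_ge0 ?(ltW s_gt0) ?sumr_ge0 // => i _; rewrite exprn_ge0.
rewrite [leRHS]ger0_norm // ler_pdivrMr ?exprn_gt0 //.
apply: (@le_trans _ _ (\sum_(i < j) s ^+ j.+1)).
  rewrite big_mkcond; apply: ler_sum => i _; case: ifP => ij; last by rewrite exprn_ge0 // ltW.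
  rewrite -sqr_s -exprM ler_weXn2l //.
  have [q jq] := dvdnP ij; have := ltn_ord i; move: jq; case: q => [|[|q]]; nia.
rewrite sumr_const card_ord -[leLHS]mulr_natl ler_wpM2r ?exprn_ge0 ?(ltW s_gt0) //.
by rewrite -natrM ler_nat; nia.
Qed.

(** On [good_event] the exponents are [(d^j - T_j) / s^j], as the two centrings cancel. Elsewhere
    only the deterministic part remains, and the series stays tame. *)
Definition hcoef_good k w : R := expseq (fun j => - (j%:R * ycoef_good j w) - mcoef j) k.

Lemma tame_hcoef_good w : tame (hcoef_good^~ w).
Proof.
apply: tame_expseq; apply: tameD; apply: tameN; last exact: tame_mcoef.
by apply: tame_natmul; exact: tame_ycoef_good.
Qed.

(** Only the second factor is random. The first one will turn out to be the expectation of the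
    product. *)
Lemma cexp_Y w z : normc z < 1 -> cexp (- Y_series d L w z) =
  cexp (psum (fun j => mcoef j / j%:R) z) * psum (hcoef_good^~ w) z.
Proof.
move=> z1; have ty := tame_ycoef_good w.
have ta : tame (fun j => - (j%:R * ycoef_good j w) - mcoef j).
  by apply: tameD; apply: tameN; [exact: tame_natmul | exact: tame_mcoef].
rewrite Y_seriesE // -psumN // -(cexp_psum ta) // mulrC -cexpD -psumD //; last 2 first.
- exact: tame_div.
- exact/tame_div/tame_mcoef.
congr (cexp (psum _ z)); apply/funext => -[|j].
  by rewrite /ycoef_good /ycoef mul0r invr0 !mulr0 if_same addr0 oppr0.
by rewrite -[RHS]mulrDl subrK mulNr mulrAC divff ?mul1r // pnatr_eq0.
Qed.

Lemma hcoef_goodE K k w : (k <= K)%N -> good_event w ->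
  hcoef_good k w = @hcoef R d K k (count_vec L K w) / s ^+ k.
Proof.
move=> kK gw; rewrite -exprVn -expseq_scale; apply: (@eq_expseq _ _ _ k) => // j /andP[j0 jk].
rewrite /ycoef_good asboolT // /ycoef /mcoef -(@trace_rvE j K) ?j0 ?(leq_trans jk kK) //.
rewrite exprVn; field.
by rewrite expf_neq0 // pnatr_eq0 -lt0n.
Qed.

Definition limit_coef k w : R :=
  s^-1 * hcoef_good k w - (if k is k'.+1 then hcoef_good k' w else 0).

(** Multiplication by [1 - d X] turns [h] into [g], and at [X = z / s] this factor equals
    [s (1 / s - z)]. *)
Lemma limit_coefE K k w : (k <= K)%N -> good_event w ->
  limit_coef k w = @gcoef R K k (count_vec L K w) / s ^+ k.+1.
Proof.
move=> kK gw; rewrite /limit_coef (@gcoefE R d K).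
case: k kK => [|k] kK; rewrite !(@hcoef_goodE K) // ?(ltnW kK) //.
  by rewrite /shiftseq /= mulr0 !subr0 expr1 expr0 divr1 mulrC.
rewrite /shiftseq /= subn1 /= -sqr_s !exprS; field.
by rewrite s_neq0 expf_neq0.
Qed.

Lemma tame_limit_coef w : tame (limit_coef^~ w).
Proof.
apply: tameD; first by apply: tameZ; exact: tame_hcoef_good.
exact/tameN/tame_mulX/tame_hcoef_good.
Qed.

Lemma poly_mean_EFin K f : poly_bounded f ->
  (\int[P]_w (f (count_vec L K w))%:E = (@mean _ _ _ P L K f)%:E)%E.
Proof.
move=> bf; rewrite /mean /Rintegral fineK //.
by apply: integrable_fin_num => //; exact: (@integrable_poly _ _ _ P d).
Qed.

Lemma measurable_ycoef k : measurable_fun setT (ycoef k).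
Proof.
case: k => [|k].
  by rewrite (_ : ycoef 0 = fun=> 0) //; apply/funext => w; rewrite /ycoef mul0r invr0 mulr0.
rewrite (_ : ycoef k.+1 = fun w =>
  ((cycle_trace k.+1 (count_vec L k.+1 w))%:R - trace_mean k.+1) / (k.+1%:R * s ^+ k.+1)).
  exact: (measurable_fun_countable (@measurable_count_vec _ _ _ P L k.+1)
    (fun c => ((cycle_trace k.+1 c)%:R - trace_mean k.+1) / (k.+1%:R * s ^+ k.+1))).
by apply/funext => w; rewrite /ycoef (@trace_rvE k.+1 k.+1) ?leqnn.
Qed.

(** The variance of the trace is at most [k^2 d^k], the square of the normalisation [k s^k]. *)
Lemma ycoef_sqr k : (\int[P]_w (ycoef k w ^+ 2)%:E <= 1%:E)%E.
Proof.
case: k => [|k].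
  under eq_integral do rewrite /ycoef mul0r invr0 mulr0 expr0n /=.
  by rewrite integral0 lee_fin.
pose f (c : {ffun 'I_k.+1 -> nat}) : R :=
  ((cycle_trace k.+1 c)%:R - \sum_(i < k.+1 | (i.+1 %| k.+1)%N) d%:R ^+ i.+1) ^+ 2.
have bf : poly_bounded f.
  have b1 : poly_bounded (fun c : {ffun 'I_k.+1 -> nat} => (cycle_trace k.+1 c)%:R -
      \sum_(i < k.+1 | (i.+1 %| k.+1)%N) d%:R ^+ i.+1 : R).
    by apply: poly_boundedB; [exact: poly_bounded_cycle_trace | exact: poly_bounded_cst].
  exact: (poly_boundedM b1 b1).
pose N : R := k.+1%:R ^+ 2 * d%:R ^+ k.+1.
have N0 : 0 < N by rewrite mulr_gt0 ?exprn_gt0 ?ltr0n.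
have E w : (ycoef k.+1 w ^+ 2)%:E = (N^-1 * f (count_vec L k.+1 w))%:E.
  rewrite /ycoef (@trace_rvE k.+1 k.+1) ?leqnn // /trace_mean (@big_divisors _ _ k.+1 k.+1) ?leqnn //.
  by rewrite exprMn exprVn exprMn -exprM mulnC exprM sqr_s mulrC.
under eq_integral do rewrite E.
rewrite (poly_mean_EFin (poly_boundedZ _ bf)) lee_fin (@meanZ _ _ _ P d L) //.
rewrite mulrC ler_pdivrMr // mul1r.
by apply: (@variance_cycle_trace _ _ _ P d L); rewrite // leqnn.
Qed.

(** Tameness is tested at the radii [1 - 1 / (m+1)] with integer bounds, a countable combination of
    measurable events. *)
Lemma measurable_good_event : measurable good_event.
Proof.
pose rad m : R := 1 - m.+1%:R^-1.
have rad01 m : 0 <= rad m < 1.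
  rewrite subr_ge0 invf_le1 ?ltr0n // ler1n /= ltrBlDr ltrDl.
  by rewrite invr_gt0 ltr0n.
rewrite (_ : good_event = \bigcap_m \bigcup_M \bigcap_k
  ~` [set w | M%:R < `|ycoef k w * rad m ^+ k|]).
  apply: bigcap_measurable => // m _; apply: bigcup_measurable => M _.
  apply: bigcap_measurable => // k _; apply: measurableC; apply: measurable_gt_normr.
  by apply: measurable_funM => //; exact: measurable_ycoef.
apply/seteqP; split => w.
  move=> tw m _; have [M MP] := tw _ (rad01 m); exists (Num.Def.archi_bound `|M|) => // k _ /=.
  apply/negP; rewrite -leNgt normrM [X in _ * X]ger0_norm ?exprn_ge0 //; last by case/andP: (rad01 m).
  by rewrite (le_trans (MP k)) // (le_trans (ler_norm _)) // ltW // archi_boundP.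
move=> h r /andP[r0 r1].
pose m := Num.Def.archi_bound (1 - r)^-1.
have [M _ MP] := h m I.
exists M%:R => k; have := MP k I; move/negP; rewrite -leNgt => {}MP.
rewrite (le_trans _ MP) // [leRHS]normrM ler_wpM2l //.
rewrite [leRHS]ger0_norm ?exprn_ge0 //; last by case/andP: (rad01 m).
rewrite lerXn2r ?nnegrE //; first by case/andP: (rad01 m).
rewrite lerBrDr -lerBrDl invf_ple ?posrE ?subr_gt0 ?ltr0n //.
rewrite ltW // (lt_le_trans (archi_boundP _)) ?invr_ge0 ?subr_ge0 ?(ltW r1) //.
by rewrite ler_nat leqnSn.
Qed.

(** Outside an event of probability at most [e'] the coefficients grow at most quadratically, hence
    are tame. *)
Lemma probability_good_event : P (~` good_event) = 0%E.
Proof.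
apply/eqP; rewrite eq_le measure_ge0 andbT; apply/lee_addgt0Pr => e e0; rewrite add0e.
pose e' := Num.min e 1; have e'01 : 0 < e' <= 1 by rewrite lt_min e0 ltr01 ge_min lexx orbT.
have := union_tail_probability (M := fun=> 1) measurable_ycoef ycoef_sqr (fun=> lexx 1) e'01.
set U := \bigcup_k _ => hU.
apply: (@le_trans _ _ (P U)); last by rewrite (le_trans hU) // lee_fin ge_min lexx.
apply: le_measure; rewrite ?inE.
- by apply: measurableC; exact: measurable_good_event.
- by apply: bigcup_measurable => k _; apply: measurable_gt_normr; exact: measurable_ycoef.
move=> w /= ngw; apply: contrapT => nU; apply: ngw.
apply: (@tame_le _ _ (fun k => k.+1%:R * (k.+2%:R * e'^-1))).
  move=> k; rewrite leNgt; apply/negP => big; apply: nU; exists k => //=.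
  apply: le_lt_trans big; rewrite mul1r natrM -mulrA ler_norm //.
have tS : tame (fun k => k.+2%:R * e'^-1).
  have := tameD (tame_natSmul (tame_cst e'^-1)) (tame_cst e'^-1).
  by congr tame; apply/funext => k; rewrite -[in RHS]natr1 mulrDl mul1r.
exact: tame_natSmul.
Qed.

(** The coefficients up to [K] depend on finitely many Poisson variables and on membership in
    [good_event]. Recording both gives a countable valued variable, all of whose functions are
    measurable. *)
Definition flag_vec K w : bool * {ffun 'I_K -> nat} := (`[< good_event w >], count_vec L K w).

Lemma measurable_flag_vec K c : measurable (flag_vec K @^-1` [set c]).
Proof.
case: c => b c; rewrite (_ : _ @^-1` _ =
  (if b then good_event else ~` good_event) `&` (count_vec L K @^-1` [set c])).
  apply: measurableI; last exact: measurable_count_vec.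
  by case: b; [|apply: measurableC]; exact: measurable_good_event.
apply/seteqP; split => w; rewrite /preimage /flag_vec /=.
  by move=> [<- ->]; split => //; case: asboolP.
by move=> [gw ->]; congr (_, _); case: b gw => gw; [exact: asboolT | exact: asboolF].
Qed.

Definition hcoef_flag K k (c : bool * {ffun 'I_K -> nat}) : R :=
  if c.1 then @hcoef R d K k c.2 / s ^+ k else expseq (fun j => - mcoef j) k.

Lemma hcoef_goodP K k w : (k <= K)%N -> hcoef_good k w = hcoef_flag k (flag_vec K w).
Proof.
move=> kK; rewrite /hcoef_flag /flag_vec /=; case: asboolP => gw; first exact: hcoef_goodE.
apply: (@eq_expseq _ _ _ k) => // j _.
by rewrite /ycoef_good asboolF // mulr0 oppr0 add0r.
Qed.

Lemma measurable_hcoef_good k : measurable_fun setT (hcoef_good k).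
Proof.
rewrite (_ : hcoef_good k = fun w => hcoef_flag k (flag_vec k w)).
  exact: (measurable_fun_countable (@measurable_flag_vec k)).
by apply/funext => w; rewrite (@hcoef_goodP k).
Qed.

Lemma ae_good (f : T -> R) K (g : {ffun 'I_K -> nat} -> R) : measurable_fun setT f ->
  (forall w, good_event w -> f w = g (count_vec L K w)) ->
  (\int[P]_w (f w)%:E = \int[P]_w (g (count_vec L K w))%:E)%E.
Proof.
move=> mf fg; apply: ae_eq_integral => //.
- exact/measurable_EFinP.
- apply/measurable_EFinP.
  exact: (measurable_fun_countable (@measurable_count_vec _ _ _ P L K)).
- exists (~` good_event); split.
  + exact/measurableC/measurable_good_event.
  + exact: probability_good_event.
  + move=> w /= nfg gw; apply: nfg => _ /=; congr EFin; exact: fg.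
Qed.

(** [|x| <= (1 + x^2) / 2], and the scaled coefficient has second moment 1 by orthogonality. *)
Lemma hcoef_good_abs k : (\int[P]_w (`|hcoef_good k w|)%:E <= 1%:E)%E.
Proof.
pose f (c : {ffun 'I_k -> nat}) : R := `|@hcoef R d k k c / s ^+ k|.
pose g (c : {ffun 'I_k -> nat}) : R :=
  2^-1 + 2^-1 * (d%:R ^+ k)^-1 * (@hcoef R d k k c * @hcoef R d k k c).
have mh : measurable_fun setT (fun w => `|hcoef_good k w|).
  by apply: measurableT_comp => //; exact: measurable_hcoef_good.
rewrite (@ae_good _ k f mh); last by move=> w gw; rewrite (@hcoef_goodE k).
have bh := @poly_bounded_hcoef R d k k.
have bhh : poly_bounded (fun c => @hcoef R d k k c * @hcoef R d k k c) by exact: poly_boundedM.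
have bg : poly_bounded g.
  by apply: poly_boundedD; [exact: poly_bounded_cst | exact: poly_boundedZ].
apply: (@le_trans _ _ (\int[P]_w (g (count_vec L k w))%:E)%E).
  apply: ge0_le_integral => //.
  - by move=> w _; rewrite lee_fin /f normr_ge0.
  - by apply/measurable_EFinP; exact: (measurable_fun_countable (@measurable_count_vec _ _ _ P L k)).
  - by apply/measurable_EFinP; exact: (measurable_fun_countable (@measurable_count_vec _ _ _ P L k)).
  - move=> w _; rewrite lee_fin /f /g; set x := hcoef _ _ _ _.
    have -> : 2^-1 * (d%:R ^+ k)^-1 * (x * x) = 2^-1 * `|x / s ^+ k| ^+ 2.
      by rewrite real_normK ?num_real // exprMn exprVn -exprM mulnC exprM sqr_s expr2; ring.
    by have := sqr_ge0 (`|x / s ^+ k| - 1); rewrite sqrrB expr1n mulr1; lra.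
rewrite poly_mean_EFin // lee_fin.
rewrite (@meanD _ _ _ P d L) ?mean_cst ?(@meanZ _ _ _ P d L) //; last 2 first.
- exact: poly_bounded_cst.
- exact: poly_boundedZ.
rewrite (mean_hcoef_ortho d_gt0 L_poisson L_indep) // eqxx -mulrA mulVf; first by lra.
by rewrite expf_neq0 // pnatr_eq0 -lt0n.
Qed.

Lemma hcoef_good_mean k : (\int[P]_w (hcoef_good k.+1 w)%:E = 0)%E.
Proof.
pose f (c : {ffun 'I_k.+1 -> nat}) : R :=
  (s ^+ k.+1)^-1 * (@hcoef R d k.+1 k.+1 c * @hcoef R d k.+1 0 c).
rewrite (@ae_good _ k.+1 f (measurable_hcoef_good _)); last first.
  by move=> w gw; rewrite (@hcoef_goodE k.+1) // /f {3}/hcoef expseq0 mulr1 mulrC.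
have bhh : poly_bounded (fun c => @hcoef R d k.+1 k.+1 c * @hcoef R d k.+1 0 c).
  by apply: poly_boundedM; exact: poly_bounded_hcoef.
rewrite poly_mean_EFin ?(@meanZ _ _ _ P d L) //; last exact: poly_boundedZ.
by rewrite (mean_hcoef_ortho d_gt0 L_poisson L_indep) // mulr0.
Qed.

Lemma limit_coef_sqr k : (\int[P]_w (limit_coef k w ^+ 2)%:E <= (1 + d%:R)%:E)%E.
Proof.
have ml : measurable_fun setT (fun w => limit_coef k w ^+ 2).
  apply: measurable_funX; apply: measurable_funB.
    by apply: measurable_funM => //; exact: measurable_hcoef_good.
  by case: k => [|k]; [exact: measurable_cst | exact: measurable_hcoef_good].
pose f (c : {ffun 'I_k -> nat}) : R := (d%:R ^+ k.+1)^-1 * (@gcoef R k k c ^+ 2).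
rewrite (@ae_good _ k f ml); last first.
  move=> w gw; rewrite (@limit_coefE k) // /f exprMn exprVn -exprM mulnC exprM sqr_s.
  by rewrite mulrC.
have bg : poly_bounded (fun c => @gcoef R k k c ^+ 2).
  have b1 := @poly_bounded_gcoef R d k k.
  exact: (poly_boundedM b1 b1).
rewrite poly_mean_EFin ?(@meanZ _ _ _ P d L) //; last exact: poly_boundedZ.
have dk : 0 < d%:R ^+ k.+1 :> R by rewrite exprn_gt0 // ltr0n.
rewrite lee_fin mulrC ler_pdivrMr //.
rewrite (le_trans (mean_gcoef_sqr d_gt0 L_poisson L_indep _)) // mulrC.
by rewrite ler_wpM2l ?addr_ge0 // ler_weXn2l // ler1n.
Qed.

Lemma expectation_hcoef_psum (f : R[i] -> R) z : (forall z', `|f z'| <= normc z') ->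
  normc z < 1 -> forall V : T -> R,
  (forall w, series (fun k => hcoef_good k w * f (z ^+ k)) n @[n --> \oo] --> V w) ->
  P.-integrable setT (EFin \o V) /\ (\int[P]_w (V w)%:E = (f 1)%:E)%E.
Proof.
move=> fle z1 V cV.
have mh := measurable_hcoef_good.
have r01 : 0 <= normc z < 1 by rewrite normc_ge0.
have mN k : measurable_fun setT (fun w => (`|hcoef_good k w|)%:E).
  by apply/measurable_EFinP; exact: measurableT_comp.
have bnd k : (\int[P]_w (`|hcoef_good k w * f (z ^+ k)|)%:E <= (1 * normc z ^+ k)%:E)%E.
  have -> : (fun w => (`|hcoef_good k w * f (z ^+ k)|)%:E) =
      (fun w => (`|f (z ^+ k)|)%:E * (`|hcoef_good k w|)%:E)%E.
    by apply/funext => w; rewrite normrM mulrC EFinM.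
  rewrite ge0_integralZl_EFin //.
  rewrite mulrC EFinM; apply: lee_pmul => //; last exact: hcoef_good_abs.
    by apply: integral_ge0 => w _; rewrite lee_fin.
  by rewrite lee_fin -normcX.
have zero k : (\int[P]_w (hcoef_good k.+1 w * f (z ^+ k.+1))%:E = 0)%E.
  under eq_integral do rewrite mulrC EFinM.
  rewrite integralZl ?hcoef_good_mean ?mule0 //.
  apply/integrableP; split; first exact/measurable_EFinP.
  by apply: le_lt_trans (hcoef_good_abs _) _; rewrite ltry.
have [|iV ->] := expectation_series (u := fun k w => hcoef_good k w * f (z ^+ k))
  _ ler01 r01 bnd zero cV.
  by move=> k; apply: measurable_funM.
split=> //; under eq_integral do rewrite /hcoef_good expseq0 mul1r expr0.
by rewrite integral_cst //= probability_setT mule1.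
Qed.

(** The random factor of [cexp_Y] has as expectation its constant term 1, because the other
    coefficients have mean zero. [lin] handles the product with the constant [u] in real and
    imaginary parts. *)
Lemma cexpectation_Y z : normc z < 1 ->
  cexpectation P (fun w => cexp (- Y_series d L w z)) = cexp (psum (fun j => mcoef j / j%:R) z).
Proof.
move=> z1; set u := cexp _.
have cRe w := cvg_psum_Re (tame_hcoef_good w) z1.
have cIm w := cvg_psum_Im (tame_hcoef_good w) z1.
have [iR eR] := expectation_hcoef_psum (@Re_le_normc R) z1
  (V := fun w => Re (psum (hcoef_good^~ w) z)) cRe.
have [iI eI] := expectation_hcoef_psum (@Im_le_normc R) z1
  (V := fun w => Im (psum (hcoef_good^~ w) z)) cIm.
have lin (a b : R) : fine (\int[P]_w (a * Re (psum (hcoef_good^~ w) z) +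
    b * Im (psum (hcoef_good^~ w) z))%:E)%E = a.
  under eq_integral do rewrite EFinD !EFinM.
  rewrite integralD //; [|exact: integrableZl..].
  by rewrite !integralZl // eR eI /= mulr1 mulr0 addr0.
rewrite /cexpectation unlock; apply: complex_ext => /=.
  rewrite -[RHS](lin (Re u) (- Im u)); congr fine; apply: eq_integral => w _.
  by congr EFin; have := congr1 (@complex.Re R) (cexp_Y w z1); rewrite -/u ReM -mulNr.
rewrite -[RHS](lin (Im u) (Re u)); congr fine; apply: eq_integral => w _.
by congr EFin; have := congr1 (@complex.Im R) (cexp_Y w z1); rewrite -/u ImM addrC.
Qed.

Lemma limit_funE w : limit_fun d L w = psum_disc (limit_coef^~ w).
Proof.
apply/funext => z; have z1 := normc_val z; have th := tame_hcoef_good w.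
rewrite /limit_fun /psum_disc cexpectation_Y // cexp_Y //.
rewrite [X in _ * X / _]mulrC mulrA mulfK ?cexp_neq0 // /sqrtd -/s.
rewrite /limit_coef psumB ?psumZ ?psumX //; [|exact: tameZ|exact: tame_mulX].
by rewrite mulrBl fmorphV.
Qed.

End LimitFunction.

(** * Convergence of the laws *)

(** Newton's identities are solved for [a] from the lowest degree upwards; the bound depends on
    [beta] and [K] only. *)
Lemma newton_bound (R : realType) (beta : nat -> R) K : exists M : nat,
  forall a : nat -> R, (forall k, (k <= K)%N -> `|expseq a k| <= beta k) ->
    forall j, (0 < j <= K)%N -> `|a j| <= M%:R.
Proof.
elim: K => [|K [M MP]]; first by exists 0%N => a _ j /andP[j0]; rewrite leqNgt j0.
pose B := K.+1%:R * `|beta K.+1| + \sum_(j < K) M%:R * `|beta (K - j)%N|.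
exists (maxn M (Num.Def.archi_bound B)) => a ab j /andP[j0].
have aM i : (0 < i <= K)%N -> `|a i| <= M%:R.
  by apply: MP => k kK; apply: ab; exact: leqW.
rewrite leq_eqVlt => /orP[/eqP -> {j j0}|]; last first.
  by rewrite ltnS => jK; rewrite (le_trans (aM j _)) ?j0 // ler_nat leq_maxl.
have := expseqS a K; rewrite big_ord_recr /= subnn expseq0 mulr1 => eK.
have -> : a K.+1 = K.+1%:R * expseq a K.+1 - \sum_(j < K) a j.+1 * expseq a (K - j).
  by rewrite eK addrAC subrr add0r.
have B0 : 0 <= B by rewrite addr_ge0 ?mulr_ge0 ?sumr_ge0 // => j _; rewrite mulr_ge0.
apply: (@le_trans _ _ B); last first.
  by rewrite ltW // (lt_le_trans (archi_boundP B0)) // ler_nat leq_maxr.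
rewrite (le_trans (ler_normB _ _)) // lerD //.
  by rewrite normrM ger0_norm // ler_wpM2l // (le_trans (ab _ _)) ?leqnn // ler_norm.
rewrite (le_trans (ler_norm_sum _ _ _)) // ler_sum // => j _.
rewrite normrM ler_pM ?aM //=.
by rewrite (le_trans (ab _ _)) ?ler_norm // (leq_trans (leq_subr _ _)).
Qed.

(** The sum is the integral of [h], equal to [Phi (tau w)] when [tau w] lies in the box [B] and to 0
    otherwise. The distance from [f] to [h] is at most [e] on [G] and at most [2 M] elsewhere. *)
Lemma expectation_compare (R : realType) (dT : measure_display) (T : measurableType dT)
    (P : probability T R) (C : countType) (tau : T -> C) (f : T -> R) (Phi : C -> R)
    (G : set T) (B : seq C) (M e : R) :
  (forall c, measurable (tau @^-1` [set c])) -> measurable_fun setT f -> measurable G ->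
  uniq B -> 0 <= M -> 0 <= e -> (forall w, `|f w| <= M) -> (forall c, `|Phi c| <= M) ->
  (P (~` G) <= e%:E)%E ->
  (forall w, G w -> tau w \in B /\ `|f w - Phi (tau w)| <= e) ->
  `|(\int[P]_w f w)%R - \sum_(c <- B) Phi c * fine (P (tau @^-1` [set c]))| <= e + 2 * M * e.
Proof.
move=> mtau mf mG uB M0 e0 fM PhiM PG GP.
have bounded_integrable (g : T -> R) N : measurable_fun setT g -> (forall w, `|g w| <= N) ->
    P.-integrable setT (EFin \o g).
  move=> mg gN; apply: (@le_integrable _ _ _ P setT _ _ (EFin \o (fun=> N))) => //.
  - exact/measurable_EFinP.
  - by move=> w _ /=; rewrite lee_fin (le_trans (gN w)) // ler_norm.
  - exact: finite_measure_integrable_cst.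
pose h w := if tau w \in B then Phi (tau w) else 0.
have mh : measurable_fun setT h.
  exact: (measurable_fun_countable mtau (fun c => if c \in B then Phi c else 0)).
have hM w : `|h w| <= M by rewrite /h; case: ifP => // _; rewrite normr0.
have ih := bounded_integrable _ _ mh hM; have if_ := bounded_integrable _ _ mf fM.
have mC c : measurable_fun setT (fun w => \1_(tau @^-1` [set c]) w : R).
  exact: measurable_indic.
have iC c : P.-integrable setT (EFin \o (fun w => Phi c * \1_(tau @^-1` [set c]) w)).
  apply: (bounded_integrable _ M); first exact: measurable_funM.
  move=> w; rewrite normrM (le_trans _ (PhiM c)) // ler_piMr //.
  by rewrite indicE; case: (_ \in _); rewrite ?normr1 ?normr0.
have -> : \sum_(c <- B) Phi c * fine (P (tau @^-1` [set c])) = (\int[P]_w h w)%R.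
  have hE w : h w = \sum_(c <- B) Phi c * \1_(tau @^-1` [set c]) w.
    rewrite /h; case: ifPn => wB.
      rewrite (bigD1_seq (tau w)) //= indicE mem_set // mulr1 big1 ?addr0 // => c cw.
      rewrite indicE memNset ?mulr0 // => /= wc; move: cw.
      by rewrite -wc eqxx.
    rewrite big1_seq // => c /= cB; rewrite indicE memNset ?mulr0 // => /= wc.
    by move: wB; rewrite wc cB.
  rewrite /Rintegral; under [in RHS]eq_integral do rewrite hE -sumEFin.
  rewrite integral_sum //.
  rewrite (eq_bigr (fun c => (Phi c * fine (P (tau @^-1` [set c])))%:E)) ?sumEFin // => c _.
  under eq_integral do rewrite EFinM.
  rewrite integralZl //; last first.
    apply: (bounded_integrable _ 1) => // w.
    by rewrite indicE; case: (_ \in _); rewrite ?normr1 ?normr0.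
  rewrite integral_indic // setIT EFinM fineK //.
  exact: fin_num_measure.
rewrite -RintegralB // (le_trans (le_normr_Rintegral _ _)) //.
  by apply: (bounded_integrable _ (M + M)); [exact: measurable_funB |
    move=> w; rewrite (le_trans (ler_normB _ _)) // lerD].
pose g w := e + 2 * M * \1_(~` G) w.
have mG' : measurable (~` G) by exact: measurableC.
have mg : measurable_fun setT (fun w => 2 * M * \1_(~` G) w).
  by apply: measurable_funM => //; exact: measurable_indic.
have ig' : P.-integrable setT (EFin \o (fun w => \1_(~` G) w : R)).
  apply: (bounded_integrable _ 1); first exact: measurable_indic.
  by move=> w; rewrite indicE; case: (_ \in _); rewrite ?normr1 ?normr0.
have ig2 : P.-integrable setT (EFin \o (fun w => 2 * M * \1_(~` G) w)).
  by have := integrableZl measurableT (2 * M) ig'; congr (_.-integrable).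
have ie : P.-integrable setT (EFin \o (fun=> e)) by exact: finite_measure_integrable_cst.
apply: (@le_trans _ _ (\int[P]_w g w)%R).
  apply: le_Rintegral => //.
  - apply: (bounded_integrable _ (M + M)); first by apply: measurableT_comp => //; exact: measurable_funB.
    by move=> w; rewrite normr_id (le_trans (ler_normB _ _)) // lerD.
  - by have := integrableD measurableT ie ig2; congr (_.-integrable).
  move=> w _; rewrite /g indicE; case: (pselect (G w)) => Gw.
    have [wB he] := GP w Gw; rewrite memNset; last by move=> /(_ Gw).
    by rewrite mulr0 addr0 /h wB.
  rewrite mem_set // mulr1 (le_trans (ler_normB _ _)) // (le_trans (lerD (fM w) (hM w))) //.
  by lra.
rewrite /g RintegralD // RintegralZl // Rintegral_cst //= probability_setT /= mulr1.
rewrite lerD2l ler_wpM2l ?mulr_ge0 // /Rintegral integral_indic // setIT.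
have PA : P (~` G) \is a fin_num by exact: fin_num_measure.
by rewrite -lee_fin fineK.
Qed.

Lemma cvg_fin_sum (R : realType) (I : Type) (r : seq I) (Q : pred I)
    (u : I -> nat -> R) (l : I -> R) :
  (forall i, Q i -> u i n @[n --> \oo] --> l i) ->
  \sum_(i <- r | Q i) u i n @[n --> \oo] --> \sum_(i <- r | Q i) l i.
Proof.
move=> h; elim: r => [|i r IH].
  rewrite big_nil (_ : (fun n => _) = fun=> 0); first exact: cvg_cst.
  by apply/funext => n; rewrite big_nil.
rewrite big_cons; case Qi: (Q i).
  rewrite (_ : (fun n => _) = fun n => u i n + \sum_(j <- r | Q j) u j n).
    by apply: cvgD IH; exact: h.
  by apply/funext => n; rewrite big_cons Qi.
by apply: cvg_trans IH; apply: near_eq_cvg; apply: nearW => n; rewrite big_cons Qi.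
Qed.

(** The recursion fixes a solution up to a scalar, so the laws are compared through the cross
    difference [D n t], which vanishes at [t = 0] and satisfies the recursion up to [O(1/n)]. If
    some [t k.+1] is positive, dividing by it expresses [D n t] by its values at smaller vectors; a
    negative entry makes both laws vanish. *)
Lemma stein_unique (R : realType) (d K : nat) (pn : nat -> (nat -> int) -> R)
    (pl : (nat -> int) -> R) (C : nat -> R) :
  (forall n t k, (0 < n)%N -> (k < K)%N ->
    `|(t k.+1)%:~R * pn n t - \sum_(l < K | (l.+1 %| k.+1)%N)
        d%:R ^+ l.+1 * pn n (cycle_shift l.+1 t)| <= C k / n%:R) ->
  (forall t k, (k < K)%N -> (t k.+1)%:~R * pl t =
     \sum_(l < K | (l.+1 %| k.+1)%N) d%:R ^+ l.+1 * pl (cycle_shift l.+1 t)) ->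
  (forall n t j, (j < K)%N -> t j.+1 < 0 -> pn n t = 0) ->
  (forall t j, (j < K)%N -> t j.+1 < 0 -> pl t = 0) ->
  (forall n t t', (forall j, (j < K)%N -> t j.+1 = t' j.+1) -> pn n t = pn n t') ->
  (forall t t', (forall j, (j < K)%N -> t j.+1 = t' j.+1) -> pl t = pl t') ->
  forall t, pn n t * pl (fun=> 0) - pl t * pn n (fun=> 0) @[n --> \oo] --> (0 : R).
Proof.
move=> Hn Hl Nn Nl En El.
pose D n t := pn n t * pl (fun=> 0) - pl t * pn n (fun=> 0).
have Dneg (t : nat -> int) : (exists2 j, (j < K)%N & t j.+1 < 0) -> (fun n => D n t) = fun=> 0.
  move=> [j jK tj]; apply/funext => n.
  by rewrite /D (Nn n t j) // (Nl t j) // !mul0r subrr.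
suff main N (t : nat -> int) : \sum_(j < K) `|t j.+1| <= N%:Z -> D n t @[n --> \oo] --> (0 : R).
  move=> t; pose S : int := \sum_(j < K) `|t j.+1|.
  by apply: (main (absz S)); rewrite -/S; lia.
elim: N t => [|N IH] t tN.
all: have [neg|/forall2NP nneg] := pselect (exists2 j, (j < K)%N & t j.+1 < 0);
  first (by rewrite Dneg //; exact: cvg_cst).
all: have t0 j : (j < K)%N -> 0 <= t j.+1
  by move=> jK; case: (nneg j) => // /negP; rewrite -leNgt.
all: have [[k kK tk]|/forall2NP zero] := pselect (exists2 k, (k < K)%N & 0 < t k.+1);
  last first.
- have tz j : (j < K)%N -> t j.+1 = 0.
    move=> jK; apply/eqP; rewrite eq_le t0 // andbT.
    by case: (zero j) => // /negP; rewrite -leNgt.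
  rewrite (_ : (fun n => D n t) = fun=> 0); first exact: cvg_cst.
  by apply/funext => n; rewrite /D (En n t (fun=> 0)) // (El t (fun=> 0)) // mulrC subrr.
- exfalso; move: tN; rewrite (bigD1 (Ordinal kK)) //=.
  have : 0 <= \sum_(i < K | i != Ordinal kK) `|t i.+1| by apply: sumr_ge0.
  by move=> h1; rewrite leNgt ltr_pwDl // normr_gt0 gt_eqF.
- have tz j : (j < K)%N -> t j.+1 = 0.
    move=> jK; apply/eqP; rewrite eq_le t0 // andbT.
    by case: (zero j) => // /negP; rewrite -leNgt.
  rewrite (_ : (fun n => D n t) = fun=> 0); first exact: cvg_cst.
  by apply/funext => n; rewrite /D (En n t (fun=> 0)) // (El t (fun=> 0)) // mulrC subrr.
have tk0 : (t k.+1)%:~R != 0 :> R by rewrite intr_eq0 gt_eqF.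
pose err n := (t k.+1)%:~R * pn n t - \sum_(l < K | (l.+1 %| k.+1)%N)
        d%:R ^+ l.+1 * pn n (cycle_shift l.+1 t).
have err0 : err n @[n --> \oo] --> (0 : R).
  apply/norm_cvg0P.
  have c1 : C k / n%:R @[n --> \oo] --> (0 : R).
    rewrite -(mulr0 (C k)); apply: cvgMr; rewrite -cvg_shiftS; exact: cvg_harmonic.
  apply: (@squeeze_cvgr _ _ _ _ (fun=> 0) (fun n => C k / n%:R)) => //; last exact: cvg_cst.
  by exists 1%N => // n /= n0; rewrite normr_ge0 Hn.
have DE n : D n t = (t k.+1)%:~R^-1 * (err n * pl (fun=> 0) +
    \sum_(l < K | (l.+1 %| k.+1)%N) d%:R ^+ l.+1 * D n (cycle_shift l.+1 t)).
  apply: (mulfI tk0); rewrite mulVKf // /D mulrBr [X in _ - X]mulrA Hl // /err.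
  rewrite mulrBl mulrA mulr_suml mulr_suml -addrA; congr (_ + _).
  rewrite -!sumrN -big_split /=; apply: eq_bigr => l _; ring.
have cvg0M (x : R) (u : nat -> R) : u n @[n --> \oo] --> (0 : R) ->
    x * u n @[n --> \oo] --> (0 : R).
  move=> cu; have c : x * u n @[n --> \oo] --> x * 0 by apply: cvgMr.
  by rewrite mulr0 in c.
rewrite (eq_cvg _ _ DE); apply: (cvg0M _ _ _).
have cS : \sum_(l < K | (l.+1 %| k.+1)%N) d%:R ^+ l.+1 * D n (cycle_shift l.+1 t)
    @[n --> \oo] --> (0 : R); last first.
  have cE : pl (fun=> 0) * err n @[n --> \oo] --> (0 : R) by exact: cvg0M.
  have cDS := cvgD cE cS; rewrite addr0 in cDS.
  rewrite (_ : (fun n => _) = fun n => pl (fun=> 0) * err n +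
    \sum_(l < K | (l.+1 %| k.+1)%N) d%:R ^+ l.+1 * D n (cycle_shift l.+1 t)); first exact: cDS.
  by apply/funext => n; rewrite [X in X + _]mulrC.
have e0 : \sum_(l < K | (l.+1 %| k.+1)%N) 0 = 0 :> R by rewrite big1.
rewrite -[X in _ --> X]e0; apply: cvg_fin_sum => l lk; apply: (cvg0M _ _ _).
have [neg|/forall2NP nn] := pselect (exists2 j, (j < K)%N & cycle_shift l.+1 t j.+1 < 0).
  by rewrite Dneg //; exact: cvg_cst.
apply: IH.
have le j : (j < K)%N -> `|cycle_shift l.+1 t j.+1| <= `|t j.+1|.
  move=> jK; have : 0 <= cycle_shift l.+1 t j.+1.
    by case: (nn j) => // /negP; rewrite -leNgt.
  have := t0 j jK; rewrite /cycle_shift; case: ifP => _; lia.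
have lt : `|cycle_shift l.+1 t l.+1| < `|t l.+1|.
  have : 0 <= cycle_shift l.+1 t l.+1.
    by case: (nn l) => [/(_ (ltn_ord l))//|/negP]; rewrite -leNgt.
  have := t0 l (ltn_ord l); rewrite /cycle_shift dvdnn; lia.
suff h : \sum_(j < K) `|cycle_shift l.+1 t j.+1| < \sum_(j < K) `|t j.+1|.
  by rewrite -ltzD1 (lt_le_trans h) // (le_trans tN) // -addn1.
rewrite (bigD1 l) //= [ltRHS](bigD1 l) //= ltr_leD //.
by apply: ler_sum => j _; exact: le.
Qed.

Lemma revchar_map (A B : comNzRingType) (f : {rmorphism A -> B}) n (M : 'M[A]_n) :
  revchar (map_mx f M) = map_poly f (revchar M).
Proof.
rewrite /revchar -det_map_mx; congr (\det _); apply/matrixP => i j.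
by rewrite !mxE rmorphB rmorphM rmorph_nat /= map_polyX map_polyC.
Qed.

(** * Coefficients of [chi_hat] and the law of the traces *)

Section ChiHat.
Variables (R : realType) (d n : nat).
Hypothesis d_gt0 : (0 < d)%N.
Local Notation Q := {ffun 'I_d -> 'S_n}.
Let s : R := Num.sqrt d%:R.
Let s_gt0 : 0 < s. Proof. by rewrite sqrtr_gt0 ltr0n. Qed.
Let s_neq0 : s != 0. Proof. by rewrite lt0r_neq0. Qed.
Let sqr_s : s ^+ 2 = d%:R. Proof. by rewrite sqr_sqrtr. Qed.

Definition chi_coef (q : Q) k : R := ((revchar (amx q))`_k)%:~R / s ^+ k.+1.

Lemma sum_perm_mxE (q : Q) : sum_perm_mx R q = map_mx (intr : int -> R[i]) (amx q).
Proof.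
rewrite /sum_perm_mx /amx; apply/matrixP => i j; rewrite !mxE !summxE rmorph_sum.
by apply: eq_bigr => c _; rewrite !mxE rmorph_nat.
Qed.

Lemma chi_hatE (q : Q) : chi_hat q = psum_disc (chi_coef q) :> disc_fun R.
Proof.
apply/funext => z; rewrite /chi_hat /psum_disc /sqrtd -/s scalerA -revchar_horner.
rewrite sum_perm_mxE revchar_map.
rewrite (psum_finite (n := size (revchar (amx q)))); last first.
  by move=> k kn; rewrite /chi_coef nth_default // mul0r.
rewrite (@horner_coef_wide _ (size (revchar (amx q)))) ?size_poly // big_distrr /=.
apply: eq_bigr => k _; rewrite coef_map /= /chi_coef.
rewrite rmorphM fmorphV rmorphXn /= rmorph_int exprMn exprVn exprS invfM.
ring.
Qed.

Lemma chi_coef0 (q : Q) k : (size (revchar (amx q)) <= k)%N -> chi_coef q k = 0.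
Proof. by move=> h; rewrite /chi_coef nth_default // mul0r. Qed.

Lemma tame_chi_coef (q : Q) : tame (chi_coef q).
Proof.
apply: tame_le (tame_trunc (size (revchar (amx q))) (chi_coef q)) => k.
by rewrite /trunc_seq; case: ltnP => // h; rewrite chi_coef0.
Qed.

Definition trace_vec K (q : Q) : {ffun 'I_K -> nat} := [ffun j : 'I_K => absz (\tr (amx q ^+ j.+1))].

Definition extend_trace K (c : {ffun 'I_K -> nat}) (j : nat) : int :=
  if insub j.-1 is Some i then (c i)%:Z else 0.

Lemma extend_traceE K (c : {ffun 'I_K -> nat}) (j : 'I_K) : extend_trace c j.+1 = c j.
Proof. by rewrite /extend_trace /= valK. Qed.

(** The coefficient as a function of finitely many traces. The same function serves the Poisson
    side, with [cycle_vec] in place of [trace_vec]. *)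
Definition trace_coef K (c : {ffun 'I_K -> nat}) k : R :=
  expseq (fun j => - (extend_trace c j)%:~R) k / s ^+ k.+1.

Lemma trunc_chi_coef K (q : Q) : trunc_seq K (chi_coef q) = trunc_seq K (trace_coef (trace_vec K q)).
Proof.
apply/funext => k; rewrite /trunc_seq; case: ifP => // kK.
rewrite /chi_coef (revchar_expseq R) /trace_coef; congr (_ / _).
apply: (@eq_expseq _ _ _ k) => // -[//|j] /andP[_ jk]; congr (- _%:~R).
have jK : (j < K)%N by exact: leq_ltn_trans (leq_trans (leqnSn j) jk) kK.
by rewrite (extend_traceE _ (Ordinal jK)) ffunE gez0_abs // trace_ge0.
Qed.

Lemma trace_vecP K (q : Q) (c : {ffun 'I_K -> nat}) :
  (trace_vec K q == c) = trace_event q K (extend_trace c).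
Proof.
apply/eqP/forallP => [<- j|h]; first by rewrite extend_traceE ffunE gez0_abs // trace_ge0.
by apply/ffunP => j; rewrite ffunE (eqP (h j)) extend_traceE.
Qed.

Section Law.
Context (dT : measure_display) (T : measurableType dT) (P : probability T R).
Variable p : 'I_d -> T -> 'S_n.
Hypothesis p_uniform : forall i, uniform_perm P (p i).
Hypothesis p_indep : mutually_independent P setT p.

Definition perm_vec w : Q := [ffun i => p i w].

Lemma perm_vecE q : perm_vec @^-1` [set q] =
  \bigcap_(i in [set` enum 'I_d]) (p i @^-1` [set q i]).
Proof.
apply/seteqP; split => w; rewrite /preimage /perm_vec /=.
  by move=> <- i /= _; rewrite ffunE.
by move=> h; apply/ffunP => i; rewrite ffunE; apply: h; rewrite /= mem_enum.
Qed.

Lemma measurable_perm_vec q : measurable (perm_vec @^-1` [set q]).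
Proof.
rewrite perm_vecE; apply: fin_bigcap_measurable => //= i _.
by case: (p_uniform i (q i)).
Qed.

Lemma perm_vec_law q : P (perm_vec @^-1` [set q]) = (#|Q|%:R^-1)%:E.
Proof.
rewrite perm_vecE p_indep ?enum_uniq // big_enum /=.
rewrite (eq_bigr (fun=> ((n`!)%:R^-1)%:E)); last by move=> i _; case: (p_uniform i (q i)).
rewrite prodEFin prodr_const card_ord card_ffun card_ord.
by rewrite (_ : #|{: 'S_n}| = n`!) ?natrX ?exprVn // card_Sn.
Qed.

Lemma card_Q_gt0 : (0 < #|Q|)%N.
Proof. by apply/card_gt0P; exists [ffun=> 1%g]. Qed.

Lemma mean_perm_vec (f : Q -> R) :
  (\int[P]_w (f (perm_vec w))%:E = (#|Q|%:R^-1 * \sum_q f q)%:E)%E.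
Proof.
have fM q : `|f q| <= \sum_q' `|f q'| by rewrite (bigD1 q) //= lerDl sumr_ge0.
have M0 : 0 <= \sum_q' `|f q'| by apply: sumr_ge0.
have mf : measurable_fun setT (fun w => f (perm_vec w)).
  exact: (measurable_fun_countable measurable_perm_vec).
have PG : (P (~` setT) <= 0%:E)%E by rewrite setCT measure0.
have := @expectation_compare R _ T P _ perm_vec _ f setT (enum {: Q}) _ 0 measurable_perm_vec
  mf measurableT (enum_uniq _) M0 (lexx _) (fun w => fM (perm_vec w)) fM PG.
rewrite mulr0 addr0 big_enum /= => h.
have /h : forall w : T, setT w -> perm_vec w \in enum {: Q} /\
    `|f (perm_vec w) - f (perm_vec w)| <= 0.
  by move=> w _; rewrite mem_enum subrr normr0.
rewrite normr_le0 subr_eq0 => /eqP e.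
rewrite mulr_sumr -(eq_bigr _ (fun q _ => mulrC _ _)).
rewrite -[X in X%:E](_ : (\int[P]_w f (perm_vec w))%R = _); last first.
  by rewrite e; apply: eq_bigr => q _; rewrite perm_vec_law.
rewrite /Rintegral fineK //; apply: integrable_fin_num => //.
apply: (@le_integrable _ _ _ P setT _ _ (EFin \o (fun=> \sum_q' `|f q'|))) => //.
- exact/measurable_EFinP.
- by move=> w _ /=; rewrite lee_fin (le_trans (fM _)) // ler_norm.
- exact: finite_measure_integrable_cst.
Qed.

Lemma trace_vec_law K (c : {ffun 'I_K -> nat}) :
  P ((fun w => trace_vec K (perm_vec w)) @^-1` [set c]) =
  ((trace_count d n K (extend_trace c))%:R / #|Q|%:R)%:E.
Proof.
set A := _ @^-1` _.
have mA : measurable A.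
  exact: (measurable_countable_preimage measurable_perm_vec (trace_vec K @^-1` [set c])).
rewrite -[LHS]mule1 -[in LHS](setIT A) -integral_indic //.
have := mean_perm_vec (fun q => (trace_event q K (extend_trace c))%:R).
rewrite -natr_sum (_ : (\sum_q _)%N = trace_count d n K (extend_trace c)); last first.
  by rewrite /trace_count -sum1_card [RHS]big_mkcond; apply: eq_bigr => q _; rewrite unfold_in /=; case: trace_event.
rewrite mulrC mule1 => <-; apply: eq_integral => w _; rewrite indicE.
congr ((nat_of_bool _)%:R%:E); rewrite -trace_vecP; apply/idP/eqP => [/set_mem //|h]; exact/mem_set.
Qed.

Lemma chi_coef_sqr k : (\int[P]_w (chi_coef (perm_vec w) k ^+ 2)%:E <=
  (d ^ d * (2 * k.+1) ^ d)%:R%:E)%E.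
Proof.
rewrite (mean_perm_vec (fun q => chi_coef q k ^+ 2)) lee_fin mulrC ler_pdivrMr ?ltr0n ?card_Q_gt0 //.
rewrite (eq_bigr (fun q : Q => (d%:R ^+ k.+1)^-1 * (((revchar (amx q))`_k ^+ 2)%:~R))); last first.
  by move=> q _; rewrite /chi_coef exprMn exprVn -exprM mulnC exprM sqr_s mulrC rmorphXn.
rewrite -mulr_sumr -rmorph_sum mulrC ler_pdivrMr ?exprn_gt0 ?ltr0n //.
have := sum_revchar_sqr d n k; rewrite -(ler_int R) => /le_trans; apply.
rewrite rmorph_nat -natrX -!natrM ler_nat /moment_const expnS.
have : (d ^ k <= d * d ^ k)%N by rewrite leq_pmull.
by move=> h; rewrite [leqRHS]mulnAC leq_mul2r leq_mul2l h !orbT.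
Qed.

End Law.
End ChiHat.

Section Truncation.
Variable R : realType.

Lemma near_disc_sym (r e : R) f g : near_disc r e f g -> near_disc r e g f.
Proof. by move=> h z zr; rewrite -normcN opprB; exact: h. Qed.

Lemma near_trunc (a : nat -> R) K r e : tame a -> 0 <= r < 1 ->
  2 * abs_sum (tailseq K a) r < e -> near_disc r e (psum_disc a) (psum_disc (trunc_seq K a)).
Proof.
move=> ta r01 h; apply: near_psum => //; first exact: tame_trunc.
rewrite (_ : (fun k => _) = tailseq K a) //; apply/funext => k.
by rewrite /trunc_seq /tailseq; case: ifP => _; rewrite ?subrr ?subr0.
Qed.

Lemma abs_sum_tail_le (a : nat -> R) J K r : tame a -> 0 <= r < 1 -> (J <= K)%N ->
  abs_sum (tailseq K a) r <= abs_sum (tailseq J a) r.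
Proof.
move=> ta r01 JK; have le k : `|tailseq K a k| <= `|tailseq J a k|.
  rewrite /tailseq; case: ltnP => kK; first by rewrite normr0.
  by rewrite ltnNge (leq_trans JK kK).
have [r0 r1] := andP r01.
by apply: le_abs_sum le; rewrite ?lexx //; exact: tame_tailseq.
Qed.

Lemma cvg_trunc (F : disc_fun R -> R) (a : nat -> R) :
  {within @analytic_disc R, continuous F} -> tame a ->
  F (psum_disc (trunc_seq K a)) @[K --> \oo] --> F (psum_disc a).
Proof.
move=> cF ta; apply/cvgrPdist_lt => e e0.
have [r [dl [r01 d0 near_F]]] := within_continuous_disc cF (analytic_psum ta) e0.
have d20 : 0 < dl / 2 by rewrite divr_gt0.
have [J hJ] := abs_sum_tail_small ta r01 d20.
exists J => // K /= JK; apply: near_F; first exact/analytic_psum/tame_trunc.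
apply: near_trunc => //; have := abs_sum_tail_le ta r01 JK; lra.
Qed.

End Truncation.

(** * Law and measurability of the limit *)

Section Limit.
Context (R : realType) (dT : measure_display) (T : measurableType dT).
Context (P : probability T R) (d : nat) (L : nat -> {RV P >-> nat}).
Hypothesis d_gt0 : (0 < d)%N.
Hypothesis L_poisson : forall l, (1 <= l)%N -> poisson_rv (d%:R ^+ l / l%:R) (L l).
Hypothesis L_indep : mutually_independent P [set l | (1 <= l)%N] (fun l => L l : T -> nat).

Local Notation cvec K := (@count_vec R dT T P L K).
Local Notation lc := (@limit_coef R dT T P d L).

Section Pmf.
Variable K : nat.

Definition cycle_event (t : nat -> int) (c : {ffun 'I_K -> nat}) : bool :=
  [forall j : 'I_K, (cycle_trace j.+1 c)%:Z == t j.+1].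

Lemma cycle_event_add_one (l : 'I_K) t c :
  cycle_event t (add_one l c) = cycle_event (cycle_shift l.+1 t) c.
Proof.
apply: eq_forallb => j; rewrite cycle_trace_add_one /cycle_shift PoszD.
by rewrite [RHS]eq_sym subr_eq [RHS]eq_sym; case: ifP => _; rewrite ?natz.
Qed.

Definition cycle_pmf t : R := @mean _ _ _ P L K (fun c => (cycle_event t c)%:R).

Lemma poly_bounded_bool (b : {ffun 'I_K -> nat} -> bool) :
  poly_bounded (fun c => (b c)%:R : R).
Proof. by exists 1, 0%N => c; rewrite expr0 mulr1; case: (b c); rewrite ?normr1 ?normr0. Qed.

Lemma cycle_pmf_rec t k : (k < K)%N -> (t k.+1)%:~R * cycle_pmf t =
  \sum_(l < K | (l.+1 %| k.+1)%N) d%:R ^+ l.+1 * cycle_pmf (cycle_shift l.+1 t).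
Proof.
move=> kK; have bb t' := poly_bounded_bool (cycle_event t').
rewrite -(@meanZ _ _ _ P d L) //.
rewrite (@eq_mean _ _ _ P L K _ (fun c => (cycle_trace k.+1 c)%:R * (cycle_event t c)%:R)).
  rewrite (mean_trace_stein d_gt0 L_poisson L_indep) //; apply: eq_bigr => l _.
  by congr (_ * _); apply: eq_mean => c; rewrite cycle_event_add_one.
move=> c; case: (boolP (cycle_event t c)) => [/forallP/(_ (Ordinal kK))/eqP /= <-|_].
  by rewrite !mulr1.
by rewrite !mulr0.
Qed.

Lemma mean_bool (b : {ffun 'I_K -> nat} -> bool) :
  @mean _ _ _ P L K (fun c => (b c)%:R) = fine (P [set w | b (cvec K w)]).
Proof.
set A := [set w | _]; have mA : measurable A.
  exact: (measurable_countable_preimage (@measurable_count_vec _ _ _ P L K) [set c | b c]).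
rewrite /mean /Rintegral -(setIT A) -integral_indic //; congr fine.
apply: eq_integral => w _; rewrite indicE; congr ((nat_of_bool _)%:R%:E).
by apply/idP/idP => [h|/set_mem //]; exact/mem_set.
Qed.

Lemma cycle_pmf_ge0_le1 t : 0 <= cycle_pmf t <= 1.
Proof.
rewrite /cycle_pmf mean_bool; set A := [set w | _]; have mA : measurable A.
  exact: (measurable_countable_preimage (@measurable_count_vec _ _ _ P L K) [set c | cycle_event t c]).
rewrite fine_ge0 //= -lee_fin fineK ?fin_num_measure //.
exact: probability_le1.
Qed.

(** The first [K] Poisson variables vanish together with positive probability. This value is the
    divisor when the two laws are normalised. *)
Lemma cycle_pmf0_gt0 : 0 < cycle_pmf (fun=> 0).
Proof.
rewrite /cycle_pmf mean_bool; set A := [set w | _]; have mA : measurable A.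
  exact: (measurable_countable_preimage (@measurable_count_vec _ _ _ P L K) [set c | cycle_event (fun=> 0) c]).
rewrite -lte_fin fineK ?fin_num_measure //.
apply: (@lt_le_trans _ _ (P (cvec K @^-1` [set [ffun=> 0%N]]))).
  by rewrite (count_vec_law L_poisson L_indep) lte_fin poisson_weight_gt0.
apply: le_measure; rewrite ?inE //; first exact: measurable_count_vec.
move=> w /= wc; rewrite /A /= wc; apply/forallP => j.
by rewrite /cycle_trace big1 // => i _; rewrite ffunE muln0.
Qed.

Definition cycle_vec w : {ffun 'I_K -> nat} := [ffun j : 'I_K => cycle_trace j.+1 (cvec K w)].

Lemma measurable_cycle_vec c : measurable (cycle_vec @^-1` [set c]).
Proof.
exact: (measurable_countable_preimage (@measurable_count_vec _ _ _ P L K)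
  [set c' : {ffun 'I_K -> nat} | [ffun j : 'I_K => cycle_trace j.+1 c'] = c]).
Qed.

Lemma cycle_vec_law c : fine (P (cycle_vec @^-1` [set c])) = cycle_pmf (extend_trace c).
Proof.
rewrite /cycle_pmf mean_bool; congr (fine (P _)); apply/seteqP; split => w.
  rewrite /preimage /= => <-; apply/forallP => j.
  by rewrite extend_traceE ffunE.
move=> /forallP h; apply/ffunP => j; rewrite ffunE.
by have /eqP := h j; rewrite extend_traceE => -[].
Qed.

Lemma trunc_limit_coef w : good_event d L w ->
  trunc_seq K (lc^~ w) = trunc_seq K (trace_coef R d (cycle_vec w)).
Proof.
move=> gw; apply/funext => k; rewrite /trunc_seq; case: ifP => // kK.
rewrite (@limit_coefE _ _ _ P d L d_gt0 K) ?(ltnW kK) // /trace_coef; congr (_ / _).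
apply: (@eq_expseq _ _ _ k) => // -[//|j] /andP[_ jk].
have jK : (j < K)%N by exact: leq_ltn_trans (leq_trans (leqnSn j) jk) kK.
by rewrite (extend_traceE _ (Ordinal jK)) ffunE.
Qed.

End Pmf.

Definition limit_flag K k (c : bool * {ffun 'I_K -> nat}) : R :=
  (Num.sqrt d%:R)^-1 * @hcoef_flag R d K k c -
  (if k is k'.+1 then @hcoef_flag R d K k' c else 0).

Lemma trunc_limit_flag K w :
  trunc_seq K (lc^~ w) = trunc_seq K (fun k => limit_flag k (flag_vec d L K w)).
Proof.
apply/funext => k; rewrite /trunc_seq; case: ifP => // kK.
rewrite /limit_coef /limit_flag; case: k kK => [|k] kK.
  by rewrite (@hcoef_goodP _ _ _ P d L d_gt0 K).
by rewrite !(@hcoef_goodP _ _ _ P d L d_gt0 K) // ltnW // ltnW.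
Qed.

Let mflag K c := @measurable_flag_vec _ _ _ P d L K c.

Lemma measurable_limit_coef k : measurable_fun setT (lc k).
Proof.
apply: measurable_funB.
  by apply: measurable_funM => //; exact: measurable_hcoef_good.
by case: k => [|k]; [exact: measurable_cst | exact: measurable_hcoef_good].
Qed.

(** Pointwise limit of truncated versions, each a function of the countable valued [flag_vec]. *)
Lemma measurable_limit_fun (F : disc_fun R -> R) :
  {within @analytic_disc R, continuous F} ->
  measurable_fun setT (fun w => F (psum_disc (lc^~ w))).
Proof.
move=> cF; apply: (measurable_fun_cvg
    (h := fun K w => F (psum_disc (trunc_seq K (lc^~ w))))).
  move=> K; rewrite (_ : (fun w => _) =
    (fun c : bool * {ffun 'I_K -> nat} =>
      F (psum_disc (trunc_seq K (fun k => limit_flag k c)))) \o flag_vec d L K).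
    exact: (measurable_fun_countable (@mflag K)).
  by apply/funext => w; rewrite /= trunc_limit_flag.
by move=> w _; apply: cvg_trunc => //; exact: tame_limit_coef.
Qed.

Lemma measurable_abs_sum_tail K r : 0 <= r < 1 ->
  measurable_fun setT (fun w => abs_sum (tailseq K (lc^~ w)) r).
Proof.
move=> r01; apply: (measurable_fun_cvg
    (h := fun n w => series (fun k => `|tailseq K (lc^~ w) k| * r ^+ k) n)).
  move=> n; rewrite /series /=; apply: measurable_sum => k.
  apply: measurable_funM => //; apply: measurableT_comp => //.
  by rewrite /tailseq; case: (k < K)%N; [exact: measurable_cst | exact: measurable_limit_coef].
by move=> w _; apply: summable_series => //; apply/tame_tailseq/tame_limit_coef.
Qed.

(** The preimage of [U] is a countable union: some truncation, itself a function of a countable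
    valued variable, has a whole neighbourhood in [U], and the neglected tail is smaller than the
    size of that neighbourhood. *)
Lemma random_analytic_limit : random_analytic (fun w => psum_disc (lc^~ w)).
Proof.
split=> [w|U oU]; first exact/analytic_psum/tame_limit_coef.
pose e m : R := m.+1%:R^-1; pose r m : R := 1 - e m.
have e0 m : 0 < e m by rewrite invr_gt0 ltr0n.
have r01 m : 0 <= r m < 1.
  by rewrite subr_ge0 invf_le1 ?ltr0n // ler1n /= ltrBlDr ltrDl.
pose tr K (c : bool * {ffun 'I_K -> nat}) : disc_fun R :=
  psum_disc (trunc_seq K (fun k => limit_flag k c)).
rewrite (_ : _ @^-1` U = \bigcup_m \bigcup_K
  ((flag_vec d L K @^-1` [set c | near_disc (r m) (e m) (tr K c) `<=` U]) `&`
   ~` [set w | e m <= 2 * abs_sum (tailseq K (lc^~ w)) (r m)])).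
  apply: bigcup_measurable => m _; apply: bigcup_measurable => K _; apply: measurableI.
    exact: measurable_countable_preimage (@mflag K) _.
  apply: measurableC.
  have mA := measurable_funM (measurable_cst (2 : R)) (measurable_abs_sum_tail K (r01 m)).
  rewrite (_ : [set w | _] = (fun w => 2 * abs_sum (tailseq K (lc^~ w)) (r m)) @^-1` `[e m, +oo[).
    by rewrite -[X in measurable X]setTI; exact: mA.
  by apply/seteqP; split => w; rewrite /preimage /= in_itv /= andbT.
apply/seteqP; split => w; last first.
  move=> [m _ [K _ []]]; rewrite /preimage /= /tr -trunc_limit_flag => sub /negP.
  rewrite -ltNge => small; apply: sub; apply: near_disc_sym.
  by apply: near_trunc => //; exact: tame_limit_coef.
rewrite /preimage /= => Uw.
have [r' [e' [/andP[r'0 r'1] e'0 sub]]] := nbhs_disc (open_nbhs_nbhs (conj oU Uw)).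
(* [r m] must exceed [r'], and two errors [e m] must fit into [e']: one for the truncation, one for
   the neighbourhood of the truncated function. *)
pose m := maxn (Num.Def.archi_bound (1 - r')^-1) (Num.Def.archi_bound (2 / e')).
have mr : r' <= r m.
  rewrite lerBrDr -lerBrDl invf_ple ?posrE ?subr_gt0 ?ltr0n //.
  rewrite ltW // (lt_le_trans (archi_boundP _)) ?invr_ge0 ?subr_ge0 ?(ltW r'1) //.
  by rewrite ler_nat ltnW // ltnS leq_maxl.
have me : 2 * e m <= e'.
  rewrite mulrC -ler_pdivlMr // invf_ple ?posrE ?ltr0n ?divr_gt0 // invf_div.
  rewrite ltW // (lt_le_trans (archi_boundP _)) ?divr_ge0 ?(ltW e'0) //.
  by rewrite ler_nat ltnW // ltnS leq_maxr.
have em2 : 0 < e m / 2 by rewrite divr_gt0.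
have tl := @tame_limit_coef _ _ _ P d L d_gt0 w.
have [K hK] := abs_sum_tail_small tl (r01 m) em2.
have small : 2 * abs_sum (tailseq K (lc^~ w)) (r m) < e m by lra.
exists m => //; exists K => //; split; rewrite /preimage /=; last by apply/negP; rewrite -ltNge.
rewrite /tr -trunc_limit_flag => g hg; apply: sub => z zr.
have zm : normc (val z) <= r m by exact: le_trans mr.
have h1 := near_trunc tl (r01 m) small zm; have h2 := hg z zm.
have tri := le_normcD (psum_disc (lc^~ w) z - psum_disc (trunc_seq K (lc^~ w)) z)
  (psum_disc (trunc_seq K (lc^~ w)) z - g z).
move: tri; rewrite addrA subrK => tri.
by rewrite (le_lt_trans tri) //; lra.
Qed.

End Limit.

(** * Convergence in law *)

Section Convergence.
Context (R : realType) (d : nat).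
Hypothesis d_gt0 : (0 < d)%N.
Context (dT : nat -> measure_display) (T : forall n, measurableType (dT n)).
Context (P : forall n, probability (T n) R) (p : forall n, 'I_d -> T n -> 'S_n).
Hypothesis p_uniform : forall n i, uniform_perm (P n) (@p n i).
Hypothesis p_indep : forall n, mutually_independent (P n) setT (@p n).
Context (dT' : measure_display) (T' : measurableType dT') (P' : probability T' R).
Context (L : nat -> {RV P' >-> nat}).
Hypothesis L_poisson : forall l, (1 <= l)%N -> poisson_rv (d%:R ^+ l / l%:R) (L l).
Hypothesis L_indep : mutually_independent P' [set l | (1 <= l)%N] (fun l => L l : T' -> nat).

Local Notation Q n := {ffun 'I_d -> 'S_n}.
Local Notation lc := (@limit_coef R dT' T' P' d L).
Let q n (w : T n) : Q n := perm_vec (@p n) w.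
Let s : R := Num.sqrt d%:R.
Let s_gt0 : 0 < s. Proof. by rewrite sqrtr_gt0 ltr0n. Qed.

(** One bound for both second moments: the product dominates the factor [1 + d] of the Poisson side
    and the factor of [chi_coef_sqr]. *)
Definition moment_bound k : nat := ((1 + d) * (d ^ d * (2 * k.+1) ^ d))%N.
Definition coef_bound (e : R) k : R := (moment_bound k)%:R * (k.+1 * k.+2)%:R / e.

Lemma tame_coef_bound e : 0 < e -> tame (coef_bound e).
Proof.
move=> e0; have tS m : tame (fun k => k.+1%:R ^+ m : R).
  elim: m => [|m IH]; first by have := tame_cst (1 : R); congr tame.
  by have := tame_natSmul IH; congr tame; apply/funext => k; rewrite exprS.
apply: (tame_le _ (tameZ (((1 + d) * (d ^ d * 2 ^ d) * 2)%:R / e) (tS (d + 2)%N))) => k.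
rewrite !ger0_norm ?mulr_ge0 ?invr_ge0 ?exprn_ge0 ?(ltW e0) // /coef_bound.
rewrite [leRHS]mulrAC ler_wpM2r ?invr_ge0 ?(ltW e0) // -natrX -!natrM ler_nat.
rewrite /moment_bound expnMn expnD.
have h : (k.+1 * k.+2 <= 2 * k.+1 ^ 2)%N by rewrite expnS expn1; nia.
set u := (1 + d)%N; set v := (d ^ d)%N; set x := (2 ^ d)%N; set y := (k.+1 ^ d)%N.
have -> : (u * (v * x) * 2 * (y * k.+1 ^ 2) = u * (v * (x * y)) * (2 * k.+1 ^ 2))%N by ring.
by rewrite leq_mul2l h orbT.
Qed.

Lemma moment_bound_ge k : (1 + d <= moment_bound k)%N /\
  (d ^ d * (2 * k.+1) ^ d <= moment_bound k)%N.
Proof.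
have h : (0 < d ^ d * (2 * k.+1) ^ d)%N by rewrite muln_gt0 !expn_gt0 d_gt0 muln_gt0.
by rewrite /moment_bound; split; [rewrite leq_pmulr | rewrite leq_pmull].
Qed.

Lemma moment_bound_ge1 k : 1 <= (moment_bound k)%:R :> R.
Proof. by rewrite ler1n (leq_trans _ (proj1 (moment_bound_ge k))). Qed.

Definition bounded_coef (e : R) (x : nat -> R) : Prop := forall k, `|x k| <= coef_bound e k.

Let mq n := measurable_perm_vec (@p_uniform n).

Lemma prob_bounded_chi n e : 0 < e <= 1 ->
  measurable (@q n @^-1` [set r | bounded_coef e (chi_coef R r)]) /\
  (P n (~` (@q n @^-1` [set r | bounded_coef e (chi_coef R r)])) <= e%:E)%E.
Proof.
move=> e01; split; first exact: measurable_countable_preimage (@mq n) _.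
have mx k : measurable_fun setT (fun w => chi_coef R (@q n w) k).
  exact: (measurable_fun_countable (@mq n) (fun r => chi_coef R r k)).
have hM k : (\int[P n]_w (chi_coef R (@q n w) k ^+ 2)%:E <= ((moment_bound k)%:R)%:E)%E.
  apply: (le_trans (chi_coef_sqr d_gt0 (@p_uniform n) (@p_indep n) k)).
  by rewrite lee_fin ler_nat (proj2 (moment_bound_ge k)).
have := union_tail_probability (x := fun k w => chi_coef R (@q n w) k) mx hM
  moment_bound_ge1 e01.
congr (_ <= _)%E; congr (P n _); apply/seteqP; split => w.
  by move=> [k _ /= h] /(_ k); rewrite leNgt h.
by move=> /existsNP[k /negP]; rewrite -ltNge => h; exists k.
Qed.

Definition limit_good e := good_event d L `&` [set w | bounded_coef e (lc^~ w)].

Lemma prob_limit_good e : 0 < e <= 1 ->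
  measurable (limit_good e) /\ (P' (~` limit_good e) <= e%:E)%E.
Proof.
move=> e01; pose U := \bigcup_k [set w | coef_bound e k < `|lc k w|].
have mU : measurable U.
  apply: bigcup_measurable => k _; apply: measurable_gt_normr.
  exact: measurable_limit_coef.
have GE : limit_good e = good_event d L `&` ~` U.
  congr (_ `&` _); apply/seteqP; split => w.
    by move=> h [k _ /=]; rewrite ltNge h.
  by move=> nU k; rewrite leNgt; apply/negP => h; apply: nU; exists k.
have mg : measurable (good_event d L) by exact: measurable_good_event.
split; first by rewrite GE; apply: measurableI => //; exact: measurableC.
have hM k : (\int[P']_w (lc k w ^+ 2)%:E <= ((moment_bound k)%:R)%:E)%E.
  apply: (le_trans (limit_coef_sqr d_gt0 L_poisson L_indep k)).
  by rewrite lee_fin -(natrD R 1 d) ler_nat (proj1 (moment_bound_ge k)).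
have hU : (P' U <= e%:E)%E.
  apply: (union_tail_probability _ hM moment_bound_ge1 e01).
  by move=> k; exact: measurable_limit_coef.
rewrite GE setCI setCK.
apply: (le_trans (measureU2 _ _ _)) => //; first exact: measurableC.
by rewrite [X in (X + _)%E](probability_good_event d_gt0 L_poisson L_indep) add0e.
Qed.

Definition count_box K M : seq {ffun 'I_K -> nat} :=
  [seq [ffun j => nat_of_ord (u j)] | u : {ffun 'I_K -> 'I_M.+1}].

Lemma count_box_uniq K M : uniq (count_box K M).
Proof.
rewrite map_inj_uniq ?enum_uniq // => u v /ffunP uv; apply/ffunP => j.
by apply: val_inj; have := uv j; rewrite !ffunE.
Qed.

Lemma mem_count_box K M (c : {ffun 'I_K -> nat}) : (forall j, (c j <= M)%N) ->
  c \in count_box K M.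
Proof.
move=> cM; apply/fintype.imageP; exists [ffun j => inord (c j)] => //.
by apply/ffunP => j; rewrite !ffunE inordK // ltnS.
Qed.

(** By [newton_bound], bounded coefficients force bounded traces. These are natural numbers in both
    models, so one finite box, independent of [n], contains them. *)
Lemma box_of_bounded_coef K e : 0 < e -> exists M,
  (forall n (r : Q n), bounded_coef e (chi_coef R r) -> trace_vec K r \in count_box K M) /\
  (forall w, limit_good e w -> cycle_vec L K w \in count_box K M).
Proof.
move=> e0; have [M MP] := newton_bound (fun k => coef_bound e k * s ^+ k.+1) K.
have unscale k (g x : R) : x = g / s ^+ k.+1 -> `|x| <= coef_bound e k ->
    `|g| <= coef_bound e k * s ^+ k.+1.
  move=> -> h; have sk : 0 < s ^+ k.+1 by rewrite exprn_gt0.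
  by rewrite -ler_pdivrMr // (le_trans _ h) // normrM normfV (gtr0_norm sk).
exists M; split=> [n r br|w [gw bw]]; apply: mem_count_box => j; rewrite ffunE.
  rewrite -(ler_nat R) natr_absz intr_norm -normrN.
  have := MP (fun j => - (\tr (amx r ^+ j))%:~R) _ j.+1.
  rewrite ltn_ord => h; apply: h => //.
  by move=> k kK; rewrite -revchar_expseq; apply: (unscale _ _ _ erefl); exact: br.
have := MP (fun j => - (cycle_trace j (count_vec L K w))%:R) _ j.+1.
rewrite ltn_ord /= normrN normr_nat ler_nat; apply=> // k kK.
apply: (unscale _ _ _ (limit_coefE d_gt0 kK gw)); exact: bw.
Qed.

Section FixedK.
Variable K : nat.
Let pn n t : R := (trace_count d n K t)%:R / #|{: Q n}|%:R.
Let pl := @cycle_pmf R dT' T' P' L K.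

Let pn01 n t : 0 <= pn n t <= 1.
Proof.
have Q0 : 0 < #|{: Q n}|%:R :> R by rewrite ltr0n card_Q_gt0.
by rewrite divr_ge0 //= ler_pdivrMr // mul1r ler_nat /trace_count max_card.
Qed.

(** [trace_stein], divided by the number of tuples, is the approximate recursion with error of order
    [1 / n]; [cycle_pmf_rec] is the exact one. *)
Lemma pmf_cross_cvg t :
  pn n t * pl (fun=> 0) - pl t * pn n (fun=> 0) @[n --> \oo] --> (0 : R).
Proof.
apply: (@stein_unique R d K pn pl (fun k => ((d ^ k).*2.+2 * error_const d K)%:R)).
- move=> n t' k n0 kK; have := trace_stein d n t' kK.
  set X : int := _ - _; rewrite -(ler_int R) => h.
  have Q0 : 0 < #|{: Q n}|%:R :> R by rewrite ltr0n card_Q_gt0.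
  have -> : (t' k.+1)%:~R * pn n t' - \sum_(l < K | (l.+1 %| k.+1)%N)
      d%:R ^+ l.+1 * pn n (cycle_shift l.+1 t') = X%:~R / #|{: Q n}|%:R :> R.
    rewrite /X rmorphB rmorphM /= rmorph_nat mulrBl rmorph_sum mulr_suml -mulrA; congr (_ - _).
    by apply: eq_bigr => l _; rewrite rmorphM /= !rmorph_nat natrX mulrA.
  rewrite normrM normfV (gtr0_norm Q0) ler_pdivrMr // mulrAC ler_pdivlMr ?ltr0n //.
  move: h; rewrite rmorphM /= intr_norm !rmorph_nat natrM [leRHS]natrM => h.
  by rewrite (le_trans _ h) // mulrC -mulrA ler_peMl ?mulr_ge0 // ler1n.
- exact: cycle_pmf_rec.
- move=> n t' j jK tj; rewrite /pn /trace_count eq_card0 ?mul0r // => r; rewrite unfold_in /=.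
  apply/negbTE/negP => /forallP/(_ (Ordinal jK))/eqP /= trE.
  by have := trace_ge0 r j; rewrite trE leNgt tj.
- move=> t' j jK tj; rewrite /pl /cycle_pmf -[RHS](@mean_cst R dT' T' P' L K 0); apply: eq_mean => c.
  case: (boolP (cycle_event t' c)) => // /forallP/(_ (Ordinal jK))/eqP /= trE.
  by move: tj; rewrite -trE.
- move=> n t1 t2 t12; rewrite /pn /trace_count; congr (_%:R / _); apply: eq_card => r.
  by rewrite !unfold_in /=; apply: eq_forallb => j; rewrite t12.
- move=> t1 t2 t12; apply: eq_mean => c; congr ((nat_of_bool _)%:R).
  by apply: eq_forallb => j; rewrite t12.
Qed.

Lemma count_box_sum_cvg M (Phi : {ffun 'I_K -> nat} -> R) :
  (forall c : {ffun 'I_K -> nat},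
     pn n (extend_trace c) @[n --> \oo] --> pl (extend_trace c)) ->
  \sum_(c <- count_box K M) Phi c * pn n (extend_trace c) @[n --> \oo] -->
  \sum_(c <- count_box K M) Phi c * pl (extend_trace c).
Proof. by move=> h; apply: cvg_fin_sum => c _; apply: cvgMr; exact: h. Qed.

Lemma compare_finite n (f : T n -> R) (Phi : {ffun 'I_K -> nat} -> R) M N e : 0 < e <= 1 -> measurable_fun setT f ->
  0 <= N -> (forall w, `|f w| <= N) -> (forall c, `|Phi c| <= N) ->
  (forall w, bounded_coef e (chi_coef R (q w)) ->
     trace_vec K (q w) \in count_box K M /\ `|f w - Phi (trace_vec K (q w))| <= e) ->
  `|(\int[P n]_w f w)%R - \sum_(c <- count_box K M) Phi c * pn n (extend_trace c)|
     <= e + 2 * N * e.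
Proof.
move=> e01 mf N0 fN PhiN h; have [mG PG] := prob_bounded_chi n e01.
have mt c : measurable ((fun w => trace_vec K (@q n w)) @^-1` [set c]).
  exact: (measurable_countable_preimage (@mq n) (trace_vec K @^-1` [set c])).
have e0 : 0 <= e by case/andP: e01 => /ltW.
have := expectation_compare mt mf mG (count_box_uniq K M) N0 e0 fN PhiN PG h.
congr (`|_ - _| <= _); apply: eq_bigr => c _; congr (_ * _).
by rewrite (trace_vec_law (@p_uniform n) (@p_indep n)).
Qed.

Lemma compare_limit (f : T' -> R) (Phi : {ffun 'I_K -> nat} -> R) M N e : 0 < e <= 1 -> measurable_fun setT f ->
  0 <= N -> (forall w, `|f w| <= N) -> (forall c, `|Phi c| <= N) ->
  (forall w, limit_good e w ->
     cycle_vec L K w \in count_box K M /\ `|f w - Phi (cycle_vec L K w)| <= e) ->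
  `|(\int[P']_w f w)%R - \sum_(c <- count_box K M) Phi c * pl (extend_trace c)|
     <= e + 2 * N * e.
Proof.
move=> e01 mf N0 fN PhiN h; have [mG PG] := prob_limit_good e01.
have e0 : 0 <= e by case/andP: e01 => /ltW.
have := expectation_compare (@measurable_cycle_vec _ _ _ P' L K) mf mG
  (count_box_uniq K M) N0 e0 fN PhiN PG h.
congr (`|_ - _| <= _); apply: eq_bigr => c _; congr (_ * _).
exact: cycle_vec_law.
Qed.

(** What is missing is the convergence of the values at 0. Summing [pmf_cross_cvg] over a box which
    carries almost all the mass of both laws replaces the two sums by 1 and compares [pn n 0] with
    [pl 0]; the cross difference at [c] is then divided by [pl 0 > 0]. *)
Lemma pmf_cvg (c : {ffun 'I_K -> nat}) : pn n (extend_trace c) @[n --> \oo] --> pl (extend_trace c).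
Proof.
have pl0 : 0 < pl (fun=> 0) by exact: (cycle_pmf0_gt0 L_poisson L_indep K).
have pl01 t : 0 <= pl t <= 1 by exact: cycle_pmf_ge0_le1.
have c0 : pn n (fun=> 0) @[n --> \oo] --> pl (fun=> 0).
  apply/cvgrPdist_le => e e0.
  (* Both masses are within [3 e'] of 1 and the cross difference is within [e / 2] of 0; the total
     [6 e' + e / 2] is at most [e]. *)
  pose e' := Num.min 1 (e / 12); have e'0 : 0 < e' by rewrite lt_min ltr01 divr_gt0.
  have e'1 : e' <= 1 by rewrite ge_min lexx.
  have e'e : 12 * e' <= e by rewrite mulrC -ler_pdivlMr // ge_min lexx orbT.
  have e'01 : 0 < e' <= 1 by rewrite e'0.
  have [M [Mn Ml]] := box_of_bounded_coef K e'0.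
  pose Sn n := \sum_(c <- count_box K M) pn n (extend_trace c).
  pose Sl := \sum_(c <- count_box K M) pl (extend_trace c).
  have int1 (dU : measure_display) (U : measurableType dU) (PU : probability U R) :
    (\int[PU]_w (1 : R))%R = 1 by rewrite Rintegral_cst //= probability_setT /= mulr1.
  have hSn n : `|1 - Sn n| <= 3 * e'.
    have := @compare_finite n (fun=> 1) (fun=> 1) M 1 e' e'01 (measurable_cst _) ler01.
    rewrite int1 normr1 mulr1 => /(_ (fun=> lexx _) (fun=> lexx _)).
    under eq_bigr do rewrite mul1r.
    move=> h; apply: (le_trans (h _)); last by lra.
    by move=> w bw; rewrite subrr normr0 (ltW e'0); split => //; exact: Mn.
  have hSl : `|1 - Sl| <= 3 * e'.
    have := @compare_limit (fun=> 1) (fun=> 1) M 1 e' e'01 (measurable_cst _) ler01.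
    rewrite int1 normr1 mulr1 => /(_ (fun=> lexx _) (fun=> lexx _)).
    under eq_bigr do rewrite mul1r.
    move=> h; apply: (le_trans (h _)); last by lra.
    by move=> w bw; rewrite subrr normr0 (ltW e'0); split => //; exact: Ml.
  have cD : Sn n * pl (fun=> 0) - Sl * pn n (fun=> 0) @[n --> \oo] --> (0 : R).
    have c0 := @cvg_fin_sum R _ (count_box K M) xpredT
      (fun c n => pn n (extend_trace c) * pl (fun=> 0) - pl (extend_trace c) * pn n (fun=> 0))
      (fun=> 0) (fun c _ => pmf_cross_cvg (extend_trace c)).
    rewrite (_ : (fun n => _) = fun n => \sum_(c <- count_box K M)
      (pn n (extend_trace c) * pl (fun=> 0) - pl (extend_trace c) * pn n (fun=> 0))).
      by move: c0; rewrite big1.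
    by apply/funext => n; rewrite /Sn /Sl !mulr_suml -sumrB.
  have e60 : 0 < e / 2 by rewrite divr_gt0.
  move/cvgrPdist_le/(_ _ e60): cD; apply: filterS => n; rewrite sub0r normrN => hD.
  have p0 := pl01 (fun=> 0); have pn0 := pn01 n (fun=> 0).
  move: (hSn n) hSl hD p0 pn0.
  set x := pl _; set y := pn _ _; set a := Sn n; set b := Sl => h1 h2 h3 /andP[x0 x1] /andP[y0 y1].
  have -> : x - y = (a * x - b * y) + (1 - a) * x - (1 - b) * y by ring.
  rewrite (le_trans (ler_normB _ _)) // (le_trans (lerD (ler_normD _ _) (lexx _))) //.
  have hx : `|(1 - a) * x| <= 3 * e'.
    by rewrite normrM (ger0_norm x0) (le_trans _ h1) // ler_piMr.
  have hy : `|(1 - b) * y| <= 3 * e'.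
    by rewrite normrM (ger0_norm y0) (le_trans _ h2) // ler_piMr.
  by lra.
have cD := pmf_cross_cvg (extend_trace c).
have c1 : pl (extend_trace c) * pn n (fun=> 0) @[n --> \oo] -->
    pl (extend_trace c) * pl (fun=> 0) by apply: cvgMr.
have c2 : (pn n (extend_trace c) * pl (fun=> 0) - pl (extend_trace c) * pn n (fun=> 0) +
    pl (extend_trace c) * pn n (fun=> 0)) / pl (fun=> 0) @[n --> \oo] -->
    (0 + pl (extend_trace c) * pl (fun=> 0)) / pl (fun=> 0).
  by apply: cvgMl; exact: cvgD cD c1.
rewrite add0r mulfK ?gt_eqF // in c2.
rewrite (_ : (fun n => _) = fun n => (pn n (extend_trace c) * pl (fun=> 0) -
  pl (extend_trace c) * pn n (fun=> 0) + pl (extend_trace c) * pn n (fun=> 0)) / pl (fun=> 0)) //.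
by apply/funext => n; rewrite subrK mulfK // gt_eqF.
Qed.

End FixedK.

Lemma chi_hat_perm_vec n (w : T n) : chi_hat (fun i => @p n i w) = psum_disc (chi_coef R (q w)).
Proof.
have -> : (fun i => @p n i w) = (q w : 'I_d -> 'S_n) by apply/funext => i; rewrite ffunE.
exact: chi_hatE.
Qed.

(** On the good events [uniform_truncation] replaces [F] by a function [Phi] of finitely many
    traces, with one [K] for all [n]. The comparison lemmas reduce both expectations to sums over
    the box, which converge by [pmf_cvg]. *)
Lemma limit_law (F : disc_fun R -> R) M : {within @analytic_disc R, continuous F} ->
  (forall f, analytic_disc f -> `|F f| <= M) ->
  (\int[P n]_w F (psum_disc (chi_coef R (@q n w))))%R @[n --> \oo] -->
  (\int[P']_w F (psum_disc (lc^~ w)))%R.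
Proof.
move=> cF FM; have M0 : 0 <= M.
  by apply: le_trans (FM _ (analytic_psum (tame_cst 0))).
(* Each of the two comparisons costs [e' + 2 M e'], at most [e / 4]; the finite sums differ by at
   most [e / 2]. *)
apply/cvgrPdist_le => e e0; pose D := 4 * (1 + 2 * M); have D0 : 0 < D by rewrite mulr_gt0 // ltr_wpDr ?mulr_ge0.
pose e' := Num.min 1 (e / D); have e'0 : 0 < e' by rewrite lt_min ltr01 divr_gt0.
have e'1 : e' <= 1 by rewrite ge_min lexx.
have e'e : e' * D <= e by rewrite -ler_pdivlMr // ge_min lexx orbT.
have e'01 : 0 < e' <= 1 by rewrite e'0.
have [K KP] := uniform_truncation (tame_coef_bound e'0) cF e'0.
pose Phi (c : {ffun 'I_K -> nat}) := F (psum_disc (trunc_seq K (trace_coef R d c))).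
have PhiM c : `|Phi c| <= M by apply: FM; exact/analytic_psum/tame_trunc.
have [B [Bn Bl]] := box_of_bounded_coef K e'0.
have hn n := @compare_finite K n (fun w => F (psum_disc (chi_coef R (q w)))) Phi B M e' e'01
  (measurable_fun_countable (@mq n) (fun r => F (psum_disc (chi_coef R r)))) M0
  (fun w => FM _ (analytic_psum (@tame_chi_coef R d n (q w)))) PhiM.
have hl := @compare_limit K (fun w => F (psum_disc (lc^~ w))) Phi B M e' e'01
  (measurable_limit_fun L d_gt0 cF) M0
  (fun w => FM _ (analytic_psum (@tame_limit_coef _ _ _ P' d L d_gt0 w))) PhiM.
have {}hl : `|(\int[P']_w F (psum_disc (lc^~ w)))%R -
    \sum_(c <- count_box K B) Phi c * @cycle_pmf R dT' T' P' L K (extend_trace c)| <= e' + 2 * M * e'.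
  apply: hl => w gw; split; first exact: Bl.
  rewrite /Phi -(trunc_limit_coef d_gt0 K (proj1 gw)); apply: KP => //.
  exact: (proj2 gw).
have cS := @count_box_sum_cvg K B Phi (@pmf_cvg K).
have e20 : 0 < e / 2 by rewrite divr_gt0.
move/cvgrPdist_le/(_ _ e20): cS; apply: filterS => n hS.
have {}hn := hn n; move: hn hl hS.
set a := (\int[P n]_w _)%R; set b := (\int[P']_w _)%R; set x := \sum_(_ <- _) _; set y := \sum_(_ <- _) _.
move=> hn hl hS; have {}hn : `|a - x| <= e' + 2 * M * e'.
  apply: hn => w bw; split; first exact: Bn.
  by rewrite /Phi -trunc_chi_coef; exact: KP.
rewrite (_ : b - a = (b - y) + (y - x) - (a - x)); last by ring.
rewrite (le_trans (ler_normB _ _)) // (le_trans (lerD (ler_normD _ _) (lexx _))) //.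
have : e' * D = 4 * (e' + 2 * M * e') by rewrite /D; ring.
by lra.
Qed.

End Convergence.

Theorem theorem2p2 (R : realType) (d : nat) (d_ge1 : (1 <= d)%N)
  (dT : nat -> measure_display) (T : forall n, measurableType (dT n))
  (P : forall n, probability (T n) R)
  (p : forall n, 'I_d -> T n -> 'S_n)
  (p_uniform : forall n i, uniform_perm (P n) (p n i))
  (p_indep : forall n, mutually_independent (P n) setT (p n))
  (dT' : measure_display) (T' : measurableType dT') (P' : probability T' R)
  (L : nat -> {RV P' >-> nat})
  (L_poisson : forall l, (1 <= l)%N -> poisson_rv (d%:R ^+ l / l%:R) (L l))
  (L_indep : mutually_independent P' [set l | (1 <= l)%N]
     (fun l => L l : T' -> nat)) :
  cvg_in_law P (fun n w => chi_hat (fun i => p n i w)) P' (limit_fun d L).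
Proof.
have limE : limit_fun d L = fun w => psum_disc ((@limit_coef R dT' T' P' d L)^~ w).
  by apply/funext => w; exact: limit_funE.
have chiE n : (fun w => chi_hat (fun i => p n i w)) =
    fun w => psum_disc (chi_coef R (perm_vec (p n) w)).
  by apply/funext => w; exact: chi_hat_perm_vec.
have mq n := measurable_perm_vec (p_uniform n).
rewrite /cvg_in_law limE; split.
- move=> n; rewrite chiE; split=> [w|U oU]; first exact/analytic_psum/tame_chi_coef.
  exact: (measurable_countable_preimage (mq n) ((fun r => psum_disc (chi_coef R r)) @^-1` U)).
- exact: random_analytic_limit.
move=> F cF [M FM].
have expE (dU : measure_display) (U : measurableType dU) (PU : probability U R) (f : U -> R) :
    measurable_fun setT f -> (forall w, `|f w| <= M) ->
    'E_PU[f]%E = ((\int[PU]_w f w)%R)%:E.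
  move=> mf fM; rewrite unlock /Rintegral fineK //; apply: integrable_fin_num => //.
  apply: (@le_integrable _ _ _ PU setT _ _ (EFin \o (fun=> M))) => //.
  - exact/measurable_EFinP.
  - by move=> w _ /=; rewrite lee_fin (le_trans (fM w)) // ler_norm.
  - exact: finite_measure_integrable_cst.
rewrite expE; last 2 first.
- exact: measurable_limit_fun.
- by move=> w; apply: FM; exact/analytic_psum/tame_limit_coef.
rewrite (_ : (fun n => _) = fun n =>
    ((\int[P n]_w F (psum_disc (chi_coef R (perm_vec (p n) w))))%R)%:E); last first.
  apply/funext => n; rewrite -expE; last 2 first.
  - exact: (measurable_fun_countable (mq n) (fun r => F (psum_disc (chi_coef R r)))).
  - by move=> w; apply: FM; exact/analytic_psum/tame_chi_coef.
  by congr ('E_(P n)[_]%E); apply/funext => w; congr F; exact: chi_hat_perm_vec.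
apply: cvg_EFin; first exact: nearW.
exact: (limit_law d_ge1 p_uniform p_indep L_poisson L_indep cF FM).
Qed.
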